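(* Let $G:(\mathbb{R}^{m},0)\to(\mathbb{R}^{p},0)$, $m>p\ge 2$, be a non-constant analytic nice map germ with radial discriminant, satisfying the condition (inclusion of set germs at the origin) $$\overline{M(G)\setminus G^{-1}(\operatorname{Disc} G)}\cap V_G\subseteq\{0\}.$$ If $\Psi_G=G/\|G\|$ is $\rho$-regular, i.e. $M(\Psi_G)\subset G^{-1}(\operatorname{Disc} G)$, then $G$ has a Milnor-Hamm sphere fibration.
   Context: $B^m_\varepsilon$ is the open ball and $S^{m-1}_\varepsilon$ the sphere of radius $\varepsilon$ centred at $0$ in $\mathbb{R}^m$. $V_G:=G^{-1}(0)$. $\operatorname{Sing}G$ is the set of points where the differential of $G$ has rank $<p$. Nice: a non-constant analytic map germ $G$ is called nice if the images $G(\operatorname{Sing}G)$ and $\operatorname{Im}G$ are well defined as germs at $0$ of subanalytic sets (i.e. the germs at $0$ of $G(\operatorname{Sing}G\cap B^m_\varepsilon)$ and $G(B^m_\varepsilon)$ do not depend on the small $\varepsilon>0$). Discriminant: $\operatorname{Disc}G:=\overline{G(\operatorname{Sing}G)}\cup\partial\overline{\operatorname{Im}G}$, where $\partial\overline{\operatorname{Im}G}:=\overline{\operatorname{Im}G}\setminus\operatorname{int}(\operatorname{Im}G)$ and $\operatorname{int}$ is the $p$-dimensional interior in $\mathbb{R}^p$. It is radial if it is the germ of a real cone with vertex at the origin (a union of real half-lines at the origin), or just the origin; the cone is then used as its representative. Milnor set: with $U$ a neighbourhood of $0$ and $\rho:U\to\mathbb{R}_{\ge0}$ the square of the Euclidean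 distance to $0$, $M(G)$ is the set germ at $0$ of $\overline{\{x\in U : \rho\not\pitchfork_x G\}}$, where $\rho\not\pitchfork_xG$ means that $\rho$ and $G$ are not transversal at $x$ (the map $(\rho,G)$ has rank $<p+1$ at $x$). For $\Psi_G:=G/\|G\|:U\setminus V_G\to S^{p-1}_1$, $M(\Psi_G)$ is defined in the same way (closure of the set of points where $(\rho,\Psi_G)$ has rank $<p$), as a set germ at $0$. Milnor-Hamm sphere fibration: $G$ (nice, with radial discriminant) has a Milnor-Hamm sphere fibration if the restriction $\Psi_{G|}:S^{m-1}_\varepsilon\setminus G^{-1}(\operatorname{Disc}G)\to S^{p-1}_1\setminus\operatorname{Disc}G$ is a locally trivial smooth fibration which is independent, up to diffeomorphisms, of the choice of $\varepsilon>0$ provided it is small enough. (Fibres over some connected components of the base may be empty.) *)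

(* Defs.v *)
From HB Require Import structures.
From mathcomp Require Import all_boot all_order all_algebra.
From mathcomp Require Import all_classical all_reals all_analysis.
From mathcomp Require summability.
Set Implicit Arguments.
Unset Strict Implicit.
Unset Printing Implicit Defensive.
Import Order.TTheory GRing.Theory Num.Theory.
Import numFieldNormedType.Exports.
Local Open Scope classical_set_scope.
Local Open Scope ring_scope.

(* The library norm on row vectors is the sup norm; it induces the usual
   topology, but spheres and balls have to be the Euclidean ones. *)
Definition sqnorm (R : realType) (n : nat) (x : 'rV[R]_n) : R :=
  \sum_(i < n) x ord0 i ^+ 2.

Definition enorm (R : realType) (n : nat) (x : 'rV[R]_n) : R :=
  Num.sqrt (sqnorm x).

Definition eball (R : realType) (n : nat) (e : R) : set 'rV[R]_n :=
  [set x | enorm x < e].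

Definition esphere (R : realType) (n : nat) (e : R) : set 'rV[R]_n :=
  [set x | enorm x = e].

Arguments eball {R} n e _.
Arguments esphere {R} n e _.

Definition germ_eq (R : realType) (n : nat) (A B : set 'rV[R]_n) : Prop :=
  \forall x \near (0 : 'rV[R]_n), A x <-> B x.

Definition germ_sub (R : realType) (n : nat) (A B : set 'rV[R]_n) : Prop :=
  \forall x \near (0 : 'rV[R]_n), A x -> B x.

(* G is near a the sum of a power series in the multi-indices
   alpha : {ffun 'I_m -> nat}.  Convergence is along the filter of finite sets
   of multi-indices, i.e. unconditional, hence absolute. *)
Definition analytic_at (R : realType) (m p : nat)
    (G : 'rV[R]_m -> 'rV[R]_p) (a : 'rV[R]_m) : Prop :=
  exists c : {ffun 'I_m -> nat} -> 'rV[R]_p,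
  \forall x \near a,
    summability.partial_sum (fun alpha : {ffun 'I_m -> nat} =>
      (\prod_(i < m) ((x : 'rV[R]_m) ord0 i - a ord0 i) ^+ alpha i) *: c alpha)
    @ summability.totally --> G x.

(* A germ (R^m,0) -> (R^p,0) is represented by a total function; only its
   values near 0 matter in what follows. *)
Definition analytic_germ (R : realType) (m p : nat)
    (G : 'rV[R]_m -> 'rV[R]_p) : Prop :=
  G 0 = 0 /\ \forall a \near (0 : 'rV[R]_m), analytic_at G a.

Definition nonconstant_germ (R : realType) (m p : nat)
    (G : 'rV[R]_m -> 'rV[R]_p) : Prop :=
  ~ exists c : 'rV[R]_p, \forall x \near (0 : 'rV[R]_m), G x = c.

Definition zero_set (R : realType) (m p : nat)
    (G : 'rV[R]_m -> 'rV[R]_p) : set 'rV[R]_m := [set x | G x = 0].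

Definition sing (R : realType) (m p : nat)
    (G : 'rV[R]_m -> 'rV[R]_p) : set 'rV[R]_m :=
  [set x | (\rank ('J G x) < p)%N].

(* For an analytic germ and small e these images are automatically
   subanalytic, so being well defined is the only requirement. *)
Definition nice (R : realType) (m p : nat)
    (G : 'rV[R]_m -> 'rV[R]_p) : Prop :=
  exists2 e0 : R, 0 < e0 & forall e1 e2 : R, 0 < e1 < e0 -> 0 < e2 < e0 ->
    germ_eq (G @` (sing G `&` eball m e1)) (G @` (sing G `&` eball m e2)) /\
    germ_eq (G @` eball m e1) (G @` eball m e2).

Definition disc (R : realType) (m p : nat)
    (G : 'rV[R]_m -> 'rV[R]_p) (e : R) : set 'rV[R]_p :=
  closure (G @` (sing G `&` eball m e)) `|`
  (closure (G @` eball m e) `\` interior (G @` eball m e)).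

Definition real_cone (R : realType) (n : nat) (C : set 'rV[R]_n) : Prop :=
  C 0 /\ forall (t : R) (y : 'rV[R]_n), 0 < t -> C y -> C (t *: y).

(* The discriminant is radial, with C the representing cone.  C is unique, as
   two cones with the same germ at 0 are equal; C = [set 0] is the case where
   the discriminant is just the origin. *)
Definition radial_disc (R : realType) (m p : nat)
    (G : 'rV[R]_m -> 'rV[R]_p) (C : set 'rV[R]_p) : Prop :=
  real_cone C /\ \forall e \near (0 : R)^'+, germ_eq (disc G e) C.

Definition with_sqnorm (R : realType) (m p : nat)
    (F : 'rV[R]_m -> 'rV[R]_p) (x : 'rV[R]_m) : 'rV[R]_(1 + p) :=
  row_mx (sqnorm x)%:M (F x).

Definition milnor_set (R : realType) (m p : nat)
    (G : 'rV[R]_m -> 'rV[R]_p) : set 'rV[R]_m :=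
  closure [set x | (\rank ('J (with_sqnorm G) x) < p.+1)%N].

Definition psi (R : realType) (m p : nat)
    (G : 'rV[R]_m -> 'rV[R]_p) (x : 'rV[R]_m) : 'rV[R]_p :=
  (enorm (G x))^-1 *: G x.

(* psi takes its values in a (p-1)-dimensional sphere, hence p, not p.+1. *)
Definition milnor_set_psi (R : realType) (m p : nat)
    (G : 'rV[R]_m -> 'rV[R]_p) : set 'rV[R]_m :=
  closure (~` zero_set G `&`
           [set x | (\rank ('J (with_sqnorm (psi G)) x) < p)%N]).

Definition rho_regular (R : realType) (m p : nat)
    (G : 'rV[R]_m -> 'rV[R]_p) (C : set 'rV[R]_p) : Prop :=
  germ_sub (milnor_set_psi G) (G @^-1` C).

(* f is of class C^k on O; meant for open O. *)
Fixpoint class_C (R : realType) (V W : normedModType R) (k : nat)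
    (O : set V) (f : V -> W) : Prop :=
  if k is k'.+1 then
    (forall x, O x -> differentiable f x) /\
    (forall v : V, class_C k' O (fun x => 'D_v f x))
  else forall x, O x -> {for x, continuous f}.

(* Smoothness on an arbitrary subset: local C^oo extensions to open sets.  On
   a submanifold this is the intrinsic notion. *)
Definition smooth_on (R : realType) (V W : normedModType R)
    (A : set V) (f : V -> W) : Prop :=
  forall x, A x -> exists (O : set V) (g : V -> W),
    [/\ open O, O x, (forall k, class_C k O g)
      & forall y, A y -> O y -> g y = f y].

Definition diffeomorphism (R : realType) (V W : normedModType R)
    (A : set V) (B : set W) (h : V -> W) : Prop :=
  exists g : W -> V,
    [/\ smooth_on A h, smooth_on B g,
        (forall x, A x -> B (h x) /\ g (h x) = x)
      & (forall y, B y -> A (g y) /\ h (g y) = y)].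

(* Over a neighbourhood of y, the typical fibre may be taken to be the fibre
   over y itself, which may be empty. *)
Definition smooth_fibration (R : realType) (V W : normedModType R)
    (X : set V) (Y : set W) (f : V -> W) : Prop :=
  [/\ (forall x, X x -> Y (f x)),
      smooth_on X f
    & forall y, Y y -> exists (O : set W) (h : V -> W * V),
      [/\ open O, O y,
          diffeomorphism (X `&` f @^-1` O)
            ((Y `&` O) `*` (X `&` f @^-1` [set y])) h
        & forall x, X x -> O (f x) -> (h x).1 = f x]].

Definition fibration_iso (R : realType) (V W : normedModType R)
    (X X' : set V) (f : V -> W) : Prop :=
  exists h : V -> V,
    diffeomorphism X X' h /\ forall x, X x -> f (h x) = f x.

Definition milnor_hamm_sphere_fibration (R : realType) (m p : nat)
    (G : 'rV[R]_m -> 'rV[R]_p) (C : set 'rV[R]_p) : Prop :=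
  exists2 e0 : R, 0 < e0 &
    (forall e : R, 0 < e < e0 ->
       smooth_fibration (esphere m e `\` G @^-1` C) (esphere p 1 `\` C)
         (psi G)) /\
    (forall e1 e2 : R, 0 < e1 < e0 -> 0 < e2 < e0 ->
       fibration_iso (esphere m e1 `\` G @^-1` C)
         (esphere m e2 `\` G @^-1` C) (psi G)).

(* Main.v *)
(* On the region U of points x of a thin annulus around the sphere with G x
   outside the cone C, consider the Gram matrix M = J^T J + beta g^T g, where J
   is the Jacobian of (rho, G), g = (0, G x), and beta >= 0 vanishes exactly
   where |G|^2 <= mu0.  M is invertible on U: near V_G because (rho, G) is a
   submersion there (this is the condition on M(G), made uniform by compactness
   of the annulus), elsewhere because rho-regularity of psi says that J^T has no
   kernel orthogonal to g.  The smooth field b M^-1 J^T then moves rho with speed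
   b_0 and G with velocity b' - lambda G, where lambda = 0 near V_G.

   In the gnomonic coordinate q = y / <y, y0> of the sphere at y0 the radial
   term lambda G is invisible, so that the choice b' = <G, y0> w moves q o G with
   constant velocity w, while <G, y0> is locally constant when it is small.
   Trajectories therefore stay in a compact subset of U, the flow exists up to
   time 1, and it trivialises psi over a neighbourhood of y0.  The choice b' = 0
   keeps psi fixed and moves one sphere onto another. *)
From HB Require Import structures.
Require Import Defs.
From mathcomp Require Import all_boot all_order all_algebra.
From mathcomp Require Import all_classical all_reals all_analysis.
From mathcomp Require Import ring lra.
From mathcomp Require finmap.
From mathcomp Require summability.
Set Implicit Arguments.
Unset Strict Implicit.
Unset Printing Implicit Defensive.
Import Order.TTheory GRing.Theory Num.Theory.
Import numFieldNormedType.Exports.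
Local Open Scope classical_set_scope.
Local Open Scope ring_scope.

(** * Calculus of maps of class C^k *)

(** The restriction of psi to a sphere minus G^-1(C) is not proper, so Ehresmann's theorem does not
    apply and completeness of the lifted flow has to be forced. As long as psi stays in a compact
    set off C, a trajectory can leave the region only through V_G: C is a closed cone, so G x can
    approach it only by approaching 0. This is where the two hypotheses meet. Regularity of psi
    alone lifts motions of the sphere S^(p-1), with no control on the size of G; close to V_G the
    condition on M(G) allows <G, y0> to be held fixed at the same time. One weighted rank-one term
    in the Gram matrix joins both regimes in a single smooth formula, in place of a partition of
    unity. Since the field lives on an open subset of R^m and the spheres are level sets of rho,
    whose speed is prescribed, all smoothness statements reduce to that of time-one maps of flows in
    Euclidean space. *)

Section differentiability.
Context {R : realType} {V W : normedModType R}.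
Implicit Types (f g : V -> W).

Lemma diff_eps f x e : differentiable f x -> 0 < e ->
  \forall y \near x, `|f y - f x - 'd f x (y - x)| <= e * `|y - x|.
Proof.
move=> /diff_locally /eqaddoP fx e0.
rewrite (near_shift 0); apply: filterS (fx _ e0) => h /=.
by rewrite subr0 addrK !fctE /= opprD addrA.
Qed.

(** Differentials that no differentiation rule provides are obtained by exhibiting the candidate L:
    for the flat function at 0, for sums of series, for flows and for glued curves. *)
Lemma eps_diff f x (L : {linear V -> W}) : continuous L ->
  (forall e, 0 < e -> \forall y \near x, `|f y - f x - L (y - x)| <= e * `|y - x|) ->
  differentiable f x /\ 'd f x = L :> (V -> W).
Proof.
move=> cL fL.
have H : f \o shift x = cst (f x) + L +o_ 0 id.
  apply/eqaddoP => e e0; have := fL _ e0; rewrite (near_shift 0).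
  by apply: filterS => h /=; rewrite subr0 addrK !fctE /= opprD addrA.
have E := diff_unique cL H.
by split=> //; apply/diff_locallyP; rewrite E.
Qed.

Lemma near_eq_differentiable f g x : (\near x, f x = g x) ->
  differentiable f x -> differentiable g x.
Proof.
move=> fg df; apply: (eps_diff (diff_continuous df) _).1 => e e0.
have := nbhs_singleton fg => /= fgx.
by near=> y; rewrite -fgx -(near fg y)//; near: y; exact: diff_eps.
Unshelve. all: by end_near. Qed.

End differentiability.

Section class_C_basic.
Context {R : realType} {V W : normedModType R}.
Implicit Types (O : set V) (f g : V -> W) (k : nat).

Lemma class_C_sub k O O' f : O' `<=` O -> class_C k O f -> class_C k O' f.
Proof.
move=> sO; elim: k f => [|k ih] f /=.
  by move=> fO x O'x; exact/fO/sO.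
by move=> [fO Df]; split=> [x /sO /fO//|v]; exact/ih.
Qed.

Lemma near_open O (P : V -> Prop) x : open O -> O x ->
  (forall y, O y -> P y) -> \near x, P x.
Proof. by move=> oO Ox OP; apply: filterS OP _; exact: open_nbhs_nbhs. Qed.

Lemma class_C_eq k O f g : open O -> (forall x, O x -> f x = g x) ->
  class_C k O f -> class_C k O g.
Proof.
move=> oO; elim: k f g => [|k ih] f g fg /=.
  move=> cf x Ox; rewrite /prop_for /continuous_at -(fg _ Ox).
  apply: cvg_trans (cf x Ox); apply: near_eq_cvg.
  exact: (near_open oO Ox).
have nfg x : O x -> \near x, f x = g x by move=> Ox; exact: (near_open oO Ox).
move=> [df Df]; split=> [x Ox|v].
  by apply: near_eq_differentiable (df x Ox); exact: nfg.
apply: (ih _ _ _ (Df v)) => x Ox.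
exact/near_eq_derive/nfg.
Qed.

Lemma class_CW k O f : class_C k.+1 O f -> class_C k O f.
Proof.
elim: k f => [|k ih] f /= [df Df].
  by move=> x Ox; exact/differentiable_continuous/df.
by split=> // v; exact/ih.
Qed.

Lemma class_C_cst k O (a : W) : class_C k O (fun=> a).
Proof.
elim: k a => [|k ih] a /=; first by move=> x _; exact: cst_continuous.
split=> [x _|v]; first exact: differentiable_cst.
rewrite (_ : 'D_v _ = (fun=> 0 : W)); last by apply/funext => x; rewrite derive_cst.
exact: ih.
Qed.

Lemma class_CD k O f g : open O -> class_C k O f -> class_C k O g ->
  class_C k O (fun x => f x + g x).
Proof.
move=> oO; elim: k f g => [|k ih] f g /=.
  by move=> cf cg x Ox; apply: continuousD; [exact: cf|exact: cg].
move=> [df Df] [dg Dg]; split=> [x Ox|v].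
  by apply: differentiableD; [exact: df|exact: dg].
apply: (class_C_eq oO _ (ih _ _ (Df v) (Dg v))) => x Ox.
by rewrite -deriveD//; apply: diff_derivable; [exact: df|exact: dg].
Qed.

Lemma class_C_sum k O (I : Type) (r : seq I) (P : pred I) (F : I -> V -> W) :
  open O -> (forall i, P i -> class_C k O (F i)) ->
  class_C k O (fun x => \sum_(i <- r | P i) F i x).
Proof.
move=> oO FO; elim: r => [|i r ih].
  by under eq_fun do rewrite big_nil; exact: class_C_cst.
under eq_fun do rewrite big_cons.
case Pi : (P i); last exact: ih.
by apply: class_CD => //; exact: FO.
Qed.

End class_C_basic.

Lemma class_C_linear (R : realType) (V W W' : normedModType R)
  (L : {linear W -> W'}) k (O : set V) (f : V -> W) :
  continuous L -> open O -> class_C k O f -> class_C k O (fun x => L (f x)).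
Proof.
move=> cL oO; elim: k f => [|k ih] f /=.
  by move=> cf x Ox; apply: continuous_comp; [exact: cf|exact: cL].
move=> [df Df]; have dLf x : O x -> differentiable (L \o f) x.
  move=> Ox; apply: differentiable_comp; first exact: df.
  exact: linear_differentiable.
split=> // v.
apply: (class_C_eq oO _ (ih _ (Df v))) => x Ox.
rewrite [RHS](deriveE v (dLf x Ox)) diff_comp/=; [|exact: df|exact: linear_differentiable].
by rewrite diff_lin// deriveE//; exact: df.
Qed.

Section class_C_opp.
Context {R : realType} {V W : normedModType R}.

Lemma class_CN k (O : set V) (f : V -> W) : open O -> class_C k O f -> class_C k O (fun x => - f x).
Proof.
move=> oO; apply: (@class_C_linear _ _ _ _ (GRing.opp : {linear W -> W})) => //.
exact: opp_continuous.
Qed.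

Lemma class_CB k (O : set V) (f g : V -> W) : open O -> class_C k O f -> class_C k O g ->
  class_C k O (fun x => f x - g x).
Proof. by move=> oO cf cg; apply: class_CD => //; exact: class_CN. Qed.

End class_C_opp.

Section class_C_scalar.
Context {R : realType} {V W : normedModType R}.
Implicit Types (O : set V) (f g : V -> R) (k : nat).

Lemma class_CZl k O f (w : W) : open O -> class_C k O f ->
  class_C k O (fun x => f x *: w).
Proof.
move=> oO; elim: k f => [|k ih] f /=.
  by move=> cf x Ox; apply: continuousZr_tmp => //; exact: cf.
move=> [df Df]; split=> [x Ox|v].
  by apply: differentiableZl; exact: df.
apply: (class_C_eq oO _ (ih _ (Df v))) => x Ox.
rewrite [RHS]deriveE; last by apply: differentiableZl; exact: df.
by rewrite diffZl ?deriveE//; exact: df.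
Qed.

Lemma class_CM k O f g : open O -> class_C k O f -> class_C k O g ->
  class_C k O (fun x => f x * g x).
Proof.
move=> oO; elim: k f g => [|k ih] f g.
  by move=> /= cf cg x Ox; apply: continuousM; [exact: cf|exact: cg].
move=> Cf Cg; have := Cf; have := Cg => -[dg Dg] [df Df].
split=> [x Ox|v].
  by apply: differentiableM; [exact: df|exact: dg].
apply: (@class_C_eq _ _ _ _ _ (fun x => f x * 'D_v g x + g x * 'D_v f x)) => //.
  move=> x Ox; rewrite [RHS]deriveM//; apply: diff_derivable; [exact: df|exact: dg].
by apply: class_CD => //; apply: ih; by [exact: (class_CW Cf)|exact: (class_CW Cg)|exact: Df|exact: Dg].
Qed.

Lemma class_C_prod k O (I : Type) (r : seq I) (P : pred I) (F : I -> V -> R) :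
  open O -> (forall i, P i -> class_C k O (F i)) ->
  class_C k O (fun x => \prod_(i <- r | P i) F i x).
Proof.
move=> oO FO; elim: r => [|i r ih].
  by under eq_fun do rewrite big_nil; exact: class_C_cst.
under eq_fun do rewrite big_cons.
case Pi : (P i); last exact: ih.
by apply: class_CM => //; exact: FO.
Qed.

Lemma class_CX k O f n : open O -> class_C k O f ->
  class_C k O (fun x => f x ^+ n).
Proof.
move=> oO fO; elim: n => [|n ih].
  by under eq_fun do rewrite expr0; exact: class_C_cst.
by under eq_fun do rewrite exprS; exact: class_CM.
Qed.

Lemma class_CV k O f : open O -> (forall x, O x -> f x != 0) ->
  class_C k O f -> class_C k O (fun x => (f x)^-1).
Proof.
move=> oO f0; elim: k => [|k ih].
  by move=> /= cf x Ox; apply: continuousV; [exact: f0|exact: cf].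
move=> Cf; have := Cf => -[df Df].
split=> [x Ox|v].
  by apply: differentiableV; [exact: df|exact: f0].
apply: (@class_C_eq _ _ _ _ _ (fun x => - ((f x)^-1 * (f x)^-1 * 'D_v f x))) => //.
  move=> x Ox; rewrite [RHS]deriveV ?f0//; last exact/diff_derivable/df.
  by rewrite scaleNr -invfM -expr2.
apply: class_CN => //; apply: class_CM => //.
  by apply: class_CM => //; apply: ih; exact: (class_CW Cf).
exact: Df.
Qed.

End class_C_scalar.

Section class_C_coordinate.
Context {R : realType} {V : normedModType R}.
Implicit Types (O : set V) (k : nat).

Lemma class_C_coord k O n (f : V -> 'rV[R]_n) i : open O -> class_C k O f ->
  class_C k O (fun x => f x ord0 i).
Proof.
move=> oO.
pose L : 'rV[R]_n -> R := fun N => N ord0 i.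
have linL : linear L by move=> a u v; rewrite /L !mxE.
pose LM := GRing.isLinear.Build _ _ _ _ _ linL.
pose LL : {linear 'rV[R]_n -> R} := HB.pack L LM.
apply: (@class_C_linear _ _ _ _ LL) => //.
exact: coord_continuous.
Qed.

End class_C_coordinate.

Section class_C_vector.
Context {R : realType} {V : normedModType R}.
Implicit Types (O : set V) (k : nat).

Lemma class_C_row k O n (f : V -> 'rV[R]_n) : open O ->
  (forall i, class_C k O (fun x => f x ord0 i)) -> class_C k O f.
Proof.
move=> oO fO.
have -> : f = fun x => \sum_(i < n) f x ord0 i *: delta_mx ord0 i.
  by apply/funext => x; exact: row_sum_delta.
by apply: class_C_sum => // i _; exact: class_CZl.
Qed.

(** [class_C] controls derivatives in fixed directions, whereas the chain rule differentiates f in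
    the moving direction D_v g. Expanding that direction in the standard basis restores fixed
    directions, to which the induction hypothesis applies. *)
Lemma class_C_comp k O n (U : set 'rV[R]_n) (g : V -> 'rV[R]_n) (f : 'rV[R]_n -> R) :
  open O -> (forall x, O x -> U (g x)) -> class_C k O g -> class_C k U f ->
  class_C k O (fun x => f (g x)).
Proof.
move=> oO gU; elim: k g gU f => [|k ih] g gU f.
  by move=> /= cg cf x Ox; apply: continuous_comp; [exact: cg|exact/cf/gU].
move=> Cg Cf; have := Cf; have := Cg => -[dg Dg] [df Df].
have dfg x : O x -> differentiable (f \o g) x.
  by move=> Ox; apply: differentiable_comp; [exact: dg|exact/df/gU].
split=> // v.
apply: (@class_C_eq _ _ _ _ _
  (fun x => \sum_(i < n) 'D_v g x ord0 i * 'D_('e_i) f (g x))) => //.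
  move=> x Ox; rewrite [RHS](deriveE v (dfg x Ox)) diff_comp/=; [|exact: dg|exact/df/gU].
  rewrite -(@deriveE _ _ _ g); last exact: dg.
  rewrite [in RHS](row_sum_delta ('D_v g x)) linear_sum; apply: eq_bigr => i _.
  by rewrite linearZ/= -deriveE//; exact/df/gU.
apply: class_C_sum => // i _; apply: class_CM => //.
  by apply: class_C_coord => //; exact: Dg.
by apply: (ih _ gU ('D_('e_i) f)); [exact: (class_CW Cg)|exact: Df].
Qed.

Lemma class_C_comp_row k O n q (U : set 'rV[R]_n) (g : V -> 'rV[R]_n)
    (f : 'rV[R]_n -> 'rV[R]_q) : open U ->
  open O -> (forall x, O x -> U (g x)) -> class_C k O g -> class_C k U f ->
  class_C k O (fun x => f (g x)).
Proof.
move=> oU oO gU cg cf; apply: class_C_row => // i.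
apply: (class_C_comp (f := fun y => f y ord0 i) oO gU cg).
exact: class_C_coord.
Qed.

Lemma class_C_id k O : class_C k O (@id V).
Proof.
case: k => [|k] /=; first by move=> x _; exact: cvg_id.
split=> [x _|v]; first exact: ex_diff.
have -> : 'D_v (@id V) = (fun=> v) by apply/funext => x; rewrite derive_id.
exact: class_C_cst.
Qed.

Lemma class_C_sqrt k O (f : V -> R) : open O -> (forall x, O x -> 0 < f x) ->
  class_C k O f -> class_C k O (fun x => Num.sqrt (f x)).
Proof.
move=> oO f0; elim: k => [|k ih].
  move=> /= cf x Ox.
  by apply: (continuous_comp (f := f)); [exact: cf|exact: sqrt_continuous].
move=> Cf; have := Cf => -[df Df].
have dsq x : O x -> differentiable (@Num.sqrt R) (f x).
  by move=> Ox; apply/derivable1_diffP; have [] := is_derive1_sqrt (f0 x Ox).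
have dsf x : O x -> differentiable (@Num.sqrt R \o f) x.
  by move=> Ox; apply: differentiable_comp; [exact: df|exact: dsq].
split=> // v.
apply: (@class_C_eq _ _ _ _ _ (fun x => 'D_v f x * (2 * Num.sqrt (f x))^-1)) => //.
  move=> x Ox; rewrite [RHS](deriveE v (dsf x Ox)) diff_comp/=; [|exact: df|exact: dsq].
  have -> : 'd f x v = 'D_v f x *: (1 : R) by rewrite -deriveE ?/GRing.scale/= ?mulr1//; exact: df.
  rewrite linearZ/= -(@deriveE _ _ _ (@Num.sqrt R)); last exact: dsq.
  by rewrite (derive_sqrt (f0 x Ox)).
apply: class_CM => //; first exact: Df.
apply: class_CV => // [x Ox|]; first by rewrite mulf_neq0// gt_eqF ?sqrtr_gt0 ?f0.
apply: class_CM => //; first exact: class_C_cst.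
by apply: ih; exact: (class_CW Cf).
Qed.

End class_C_vector.

Section class_C_pairs.
Context {R : realType}.

Lemma class_C_fst k (V W W' : normedModType R) (O : set V) (f : V -> W * W') :
  open O -> class_C k O f -> class_C k O (fun x => (f x).1).
Proof.
move=> oO; apply: (@class_C_linear _ _ _ _ (fst : {linear (W * W')%type -> W})) => //.
by move=> x; exact: cvg_fst.
Qed.

Lemma class_C_snd k (V W W' : normedModType R) (O : set V) (f : V -> W * W') :
  open O -> class_C k O f -> class_C k O (fun x => (f x).2).
Proof.
move=> oO; apply: (@class_C_linear _ _ _ _ (snd : {linear (W * W')%type -> W'})) => //.
by move=> x; exact: cvg_snd.
Qed.

Lemma class_C_pair k (V W W' : normedModType R) (O : set V) (f : V -> W) (g : V -> W') :
  open O -> class_C k O f -> class_C k O g -> class_C k O (fun x => (f x, g x)).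
Proof.
move=> oO; elim: k f g => [|k ih] f g.
  by move=> /= cf cg x Ox; apply: cvg_pair; [exact: cf|exact: cg].
move=> [df Df] [dg Dg].
have dfg x : O x -> differentiable (fun x => (f x, g x)) x.
  by move=> Ox; apply: differentiable_pair; [exact: df|exact: dg].
split=> // v.
apply: (class_C_eq oO _ (ih _ _ (Df v) (Dg v))) => x Ox.
rewrite [RHS](deriveE v (dfg x Ox)) diff_pair; [|exact: df|exact: dg].
by rewrite !deriveE//; [exact: dg|exact: df].
Qed.

End class_C_pairs.

(** * The flat function exp(-1/x) *)

Section flat_function.
Context {R : realType}.

(* x |-> P(1/x) exp(-1/x) on x > 0: a family closed under differentiation. *)
Definition flat (P : {poly R}) (x : R) : R :=
  if 0 < x then P.[x^-1] * expR (- x^-1) else 0.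

(** With y = 1/x one has dy/dx = - y^2, and P(y) exp(-y) has y-derivative (P' - P)(y) exp(-y). *)
Definition flat_deriv (P : {poly R}) : {poly R} := 'X ^+ 2 * (P - P^`()).

Lemma exprn_le_expR (y : R) k : 0 <= y -> y ^+ k <= k`!%:R * expR y.
Proof.
case: k => [|k] y0; first by rewrite expr0 fact0 mul1r -expR0 ler_expR.
rewrite mulrC -ler_pdivrMr ?ltr0n ?fact_gt0//.
apply: le_trans (expR_ge1Dxn k y0); by rewrite lerDr.
Qed.

Lemma poly_expR_bounded (P : {poly R}) : exists2 C, 0 <= C &
  forall y, 0 <= y -> `|P.[y] * expR (- y)| <= C.
Proof.
exists (\sum_(i < size P) `|P`_i| * i`!%:R).
  by apply: sumr_ge0 => i _; rewrite mulr_ge0.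
move=> y y0; rewrite normrM (ger0_norm (expR_ge0 _)) expRN ler_pdivrMr ?expR_gt0//.
rewrite horner_coef (le_trans (ler_norm_sum _ _ _))// mulr_suml ler_sum// => i _.
rewrite normrM -mulrA ler_wpM2l// normrX ger0_norm//.
exact: exprn_le_expR.
Qed.

(** Boundedness of y^2 P(y) exp(-y) at y = 1/x. A quadratic bound is what makes the derivative at
    the origin exist and vanish. *)
Lemma flat_sqr_bound (P : {poly R}) : exists2 C, 0 <= C &
  forall x, `|flat P x| <= C * x ^+ 2.
Proof.
have [C C0 HC] := poly_expR_bounded ('X ^+ 2 * P).
exists C => // x; rewrite /flat; case: ifPn => x0; last first.
  by rewrite normr0 mulr_ge0// sqr_ge0.
rewrite -ler_pdivrMr ?exprn_gt0// -[_ / _](ger0_norm _) ?divr_ge0 ?sqr_ge0//.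
rewrite normrM normr_id.
have := HC x^-1; rewrite invr_ge0 (ltW x0) => /(_ isT).
rewrite hornerM hornerXn -mulrA normrM mulrC.
by rewrite -exprVn.
Qed.

Lemma is_derive_flat (P : {poly R}) (x : R) :
  is_derive x (1:R) (flat P) (flat (flat_deriv P) x).
Proof.
have [x0|x0|x0] := ltgtP x 0.
- have -> : flat (flat_deriv P) x = 0 by rewrite /flat ltNge ltW.
  apply: near_eq_is_derive (is_derive_cst (0 : R) x (1:R)).
  near=> y; rewrite /flat ltNge; rewrite ifN// negbK ltW//.
  by near: y; exact: lt_nbhsl.
- have xn0 : x != 0 by rewrite gt_eqF.
  pose g (y : R) := P.[y^-1] * expR (- y^-1).
  have Di : is_derive x (1:R) (fun y : R => y^-1) (- x ^- 2).
    have := @is_deriveV R (@id R) x 1 1 xn0 (is_derive_id _ _).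
    by rewrite /GRing.scale/= mulr1.
  have DN : is_derive x (1:R) (fun y : R => - y^-1) (x ^- 2).
    by rewrite -[x ^- 2]opprK; exact: is_deriveN.
  have DP := is_derive1_comp (is_derive_poly P x^-1) Di.
  have DE := @is_derive1_comp R expR (fun y => - y^-1) x _ _ (is_derive_expR (- x^-1)) DN.
  have Dg := is_deriveM DP DE.
  apply: (@near_eq_is_derive _ _ _ g).
    near=> y; rewrite /flat/g ifT//; near: y; exact: lt_nbhsr.
  apply: is_derive_eq Dg _.
  rewrite /flat x0 /flat_deriv hornerM hornerXn hornerD hornerN /GRing.scale/=.
  rewrite exprVn; ring.
- have -> : flat (flat_deriv P) x = 0 by rewrite /flat x0 ltxx.
  have [C C0 HC] := flat_sqr_bound P.
  pose L : {linear R -> R} := \0.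
  have cL : continuous L by move=> y; exact: cvg_cst.
  have H e : 0 < e -> \forall y \near x, `|flat P y - flat P x - L (y - x)| <= e * `|y - x|.
    move=> e0; have C1 : 0 < C + 1 by rewrite ltr_wpDl.
    near=> y.
    have -> : flat P x = 0 by rewrite /flat x0 ltxx.
    rewrite x0 !subr0; apply: (le_trans (HC y)).
    (* Then C y^2 <= e |y|; the summand 1 guards against C = 0. *)
    have ye : `|y| <= e / (C + 1).
      near: y; rewrite x0; apply/nbhs_ballP; exists (e / (C + 1)).
        by rewrite /= divr_gt0.
      by move=> z; rewrite -ball_normE /= sub0r normrN => /ltW.
    rewrite -real_normK ?num_real// expr2 mulrA ler_wpM2r//.
    apply: (le_trans (ler_wpM2l C0 ye)).
    by rewrite mulrCA ler_piMr ?(ltW e0)// ler_pdivrMr// mul1r lerDl.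
  have [df Ef] := eps_diff cL H.
  apply: DeriveDef; first exact/derivable1_diffP.
  by rewrite (deriveE _ df) [LHS](congr1 (fun h : R -> R => h 1) Ef).
Unshelve. all: by end_near. Qed.

Lemma class_C_flat (V : normedModType R) k (O : set V) (P : {poly R}) (g : V -> R) :
  open O -> class_C k O g -> class_C k O (fun x => flat P (g x)).
Proof.
move=> oO; elim: k P => [|k ih] P.
  move=> /= cg x Ox; apply: (@continuous_comp _ _ _ g (flat P)); first exact: cg.
  apply: differentiable_continuous; apply/derivable1_diffP.
  by have [] := is_derive_flat P (g x).
move=> Cg; have := Cg => -[dg Dg].
have df y : differentiable (flat P) y.
  by apply/derivable1_diffP; have [] := is_derive_flat P y.
have dfg x : O x -> differentiable (flat P \o g) x.
  by move=> Ox; apply: differentiable_comp => //; exact: dg.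
split=> // v.
apply: (@class_C_eq _ _ _ _ _ (fun x => 'D_v g x * flat (flat_deriv P) (g x))) => //.
  move=> x Ox; rewrite [RHS](deriveE v (dfg x Ox)) diff_comp//=; last exact: dg.
  have -> : 'd g x v = 'D_v g x *: (1 : R) by rewrite -deriveE ?/GRing.scale/= ?mulr1//; exact: dg.
  rewrite linearZ/= -(@deriveE _ _ _ (flat P))//.
  by have [_ ->] := is_derive_flat P (g x).
apply: class_CM => //; first exact: Dg.
by apply: ih; exact: (class_CW Cg).
Qed.

(** A smooth function whose zero set is exactly the nonpositive half-line. It weights the Gram
    matrix and also serves as a smooth test for an inequality. *)
Definition bump : R -> R := flat 1.

Lemma bump_le0 x : x <= 0 -> bump x = 0.
Proof. by move=> x0; rewrite /bump /flat ltNge x0. Qed.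

Lemma bump_gt0 x : 0 < x -> 0 < bump x.
Proof. by move=> x0; rewrite /bump /flat x0 hornerC mul1r expR_gt0. Qed.

Lemma bump_ge0 x : 0 <= bump x.
Proof. by have [/bump_le0->//|/bump_gt0/ltW] := leP x 0. Qed.

End flat_function.

(** * Ordinary differential equations *)

Section ode_tools.
Context {R : realType}.

(** The mean value theorem for h - s f with s = 1 and s = -1: both functions have nonnegative
    derivative. *)
Lemma le_derive_increment (f h df dh : R -> R) (a b : R) : a <= b ->
  (forall t : R, a < t < b -> is_derive t (1:R) f (df t)) ->
  (forall t : R, a < t < b -> is_derive t (1:R) h (dh t)) ->
  {within `[a, b], continuous f} -> {within `[a, b], continuous h} ->
  (forall t, a < t < b -> `|df t| <= dh t) ->
  `|f b - f a| <= h b - h a.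
Proof.
move=> ab Df Dh cf ch le.
have aux (s : R) : (s = 1 \/ s = -1) -> s * (f b - f a) <= h b - h a.
  move=> s1; have [c cab] : exists2 c, c \in `[a, b] &
      (h \- s \*o f) b - (h \- s \*o f) a = (if a < c < b then dh c - s * df c else 0) * (b - a).
    (* For a = b there is no interior point to evaluate the derivatives at; the factor b - a
       vanishes, and the default slope 0 serves. *)
    move: ab; rewrite le_eqVlt => /predU1P[<-|ab].
      exists a; first by rewrite in_itv/= lexx.
      by rewrite ltxx andbF subrr mul0r.
    have D t : t \in `]a, b[ -> is_derive t (1:R) (h \- s \*o f) (dh t - s * df t).
      rewrite in_itv/= => tab.
      have := Df _ tab; have := Dh _ tab => ? ?.
      exact: is_deriveB.
    have [|c cab E] := MVT ab D.
      move=> x; apply: (@continuousB _ _ (subspace `[a, b])); first exact: ch.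
      by apply: continuousM; [exact: cst_continuous|exact: cf].
    exists c; first by move: cab; apply: subset_itv_oo_cc.
    by rewrite in_itv/= in cab; rewrite cab.
  move=> E; rewrite -subr_ge0.
  have -> : h b - h a - s * (f b - f a) = (h \- s \*o f) b - (h \- s \*o f) a.
    by rewrite /=; ring.
  rewrite E mulr_ge0 ?subr_ge0//; case: ifPn => // /le; rewrite subr_ge0.
  by apply: le_trans; case: s1 => ->; rewrite ?mul1r ?mulN1r ?ler_norm// -normrN ler_norm.
rewrite ler_norml; apply/andP; split.
  by rewrite lerNl -mulN1r; apply: aux; right.
by rewrite -[leLHS]mul1r; apply: aux; left.
Qed.

(** The open interval ]-1, 2[ leaves room around [0, 1], so that derivatives at times 0 and 1 are
    two-sided; global continuity lets the Picard operator be iterated on functions defined on all of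
    R. *)
Lemma continuous_primitive (f : R -> R) : continuous f ->
  exists F : R -> R, [/\ F 0 = 0, continuous F &
    forall t : R, -1 < t < 2 -> is_derive t (1:R) F (f t)].
Proof.
move=> cf.
pose F0 (x : R) : R := (\int[@lebesgue_measure R]_(t in `[-3, x]) f t)%R.
have intf (u : R) : (@lebesgue_measure R).-integrable `[-3, u] (EFin \o f).
  apply: continuous_compact_integrable; first exact: segment_compact.
  exact: continuous_subspaceT.
have DF0 (x : R) : -3 < x -> is_derive x (1:R) F0 (f x).
  move=> x3; have [|dF EF] := @continuous_FTC1_closed _ f (-3) x (x + 1) _ (intf _) x3 (cf x).
    by rewrite ltrDl.
  by split; [exact: dF|rewrite -derive1E; exact: EF].
(* Clamping the upper limit keeps it above -3, the base point of the integral, and makes the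
   primitive constant far out. *)
pose cl (t : R) := Num.max (-2) (Num.min t 3).
have ccl : continuous cl.
  move=> x; apply: (@continuous_max R _ (cst _) _ x); first exact: cst_continuous.
  by apply: (@continuous_min R _ id (cst _) x); [exact: cvg_id|exact: cst_continuous].
have cl3 x : -3 < cl x by rewrite /cl lt_max; apply/orP; left; lra.
exists (fun t => F0 (cl t) - F0 (cl 0)); split.
- by rewrite subrr.
- move=> x; apply: cvgB; last exact: cvg_cst.
  apply: (@continuous_comp _ _ _ cl F0 x); first exact: ccl.
  apply: differentiable_continuous; apply/derivable1_diffP.
  by have [] := DF0 _ (cl3 x).
- move=> t /andP[t1 t2].
  have : is_derive t (1:R) (fun t => F0 t - F0 (cl 0)) (f t - 0).
    have := DF0 t; rewrite (lt_trans _ t1); last by lra.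
    by move=> /(_ isT) ?; apply: is_deriveB.
  rewrite subr0; apply: near_eq_is_derive.
  near=> x; rewrite {2}/cl min_l ?max_r//.
    by apply/ltW; near: x; apply: lt_nbhsr; lra.
  by apply/ltW; near: x; apply: lt_nbhsl; lra.
Unshelve. all: by end_near. Qed.

Lemma rV_norm_le n (x : 'rV[R]_n) (c : R) : 0 <= c ->
  (`|x| <= c) = [forall i, `|x ord0 i| <= c].
Proof.
move=> c0; rewrite [in LHS]/Num.Def.normr/= mx_normrE; apply/idP/idP.
  move=> H; apply/forallP => i; apply: le_trans H.
  exact: (le_bigmax _ (fun ij : 'I_1 * 'I_n => `|x ij.1 ij.2|) (ord0, i)).
move=> /forallP H; apply: bigmax_le => //= -[i j] _ /=.
by rewrite (ord1 i).
Qed.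

Lemma rV_coord_le n (x : 'rV[R]_n) i : `|x ord0 i| <= `|x|.
Proof. by have := rV_norm_le x (normr_ge0 x); rewrite lexx => /esym/forallP. Qed.

Lemma is_derive_coordP n (u : R -> 'rV[R]_n) (t : R) v :
  is_derive t (1 : R) u v <->
  forall i, is_derive t (1 : R) (fun s => u s ord0 i) (v ord0 i).
Proof.
split=> [[d e] i|H].
  have /derivable_mxP di := d.
  apply: DeriveDef; first exact: di.
  by rewrite -e derive_mx// mxE.
have d : derivable u t (1:R).
  by apply/derivable_mxP => a i; rewrite (ord1 a); have [] := H i.
apply: DeriveDef => //; rewrite derive_mx//; apply/rowP => i; rewrite mxE.
by have [] := H i.
Qed.

Lemma continuous_rowP n (u : R -> 'rV[R]_n) :
  continuous u <-> forall i, continuous (fun s => u s ord0 i).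
Proof.
split=> [cu i x|H x].
  by apply: (@continuous_comp _ _ _ u (fun v : 'rV[R]_n => v ord0 i) x) => //;
    [exact: cu|exact: coord_continuous].
apply/cvgrPdist_le => e e0; near=> y.
rewrite rV_norm_le ?(ltW e0)//; apply/forallP => i; rewrite !mxE.
move: i; near: y; apply: filter_forall => /= i.
by have /cvgrPdist_le := H i x; exact.
Unshelve. all: by end_near. Qed.

Lemma continuous_primitive_rV n (f : R -> 'rV[R]_n) (x0 : 'rV[R]_n) : continuous f ->
  exists F : R -> 'rV[R]_n, [/\ F 0 = x0, continuous F &
    forall t : R, -1 < t < 2 -> is_derive t (1:R) F (f t)].
Proof.
move=> /continuous_rowP cf.
have /choice[F HF] i := continuous_primitive (cf i).
exists (fun t => x0 + \row_i F i t); split.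
- by apply/rowP => i; rewrite !mxE; have [-> _ _] := HF i; rewrite addr0.
- apply/continuous_rowP => i x; under eq_fun do rewrite !mxE.
  by apply: cvgD; [exact: cvg_cst|have [_ + _] := HF i; exact].
- move=> t t12; apply/is_derive_coordP => i.
  have [_ _ /(_ t t12) D] := HF i.
  have -> : (fun s => (x0 + \row_i F i s) ord0 i) = cst (x0 ord0 i) + F i.
    by apply/funext => s; rewrite !mxE.
  by apply: is_derive_eq; rewrite add0r.
Qed.

(** The coordinatewise retraction onto the sup-norm ball of radius r does not expand sup-norm
    distances. Composed with it, a locally Lipschitz field becomes globally Lipschitz, as [picard]
    demands. *)
Definition vclamp n (r : R) (x : 'rV[R]_n) : 'rV[R]_n :=
  \row_i Num.max (- r) (Num.min (x ord0 i) r).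

Lemma vclamp_lip n r (x y : 'rV[R]_n) : `|vclamp r x - vclamp r y| <= `|x - y|.
Proof.
rewrite rV_norm_le//; apply/forallP => i; rewrite !mxE.
apply: (@le_trans _ _ `|x ord0 i - y ord0 i|); last first.
  by have := rV_coord_le (x - y) i; rewrite !mxE.
move: (x ord0 i) (y ord0 i) => a b.
wlog ab : a b / b <= a => [H|].
  by have [/H//|/ltW/H] := leP b a; rewrite distrC (distrC a).
rewrite (ger0_norm (_ : 0 <= a - b)) ?subr_ge0//.
rewrite ger0_norm; last by rewrite subr_ge0 le_max2// le_min2.
by rewrite /Num.max /Num.min; do ![case: ifPn]; rewrite -?leNgt; lra.
Qed.

Lemma vclamp_le n r (x : 'rV[R]_n) : 0 <= r -> `|vclamp r x| <= r.
Proof.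
move=> r0; rewrite rV_norm_le//; apply/forallP => i; rewrite !mxE ler_norml.
by rewrite le_max lexx/= ge_max; rewrite ge_min lexx orbT andbT; lra.
Qed.

Lemma vclamp_id n r (x : 'rV[R]_n) : `|x| <= r -> vclamp r x = x.
Proof.
move=> xr; apply/rowP => i; rewrite !mxE.
have := le_trans (rV_coord_le x i) xr; rewrite ler_norml => /andP[a b].
by rewrite min_l// max_r.
Qed.

Definition clamp (a b t : R) : R := Num.max a (Num.min t b).

Lemma clamp_continuous a b : continuous (clamp a b).
Proof.
move=> x; apply: (@continuous_max R _ (cst _) _ x); first exact: cst_continuous.
by apply: (@continuous_min R _ id (cst _) x); [exact: cvg_id|exact: cst_continuous].
Qed.

Lemma clamp_itv a b t : a <= b -> a <= clamp a b t <= b.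
Proof.
by move=> ab; rewrite /clamp le_max lexx/= ge_max ab ge_min lexx orbT.
Qed.

Lemma clamp_id a b t : a <= t <= b -> clamp a b t = t.
Proof. by move=> /andP[a1 b1]; rewrite /clamp min_l// max_r. Qed.

Lemma is_derive_expM (c t : R) :
  is_derive t (1:R) (fun s => expR (c * s)) (c * expR (c * t)).
Proof.
have D : is_derive t (1:R) (fun s => c * s) c.
  have -> : (fun s => c * s) = c *: (@id R) :> (R -> R) by [].
  by apply: is_derive_eq; rewrite /GRing.scale/= mulr1.
have := is_derive1_comp (is_derive_expR (c * t)) D.
by rewrite mulrC.
Qed.

End ode_tools.

(** A and c are free in sign: for negative times both are taken negative, because |s| = - s
    there. *)
Lemma incr_exp (R : realType) (d dd : R -> R) (A c a b : R) : a <= b ->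
  (forall s : R, a < s < b -> is_derive s (1:R) d (dd s)) -> continuous d ->
  (forall s : R, a < s < b -> `|dd s| <= c * A * expR (c * s)) ->
  `|d b - d a| <= A * expR (c * b) - A * expR (c * a).
Proof.
move=> ab Dd cd bd.
have Dh (s : R) : is_derive s (1:R) (fun s => A * expR (c * s)) (c * A * expR (c * s)).
  have D := is_derive_expM c s.
  have -> : (fun s => A * expR (c * s)) = A *: (fun s => expR (c * s)) :> (R -> R) by [].
  by apply: is_derive_eq; rewrite /GRing.scale/= mulrCA mulrA.
apply: (le_derive_increment ab Dd (fun s _ => Dh s)) => //.
  exact: continuous_subspaceT.
apply: continuous_subspaceT => s.
by apply: differentiable_continuous; apply/derivable1_diffP; have [] := Dh s.
Qed.

Lemma half_geometric_lt (R : realType) (C e : R) : 0 < e -> exists k, C / 2 ^+ k < e.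
Proof.
move=> e0; exists (Num.Def.archi_bound (C / e)).
by rewrite ltr_pdivrMr ?exprn_gt0// -ltr_pdivrMl// mulrC upper_nthrootP.
Qed.

Lemma geometric_limit (R : realType) n (v : nat -> 'rV[R]_n) (C : R) :
  (forall k j, `|v (k + j)%N - v k| <= C / 2 ^+ k) ->
  exists l, forall k, `|l - v k| <= C / 2 ^+ k.
Proof.
move=> H.
have C0 k : 0 <= C / 2 ^+ k by exact: le_trans (H k 0%N).
have Hi i k j : `|v (k + j)%N ord0 i - v k ord0 i| <= C / 2 ^+ k.
  by apply: le_trans (H k j); have := rV_coord_le (v (k + j)%N - v k) i; rewrite !mxE.
have /choice[l Hl] i : exists l : R, v k ord0 i @[k --> \oo] --> l.
  apply/cvg_ex; apply: cauchy_cvg; apply: cauchy_exP => e e0.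
  have [k ke] := half_geometric_lt C e0.
  exists (v k ord0 i); exists k => // j /= kj.
  rewrite -(subnKC kj) -ball_normE /ball_/= distrC.
  exact: le_lt_trans (Hi _ _ _) ke.
exists (\row_i l i) => k; rewrite rV_norm_le//; apply/forallP => i; rewrite !mxE.
apply/ler_addgt0Pl => e e0.
have /cvgrPdist_lt/(_ _ e0)[N _ HN] := Hl i.
rewrite (le_trans (ler_distD (v (k + N)%N ord0 i) _ _))// lerD//.
by apply/ltW/HN => /=; rewrite leq_addl.
Qed.

(** * Picard iteration for globally Lipschitz fields *)

Section picard.
Context {R : realType} {n : nat}.
Variables (f : R -> 'rV[R]_n -> 'rV[R]_n) (L : R).
Hypothesis L0 : 0 < L.
Hypothesis lip : forall t x y, `|f t x - f t y| <= L * `|x - y|.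
Hypothesis cf : forall x, continuous (f ^~ x).

Lemma picard_continuous (u : R -> 'rV[R]_n) : continuous u ->
  continuous (fun t => f t (u t)).
Proof using cf lip L0.
move=> cu x; apply/cvgrPdist_le => e e0.
near=> t.
rewrite (le_trans (ler_distD (f t (u x)) _ _))// (splitr e) lerD//.
  near: t; have /cvgrPdist_le := @cf (u x) x; apply; exact: divr_gt0.
rewrite (le_trans (lip _ _ _))// mulrC -ler_pdivlMr//.
near: t; have /cvgrPdist_le := @cu x; apply; by rewrite !divr_gt0.
Unshelve. all: by end_near. Qed.

(* The weight exp(2 L |t|) makes the Picard operator contract by 1/2 on the whole
   time interval. *)
Lemma picard_contract (u v U V : R -> 'rV[R]_n) (a t : R) : -1 < t < 2 ->
  continuous U -> continuous V -> U 0 = V 0 ->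
  (forall t : R, -1 < t < 2 -> is_derive t (1:R) U (f t (u t))) ->
  (forall t : R, -1 < t < 2 -> is_derive t (1:R) V (f t (v t))) ->
  (forall s : R, 0 <= s <= t \/ t <= s <= 0 -> `|u s - v s| <= a * expR (2 * L * `|s|)) ->
  `|U t - V t| <= a / 2 * expR (2 * L * `|t|).
Proof using lip L0.
move=> /andP[t1 t2] cU cV UV0 DU DV H.
have a0 : 0 <= a.
  have := H 0; rewrite normr0 mulr0 expR0 mulr1 lexx andbT => h.
  by apply: le_trans (h _) => //; have [|/ltW] := leP 0 t; [left|right].
rewrite rV_norm_le; last by rewrite mulr_ge0 ?expR_ge0// divr_ge0.
apply/forallP => i; rewrite !mxE.
pose d s := U s ord0 i - V s ord0 i.
have d0 : d 0 = 0 by rewrite /d UV0 subrr.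
have cd : continuous d.
  move: cU cV => /continuous_rowP /(_ i) cU /continuous_rowP /(_ i) cV x.
  by apply: cvgB; [exact: cU|exact: cV].
have Dd (s : R) : -1 < s < 2 -> is_derive s (1:R) d (f s (u s) ord0 i - f s (v s) ord0 i).
  move=> ss; have /is_derive_coordP/(_ i) := DU s ss; have /is_derive_coordP/(_ i) := DV s ss.
  by move=> ? ?; apply: is_deriveB.
have bd (s : R) : 0 <= s <= t \/ t <= s <= 0 ->
    `|f s (u s) ord0 i - f s (v s) ord0 i| <= L * (a * expR (2 * L * `|s|)).
  move=> st; have := rV_coord_le (f s (u s) - f s (v s)) i; rewrite !mxE => h.
  apply: (le_trans h); apply: (le_trans (lip _ _ _)).
  by rewrite ler_pM2l//; exact: H.
have K (c A p q : R) : p <= q -> -1 < p -> q < 2 ->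
    (forall s, p < s < q -> (0 <= s <= t \/ t <= s <= 0) /\
       c * A * expR (c * s) = L * (a * expR (2 * L * `|s|))) ->
    `|d q - d p| <= A * expR (c * q) - A * expR (c * p).
  move=> pq p1 q2 Hs; apply: (incr_exp pq _ cd).
    by move=> s /andP[s1 s2]; apply: Dd; apply/andP; split; lra.
  by move=> s ss; have [st ->] := Hs s ss; apply: bd.
rewrite -/(d t); have [tge|tlt] := leP 0 t.
  have := @K (2 * L) (a / 2) 0 t tge; rewrite d0 subr0 mulr0 expR0 => KK.
  apply: le_trans (KK _ _ _) _ => //.
    move=> s /andP[s1 s2]; split; first by left; rewrite !ltW.
    by rewrite gtr0_norm//; field.
  by rewrite ger0_norm// lerBlDr lerDl; lra.
(* For t < 0 the increment is taken from t to 0, and the weight exp(2 L |s|) is exp(- 2 L s):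
   exponent and amplitude both change sign. *)
have := @K (- (2 * L)) (- (a / 2)) t 0 (ltW tlt); rewrite d0 sub0r normrN mulr0 expR0 => KK.
apply: le_trans (KK _ _ _) _ => //.
  move=> s /andP[s1 s2]; rewrite ltr0_norm// (_ : - (2 * L) * s = 2 * L * - s); last by ring.
  split; first by right; rewrite !ltW.
  by field.
rewrite ltr0_norm// (_ : - (2 * L) * t = 2 * L * - t); last by ring.
by move: (expR _) => ?; lra.
Qed.

Lemma picard_step (x0 : 'rV[R]_n) : exists P : (R -> 'rV[R]_n) -> R -> 'rV[R]_n,
  forall u, continuous u -> [/\ P u 0 = x0, continuous (P u) &
    forall t : R, -1 < t < 2 -> is_derive t (1:R) (P u) (f t (u t))].
Proof using cf lip L0.
suff /choice[P HP] : forall u, exists U, continuous u -> [/\ U 0 = x0, continuous U &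
    forall t : R, -1 < t < 2 -> is_derive t (1:R) U (f t (u t))] by exists P.
(* For discontinuous u the requirement is vacuous and [u] itself is a junk value. *)
move=> u; have [cu|ncu] := pselect (continuous u); last by exists u.
have [F HF] := continuous_primitive_rV x0 (picard_continuous cu).
by exists F.
Qed.

(** The interval ]-1/2, 3/2[ sits strictly between [0, 1] and the interval ]-1, 2[ of the
    primitives: the limit is formed at times clamped to [-1/2, 3/2], which is what makes it
    continuous everywhere. *)
Theorem picard (x0 : 'rV[R]_n) : exists u : R -> 'rV[R]_n,
  [/\ u 0 = x0, continuous u &
    forall t : R, -1/2 < t < 3/2 -> is_derive t (1:R) u (f t (u t))].
Proof using cf lip L0.
have [P HP] := picard_step x0.
pose u k := iter k P (fun=> x0).
have cu k : continuous (u k).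
  by elim: k => [|k /HP[]//]; move=> x; exact: cvg_cst.
have u0 k : u k 0 = x0 by case: k => [//|k]; have [] := HP _ (cu k).
have Du k (t : R) : -1 < t < 2 -> is_derive t (1:R) (u k.+1) (f t (u k t)).
  by have [_ _] := HP _ (cu k); exact.
pose g t := `|u 1%N t - x0|.
have cg : continuous g.
  by move=> x; apply: cvg_norm; apply: cvgB; [exact: cu|exact: cvg_cst].
have [c _ gc] := @EVT_max R g (-1) 2 ltac:(lra) (continuous_subspaceT cg).
pose B := g c.
have B0 : 0 <= B by exact: normr_ge0.
(* B bounds the first increment, and each application of the Picard operator halves the weighted
   distance. *)
have step k (t : R) : -1 < t < 2 ->
    `|u k.+1 t - u k t| <= B / 2 ^+ k * expR (2 * L * `|t|).
  elim: k t => [|k ih] t t12.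
    rewrite expr0 divr1; apply: (@le_trans _ _ B).
      by apply: gc; rewrite in_itv/=; move: t12 => /andP[? ?]; apply/andP; split; exact: ltW.
    by rewrite ler_peMr// -expR0 ler_expR mulr_ge0// mulr_ge0// ltW.
  rewrite exprS invfM (mulrC 2^-1) mulrA.
  have := @picard_contract (u k.+1) (u k) (u k.+2) (u k.+1) (B / 2 ^+ k) t t12
    (cu _) (cu _) (etrans (u0 _) (esym (u0 _))) (Du _) (Du _).
  apply=> s st; apply: ih.
  by move: t12 => /andP[? ?]; apply/andP; case: st => /andP[? ?]; split; lra.
pose E := expR (2 * L * 2).
pose C := B * E.
have stepC k (t : R) : -1 < t < 2 -> `|u k.+1 t - u k t| <= C / 2 ^+ k.
  move=> t12; apply: (le_trans (step k t t12)); rewrite /C [leRHS]mulrAC ler_wpM2l//.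
    by rewrite divr_ge0// exprn_ge0.
  rewrite /E ler_expR ler_pM2l ?mulr_gt0//; move: t12 => /andP[? ?].
  by rewrite ler_norml; apply/andP; split; lra.
have C0 : 0 <= C by rewrite mulr_ge0// expR_ge0.
have tail k j (t : R) : -1 < t < 2 -> `|u (k + j)%N t - u k t| <= 2 * C / 2 ^+ k.
  move=> t12; apply: (@le_trans _ _ (2 * C / 2 ^+ k - 2 * C / 2 ^+ (k + j))); last first.
    by rewrite gerBl; apply: divr_ge0; [exact: mulr_ge0|exact: exprn_ge0].
  elim: j => [|j ih]; first by rewrite addn0 !subrr normr0.
  rewrite (le_trans (ler_distD (u (k + j)%N t) _ _))// addnS.
  apply: (le_trans (lerD (stepC _ _ t12) ih)).
  rewrite exprS invfM; set w := 2 ^- (k + j).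
  by rewrite le_eqVlt; apply/orP; left; apply/eqP; field.
have cl1 (t : R) : -1 < clamp (-1/2) (3/2) t < 2.
  have /andP[] := @clamp_itv R (-1/2) (3/2) t ltac:(lra).
  by move=> ? ?; apply/andP; split; lra.
have /choice[l Hl] (t : R) : exists l, forall k,
    `|l - u k (clamp (-1/2) (3/2) t)| <= 2 * C / 2 ^+ k.
  by apply: geometric_limit => k j; exact: tail.
have cl : continuous l.
  move=> t; apply/cvgrPdist_le => e e0.
  have [k ke] := @half_geometric_lt R (2 * C) (e / 3) ltac:(lra).
  have cuk : continuous (fun t => u k (clamp (-1/2) (3/2) t)).
    move=> s; apply: (@continuous_comp _ _ _ (clamp (-1/2) (3/2)) (u k) s).
      exact: clamp_continuous.
    exact: cu.
  near=> s.
  have h1 : `|u k (clamp (-1/2) (3/2) t) - u k (clamp (-1/2) (3/2) s)| <= e / 3.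
    by near: s; have /cvgrPdist_le := cuk t; apply; rewrite divr_gt0.
  have h2 := Hl s k; rewrite distrC in h2.
  apply: le_trans (ler_distD (u k (clamp (-1/2) (3/2) t)) _ _) _.
  apply: le_trans (lerD (Hl t k) (ler_distD (u k (clamp (-1/2) (3/2) s)) _ _)) _.
  by apply: le_trans (lerD (lexx _) (lerD h1 h2)) _; move: ke; lra.
have [U0 cU DU] := HP _ cl.
have lU (t : R) : -1/2 <= t <= 3/2 -> l t = P l t.
  move=> t12.
  have t12' : -1 < t < 2 by move: t12 => /andP[? ?]; apply/andP; split; lra.
  (* Compare both sides with the iterate k+1: l is close to it by the geometric tail, and P l is
     close to it by contraction, as l is close to the iterate k. *)
  suff H k : `|l t - P l t| <= (2 * C + C * E) / 2 ^+ k.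
    apply/eqP; rewrite -subr_eq0 -normr_eq0 eq_le normr_ge0 andbT.
    apply/ler_addgt0Pl => e e0; rewrite addr0.
    by have [k ke] := half_geometric_lt (2 * C + C * E) e0; exact: le_trans (ltW ke).
  have := @picard_contract l (u k) (P l) (u k.+1) (2 * C / 2 ^+ k) t t12' cU (cu _)
    (etrans U0 (esym (u0 _))) DU (Du _).
  have H1 (s : R) : 0 <= s <= t \/ t <= s <= 0 ->
     `|l s - u k s| <= 2 * C / 2 ^+ k * expR (2 * L * `|s|).
    move=> st; have st' : -1/2 <= s <= 3/2.
      by move: t12 => /andP[? ?]; apply/andP; case: st => /andP[? ?]; split; lra.
    have := Hl s k; rewrite clamp_id// => /le_trans; apply.
    have Ck0 : 0 <= 2 * C / 2 ^+ k by apply: divr_ge0; [exact: mulr_ge0|exact: exprn_ge0].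
    rewrite ler_peMr//.
    by rewrite -expR0 ler_expR mulr_ge0// mulr_ge0// ltW.
  move=> /(_ H1) H2.
  have := Hl t k.+1; rewrite clamp_id// => H3.
  rewrite (le_trans (ler_distD (u k.+1 t) _ _))// mulrDl lerD//.
    have C20 : 0 <= 2 * C by exact: mulr_ge0.
    apply: (le_trans H3); rewrite ler_wpM2l// lef_pV2 ?posrE ?exprn_gt0//.
    by rewrite ler_eXn2l ?ltr1n.
  rewrite distrC; apply: (le_trans H2).
  have -> : 2 * C / 2 ^+ k / 2 = C / 2 ^+ k by field; exact: expf_neq0.
  rewrite [leRHS]mulrAC ler_wpM2l ?divr_ge0 ?exprn_ge0//.
  rewrite /E ler_expR ler_pM2l ?mulr_gt0//; move: t12' => /andP[? ?].
  by rewrite ler_norml; apply/andP; split; lra.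
exists (P l); split=> // t t12; rewrite -lU.
  by apply: DU; move: t12 => /andP[? ?]; apply/andP; split; lra.
by move: t12 => /andP[? ?]; apply/andP; split; lra.
Unshelve. all: by end_near.
Qed.

End picard.

(** * Gronwall's inequality *)

Section gronwall.
Context {R : realType}.

(** The dimension enters through the comparison of the sup norm with the Euclidean norm. The value
    is not sharp; what counts is that it depends on n and L only. *)
Definition gronwall_cst n (L : R) : R := n.+1%:R * expR (n%:R * (2 * L + 1)).

Lemma gronwall_cst_ge1 n L : 0 <= L -> 1 <= gronwall_cst n L.
Proof.
move=> L0; apply: mulr_ege1; first by rewrite ler1n.
by rewrite -expR0 ler_expR mulr_ge0// addr_ge0// mulr_ge0.
Qed.

Lemma sqnorm_ge0 n (x : 'rV[R]_n) : 0 <= sqnorm x.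
Proof. by apply: sumr_ge0 => i _; exact: sqr_ge0. Qed.

Lemma norm_sqr_le_sqnorm n (x : 'rV[R]_n) : `|x| ^+ 2 <= sqnorm x.
Proof.
rewrite -(@ler_pXn2r _ 2 isT) ?nnegrE ?sqr_ge0 ?sqnorm_ge0// -!exprM.
rewrite -(sqr_sqrtr (sqnorm_ge0 x)) -exprM ler_pXn2r ?nnegrE ?sqrtr_ge0//.
rewrite rV_norm_le ?sqrtr_ge0//; apply/forallP => i.
rewrite -sqrtr_sqr ler_sqrt ?sqnorm_ge0//.
by rewrite /sqnorm (bigD1 i)//= lerDl sumr_ge0// => j _; exact: sqr_ge0.
Qed.

Lemma sqnorm_le_norm_sqr n (x : 'rV[R]_n) : sqnorm x <= n%:R * `|x| ^+ 2.
Proof.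
rewrite /sqnorm mulr_natl -[X in _ *+ X]card_ord -sumr_const.
apply: ler_sum => i _; rewrite -real_normK ?num_real//.
by rewrite ler_pXn2r ?nnegrE// rV_coord_le.
Qed.

Lemma is_derive_sqnorm n (z : R -> 'rV[R]_n) (t : R) dz :
  is_derive t (1:R) z dz ->
  is_derive t (1:R) (fun s => sqnorm (z s)) (\sum_(i < n) 2 * z t ord0 i * dz ord0 i).
Proof.
move=> /is_derive_coordP D.
have -> : (fun s => sqnorm (z s)) = \sum_(i < n) (fun s => z s ord0 i) ^+ 2.
  by apply/funext => s; rewrite /sqnorm fct_sumE; apply: eq_bigr => i _; rewrite !fctE.
have Di i : is_derive t (1:R) ((fun s => z s ord0 i) ^+ 2) (2 * z t ord0 i * dz ord0 i).
  by have ? := D i; apply: is_derive_eq; rewrite /GRing.scale/= expr1.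
exact: is_derive_sum.
Qed.

(** The sup norm is not differentiable, so the argument runs on S = [sqnorm z]: from S' <= A (S +
    k^2) it follows that (S + k^2) exp(- A t) does not increase. *)
Lemma gronwall n (z dz : R -> 'rV[R]_n) (L k tau : R) : 0 <= L -> 0 <= k ->
  0 <= tau <= 1 ->
  (forall t : R, 0 <= t <= tau -> is_derive t (1:R) z (dz t)) ->
  (forall t : R, 0 <= t <= tau -> `|dz t| <= L * `|z t| + k) ->
  `|z tau| <= gronwall_cst n L * (`|z 0| + k).
Proof.
move=> L0 k0 /andP[tau0 tau1] Dz bz.
pose A := n%:R * (2 * L + 1).
have A0 : 0 <= A by rewrite mulr_ge0// addr_ge0// mulr_ge0.
pose S t := sqnorm (z t).
pose dS t := \sum_(i < n) 2 * z t ord0 i * dz t ord0 i.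
have DS (t : R) : 0 <= t <= tau -> is_derive t (1:R) S (dS t).
  by move=> /Dz; exact: is_derive_sqnorm.
have bS t : 0 <= t <= tau -> dS t <= A * (S t + k ^+ 2).
  move=> tt; apply: (@le_trans _ _ (n%:R * ((2 * L + 1) * `|z t| ^+ 2 + k ^+ 2))).
    set w := (X in n%:R * X); have -> : n%:R * w = \sum_(i < n) w.
      by rewrite sumr_const card_ord mulr_natl.
    rewrite /w; apply: ler_sum => i _.
    apply: le_trans (ler_norm _) _; rewrite !normrM ger0_norm//.
    have h1 := rV_coord_le (z t) i; have h2 := le_trans (rV_coord_le (dz t) i) (bz t tt).
    apply: (@le_trans _ _ (2 * `|z t| * (L * `|z t| + k))).
      by apply: ler_pM; rewrite ?mulr_ge0// ler_pM2l.
    (* The mixed term 2 a k is absorbed by a^2 + k^2, whence the summand 1 in 2 L + 1. *)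
    have := sqr_ge0 (`|z t| - k); move: (`|z t|) => a; rewrite !expr2; nra.
  rewrite /A -mulrA ler_wpM2l// mulrDr lerD//.
    by rewrite ler_wpM2l ?norm_sqr_le_sqnorm// addr_ge0// mulr_ge0.
  by rewrite ler_peMl ?sqr_ge0// lerDr mulr_ge0.
pose T t := (S t + k ^+ 2) * expR (- A * t).
have DT (t : R) : 0 <= t <= tau -> is_derive t (1:R) T
    (dS t * expR (- A * t) + (S t + k ^+ 2) * (- A * expR (- A * t))).
  move=> tt; have D1 := DS t tt; have D2 := is_derive_expM (- A) t.
  have -> : T = (S + cst (k ^+ 2)) * (fun s => expR (- A * s)) by [].
  apply: is_derive_eq; rewrite !fctE addr0 /GRing.scale/=.
  by ring.
have T10 : T tau <= T 0.
  apply: (@ler0_derive1_le_cc R T 0 tau) => //.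
  - move=> t; rewrite in_itv/= => /andP[t0 t1].
    by have [] := DT t; rewrite ?ltW.
  - move=> t; rewrite in_itv/= => /andP[t0 t1].
    have tt : 0 <= t <= tau by rewrite !ltW.
    have [_] := DT t tt; rewrite derive1E => ->.
    have := bS t tt; have := expR_ge0 (- A * t); move: (expR _) => e e0 h.
    by rewrite [X in _ + X]mulrA -mulrDl mulr_le0_ge0//; lra.
  - apply/continuous_in_subspaceT => t; rewrite inE/= in_itv/= => tt.
    by apply: differentiable_continuous; apply/derivable1_diffP; have [] := DT t tt.
  - by rewrite in_itv/= lexx andbT.
  - by rewrite in_itv/= lexx.
have Stau : S tau + k ^+ 2 <= (S 0 + k ^+ 2) * expR A.
  move: T10; rewrite /T mulr0 expR0 mulr1 mulNr expRN ler_pdivrMr ?expR_gt0// => h.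
  apply: (le_trans h); rewrite ler_wpM2l ?ler_expR ?ler_piMr//.
  by rewrite addr_ge0 ?sqr_ge0 ?sqnorm_ge0.
have E1 := gronwall_cst_ge1 n L0; set E := gronwall_cst n L in E1 *.
have E0 : 0 <= E by exact: le_trans E1.
rewrite -(@ler_pXn2r _ 2 isT) ?nnegrE ?mulr_ge0 ?addr_ge0//.
apply: (le_trans (norm_sqr_le_sqnorm _)).
(* As E >= 1, the bound with E in place of E^2 is enough and avoids a square root of the
   constant. *)
apply: (@le_trans _ _ (E * (`|z 0| + k) ^+ 2)); last first.
  by rewrite exprMn ler_wpM2r ?sqr_ge0// expr2 ler_peMr.
rewrite -/(S tau); apply: (@le_trans _ _ (S tau + k ^+ 2)); first by rewrite lerDl sqr_ge0.
apply: (le_trans Stau); rewrite /E /gronwall_cst -/A mulrAC ler_wpM2r ?expR_ge0//.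
have := sqnorm_le_norm_sqr (z 0); rewrite -/(S 0) -natr1 => h.
have := normr_ge0 (z 0); move: (`|z 0|) h => a h a0.
have n0 : 0 <= n%:R :> R by [].
move: (n%:R) n0 h => N n0; rewrite !expr2 => h.
have h1 : 0 <= a * k by exact: mulr_ge0.
have h2 : 0 <= N * (a * k) by exact: mulr_ge0.
have h3 : 0 <= N * (k * k) by rewrite !mulr_ge0.
have h4 : 0 <= a * a by exact: mulr_ge0.
lra.
Qed.

End gronwall.

(** * Mean value inequality and uniform strict differentiability *)

Section mean_value.
Context {R : realType}.

Lemma is_derive_comp_diff (V W : normedModType R) (c : R -> V) (F : V -> W) (t : R) v :
  is_derive t (1:R) c v -> differentiable F (c t) ->
  is_derive t (1:R) (F \o c) ('d F (c t) v).
Proof.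
move=> [dc ec] dF; have dc' : differentiable c t by apply/derivable1_diffP.
have dFc : differentiable (F \o c) t by exact: differentiable_comp.
apply: DeriveDef; first exact/derivable1_diffP.
by rewrite (deriveE _ dFc) diff_comp//= -ec (deriveE _ dc').
Qed.

Lemma is_derive_line (V : normedModType R) (x w : V) (s : R) :
  is_derive s (1:R) (fun t : R => x + t *: w) w.
Proof.
have dw : differentiable (fun t : R => t *: w) s by exact: differentiableZl.
have D : is_derive s (1:R) (fun t : R => t *: w) w.
  apply: DeriveDef; first exact/derivable1_diffP.
  by rewrite (deriveE _ dw) diffZl// diff_val scale1r.
have -> : (fun t : R => x + t *: w) = cst x + (fun t : R => t *: w) by [].
by have := is_deriveD (is_derive_cst x s 1) D; rewrite add0r.
Qed.

Lemma mean_value_ineq (V : normedModType R) n (F : V -> 'rV[R]_n) (x y : V) (B : R) :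
  (forall s : R, 0 <= s <= 1 -> differentiable F (x + s *: (y - x)) /\
     `|'d F (x + s *: (y - x)) (y - x)| <= B) ->
  `|F y - F x| <= B.
Proof.
move=> H.
have B0 : 0 <= B by have [|_] := H 0; [rewrite lexx ler01|exact: le_trans].
rewrite rV_norm_le//; apply/forallP => i; rewrite !mxE.
pose c (s : R) := x + s *: (y - x).
have D (s : R) : 0 <= s <= 1 ->
    is_derive s (1:R) (fun t => F (c t) ord0 i) ('d F (c s) (y - x) ord0 i).
  move=> ss; have [dF _] := H s ss.
  by have /is_derive_coordP := is_derive_comp_diff (is_derive_line x (y - x) s) dF; exact.
have -> : y = c 1 by rewrite /c scale1r addrC subrK.
have -> : F x = F (c 0) by rewrite /c scale0r addr0.
have := @le_derive_increment R (fun t => F (c t) ord0 i) (fun t => B * t) _ (fun=> B) 0 1 ler01.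
rewrite mulr1 mulr0 subr0; apply.
- by move=> t /andP[t0 t1]; apply: D; rewrite !ltW.
- move=> t _; have -> : (fun t => B * t) = B *: (@id R) :> (R -> R) by [].
  by apply: is_derive_eq; rewrite /GRing.scale/= mulr1.
- apply/continuous_in_subspaceT => t; rewrite inE/= in_itv/= => tt.
  by apply: differentiable_continuous; apply/derivable1_diffP; have [] := D t tt.
- by apply: continuous_subspaceT => t; apply: cvgM; [exact: cvg_cst|exact: cvg_id].
- move=> t /andP[t0 t1]; apply: le_trans (rV_coord_le _ _) _.
  by have [|_ h] := H t; [rewrite !ltW|exact: h].
Qed.

Lemma linear_rV_bound (W : normedModType R) q (L : {linear 'rV[R]_q -> W}) v :
  `|L v| <= (\sum_(i < q) `|L 'e_i|) * `|v|.
Proof.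
rewrite [X in L X](row_sum_delta v) linear_sum (le_trans (ler_norm_sum _ _ _))//.
rewrite mulr_suml ler_sum// => i _; rewrite linearZ normrZ mulrC ler_wpM2l//.
exact: rV_coord_le.
Qed.

Lemma linear_rV_continuous (W : normedModType R) q (L : {linear 'rV[R]_q -> W}) :
  continuous L.
Proof.
pose C := \sum_(i < q) `|L 'e_i| + 1.
have C0 : 0 < C by rewrite ltr_wpDl// sumr_ge0.
move=> x; apply/(@cvgrPdist_le _ _ _ (nbhs x) (nbhs_filter x)) => e e0; apply/nbhs_ballP.
exists (e / C); first by rewrite /= divr_gt0.
move=> y; rewrite -ball_normE /= => xy.
rewrite -linearB (le_trans (linear_rV_bound _ _))//.
apply: (@le_trans _ _ (C * `|x - y|)); first by rewrite ler_wpM2r// lerDl.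
by rewrite -ler_pdivlMl// mulrC ltW.
Qed.

Lemma linear_diff_bound (W : normedModType R) q (A B : {linear 'rV[R]_q -> W}) e : 0 <= e ->
  (forall i, `|A 'e_i - B 'e_i| <= e / q.+1%:R) -> forall v, `|A v - B v| <= e * `|v|.
Proof.
move=> e0 hi v.
rewrite [X in A X](row_sum_delta v) [X in B X](row_sum_delta v).
rewrite (linear_sum A) (linear_sum B) -sumrB (le_trans (ler_norm_sum _ _ _))//.
apply: (@le_trans _ _ (\sum_(i < q) e / q.+1%:R * `|v|)).
  apply: ler_sum => i _; rewrite (linearZ_LR A) (linearZ_LR B) -scalerBr normrZ mulrC.
  by apply: ler_pM => //; exact: rV_coord_le.
rewrite sumr_const card_ord -(mulr_natl (_ * _)) mulrA ler_wpM2r// mulrCA ler_piMr//.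
by rewrite ler_pdivrMr// mul1r ler_nat.
Qed.

Lemma diff_sub_linear (V W : normedModType R) (f : V -> W) (B : {linear V -> W}) z :
  continuous B -> differentiable f z ->
  differentiable (fun x => f x - B x) z /\
  forall v, 'd (fun x => f x - B x) z v = 'd f z v - B v.
Proof.
move=> cB df; have dB : differentiable B z by exact: linear_differentiable.
split; first exact: differentiableB.
move=> v; have := congr1 (fun h : V -> W => h v) (diffB df dB).
by move=> ->; exact: (congr1 (fun h : V -> W => 'd f z v - h v) (diff_lin z cB)).
Qed.

Lemma dist_half (W : normedModType R) (u v w : W) (e d : R) :
  `|u - v| <= e / 2 * d -> `|w - v| <= e / 2 * d -> `|u - w| <= e * d.
Proof.
move=> uv wv; apply: le_trans (ler_distD v _ _) _; rewrite (distrC v).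
by apply: (le_trans (lerD uv wv)); rewrite -mulrDl -splitr.
Qed.

(** Continuity of the finitely many partial derivatives gives uniformity over all directions v by
    linearity. The share e / q.+1 stays meaningful for q = 0. *)
Lemma class_C1_strict q n (U : set 'rV[R]_q) (f : 'rV[R]_q -> 'rV[R]_n) a e :
  open U -> class_C 1 U f -> U a -> 0 < e ->
  \forall z \near a, U z /\ forall v, `|'d f z v - 'd f a v| <= e * `|v|.
Proof.
move=> oU [df Df] Ua e0.
have e1 : 0 < e / q.+1%:R by rewrite divr_gt0.
have Hn : \forall z \near a, forall i : 'I_q,
    `|'D_('e_i) f a - 'D_('e_i) f z| <= e / q.+1%:R.
  apply: (@filter_forall _ _ _ (nbhs a) (nbhs_filter a)) => i.
  by have /cvgrPdist_le := Df 'e_i a Ua; exact.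
apply: filterS (filterI (open_nbhs_nbhs (conj oU Ua)) Hn) => z [Uz hz].
split=> // v.
have Ed y (i : 'I_q) : U y -> 'd f y 'e_i = 'D_('e_i) f y.
  by move=> Uy; rewrite deriveE//; exact: df.
have hi (i : 'I_q) : `|'d f z 'e_i - 'd f a 'e_i| <= e / q.+1%:R.
  by have := hz i; rewrite -normrN opprB -(Ed z i Uz) -(Ed a i Ua).
exact: linear_diff_bound (ltW e0) hi v.
Qed.

(** One radius r serves all of K and also provides a tube around K inside U. It yields local
    Lipschitz bounds as well as the first-order expansion of the field along a trajectory. *)
Lemma compact_strict_diff q n (U K : set 'rV[R]_q) (f : 'rV[R]_q -> 'rV[R]_n) e :
  open U -> class_C 1 U f -> compact K -> K `<=` U -> 0 < e ->
  exists2 r, 0 < r & forall a, K a -> forall x y, `|x - a| < r -> `|y - a| < r ->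
    [/\ U x, U y & `|f y - f x - 'd f a (y - x)| <= e * `|y - x|].
Proof.
move=> oU Cf cK KU e0.
have [df _] := Cf.
pose P (r : R) a := forall x y, `|x - a| < r -> `|y - a| < r ->
    [/\ U x, U y & `|f y - f x - 'd f a (y - x)| <= e * `|y - x|].
suff [r r0 Pr] : exists2 r, 0 < r & K `<=` P r by exists r.
have : \forall r \near 0^'+, K `<=` P r.
  move/compact_near_coveringP : cK; apply => a0 Ka0.
  have e2 : 0 < e / 2 by rewrite divr_gt0.
  have /nbhs_ballP[d /= d0 Hd] := class_C1_strict oU Cf (KU _ Ka0) e2.
  exists (ball a0 (d / 2), [set r | r < d / 2]).
    split; first by apply: nbhsx_ballx; rewrite divr_gt0.
    by apply: nbhs_right_lt; rewrite divr_gt0.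
  move=> [a r] [/= aa0 rd] x y xa ya.
  rewrite -ball_normE /= in aa0.
  have inb z : `|z - a| < d / 2 -> ball a0 d z.
    move=> za; rewrite -ball_normE /=.
    have := ler_distD a a0 z; rewrite (distrC a z) => /le_lt_trans; apply.
    by rewrite (splitr d) ltrD.
  have aba : ball a0 d a by apply: inb; rewrite subrr normr0 divr_gt0.
  have bx := inb _ (lt_trans xa rd); have by_ := inb _ (lt_trans ya rd).
  have [Ux _] := Hd _ bx; have [Uy _] := Hd _ by_.
  split=> //.
  (* The differential of g along the segment is 'd f z - 'd f a; both are within e / 2 of 'd f a0,
     so the mean value inequality gives the factor e. *)
  pose g := fun z => f z - 'd f a z.
  have -> : f y - f x - 'd f a (y - x) = g y - g x.
    by rewrite /g linearB; apply/rowP => i; rewrite !mxE; ring.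
  apply: mean_value_ineq => s /andP[s0 s1].
  set z := x + s *: (y - x).
  have bz : ball a0 d z.
    apply: inb; rewrite /z.
    have -> : x + s *: (y - x) - a = (1 - s) *: (x - a) + s *: (y - a).
      by apply/rowP => i; rewrite !mxE; ring.
    apply: le_lt_trans rd; apply: (le_trans (ler_normD _ _)); rewrite !normrZ.
    rewrite (ger0_norm s0) ger0_norm ?subr_ge0//.
    apply: (@le_trans _ _ ((1 - s) * r + s * r)); last by rewrite -mulrDl subrK mul1r.
    by apply: lerD; apply: ler_wpM2l; rewrite ?subr_ge0// ltW.
  have [Uz hz] := Hd _ bz; have [_ ha] := Hd _ aba.
  have [dg Eg] := diff_sub_linear (@linear_rV_continuous _ _ ('d f a)) (df _ Uz).
  split; first exact: dg.
  rewrite Eg.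
  exact: (dist_half (hz _) (ha _)).
move=> H; near (0 : R)^'+ => r; exists r => //; near: r => //.
Unshelve. all: by end_near. Qed.

Lemma compact_diff_bound q n (U K : set 'rV[R]_q) (f : 'rV[R]_q -> 'rV[R]_n) :
  open U -> class_C 1 U f -> compact K -> K `<=` U ->
  exists2 L, 0 < L & forall a, K a -> forall v, `|'d f a v| <= L * `|v|.
Proof.
move=> oU Cf cK KU.
pose P (L : R) a := forall v, `|'d f a v| <= L * `|v|.
suff [L L0 PL] : exists2 L, 0 < L & K `<=` P L by exists L.
have : \forall L \near +oo, K `<=` P L.
  move/compact_near_coveringP : cK; apply => a0 Ka0.
  have Hd := class_C1_strict oU Cf (KU _ Ka0) ltr01.
  pose C := \sum_(i < q) `|'d f a0 'e_i|.
  exists ([set a | U a /\ forall v, `|'d f a v - 'd f a0 v| <= 1 * `|v|], [set L | 1 + C <= L]).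
    by split; [exact: Hd|by apply: nbhs_pinfty_ge; rewrite num_real].
  move=> [a L] [/= [_ ha] CL] v.
  apply: (@le_trans _ _ ((1 + C) * `|v|)); last by rewrite ler_wpM2r.
  rewrite mulrDl -[X in `|X|](subrK ('d f a0 v)) (le_trans (ler_normD _ _))//.
  by rewrite lerD//; exact: linear_rV_bound.
move=> H; near (+oo : set_system R) => L; exists L => //; near: L => //.
Unshelve. all: by end_near. Qed.

End mean_value.

(** The derivative is two-sided also at 0 and at T, so the values of c just outside [0, T] matter;
    extending a solution therefore replaces c beyond T and glues differentiably there. *)
Definition solution (R : realType) n (xi : 'rV[R]_n -> 'rV[R]_n) (U : set 'rV[R]_n)
    (x : 'rV[R]_n) (c : R -> 'rV[R]_n) (T : R) : Prop :=
  c 0 = x /\ forall t : R, 0 <= t <= T -> U (c t) /\ is_derive t (1:R) c (xi (c t)).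

Definition flow_domain (R : realType) n (xi : 'rV[R]_n -> 'rV[R]_n) (U : set 'rV[R]_n) :=
  [set x | exists c, solution xi U x c 1].

(* Junk value 0 outside [flow_domain xi U]. *)
Definition flow1 (R : realType) n (xi : 'rV[R]_n -> 'rV[R]_n) (U : set 'rV[R]_n)
  (x : 'rV[R]_n) : 'rV[R]_n := xget 0 [set y | exists2 c, solution xi U x c 1 & c 1 = y].

Lemma is_derive_continuous (R : realType) (V : normedModType R) (c : R -> V) (t : R) v :
  is_derive t (1:R) c v -> {for t, continuous c}.
Proof. by move=> [dc _]; apply: differentiable_continuous; apply/derivable1_diffP. Qed.

Lemma vclamp_continuous (R : realType) n (r : R) : continuous (@vclamp R n r).
Proof.
move=> x; apply/(@cvgrPdist_le _ _ _ (nbhs x) (nbhs_filter x)) => e e0; apply/nbhs_ballP.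
exists e => // y; rewrite -ball_normE /= => xy.
by apply: (le_trans (vclamp_lip _ _ _)); exact: ltW.
Qed.

(** * Uniqueness, perturbation and differentiability of the time-one flow *)

Section flow.
Context {R : realType} {n : nat}.
Variables (xi : 'rV[R]_n -> 'rV[R]_n) (U : set 'rV[R]_n).
Hypothesis oU : open U.
Hypothesis Cxi : class_C 1 U xi.

Lemma solution_compact x c T : solution xi U x c T ->
  compact (c @` `[0, T]) /\ c @` `[0, T] `<=` U.
Proof.
move=> [_ H]; split; last by move=> _ [t /= + <-]; rewrite in_itv/= => /H[].
apply: continuous_compact; last exact: segment_compact.
apply/continuous_in_subspaceT => t; rewrite inE/= in_itv/= => /H[_].
exact: is_derive_continuous.
Qed.

Lemma clamp01 (t : R) : 0 <= clamp 0 1 t <= 1.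
Proof. exact: clamp_itv. Qed.

Lemma solution_clamp_continuous x c : solution xi U x c 1 ->
  continuous (fun t => c (clamp 0 1 t)).
Proof.
move=> [_ H] t; apply: (@continuous_comp _ _ _ (clamp 0 1) c).
  exact: clamp_continuous.
by have [_] := H _ (clamp01 t); exact: is_derive_continuous.
Qed.

Lemma compact_lipschitz (K : set 'rV[R]_n) : compact K -> K `<=` U ->
  exists r L, [/\ 0 < r, 0 < L & forall a, K a -> forall x y, `|x - a| < r -> `|y - a| < r ->
    [/\ U x, U y & `|xi y - xi x| <= L * `|y - x|]].
Proof using oU Cxi.
move=> cK KU.
have [r r0 Hr] := compact_strict_diff oU Cxi cK KU ltr01.
have [L L0 HL] := compact_diff_bound oU Cxi cK KU.
exists r, (1 + L); split=> //; first by rewrite addr_gt0.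
move=> a Ka x y xa ya; have [Ux Uy h] := Hr a Ka x y xa ya.
split=> //; rewrite -[X in `|X|](subrK ('d xi a (y - x))).
by rewrite (le_trans (ler_normD _ _))// mulrDl lerD//; exact: HL.
Qed.

Lemma solution_unique x c d T t : 0 <= t <= T -> T <= 1 ->
  solution xi U x c T -> solution xi U x d T -> c t = d t.
Proof using oU Cxi.
move=> /andP[t0 tT] T1 sc sd.
have [cK1 KU1] := solution_compact sc; have [cK2 KU2] := solution_compact sd.
pose K := c @` `[0, T] `|` d @` `[0, T].
have cK : compact K by exact: compactU.
have KU : K `<=` U by move=> z [/KU1|/KU2].
have [r [L [r0 L0 Hr]]] := compact_lipschitz cK KU.
have [df _] := Cxi.
have : compact (xi @` K).
  apply: continuous_compact cK; apply/continuous_in_subspaceT => z; rewrite inE => /KU Uz.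
  exact/differentiable_continuous/df.
move=> /compact_bounded[M0 [_ HM0]].
have [M M1 HM] : exists2 M, 0 < M & forall z, K z -> `|xi z| <= M.
  exists (Num.max M0 0 + 1); first by rewrite ltr_wpDl// le_max lexx orbT.
  by move=> z Kz; apply: HM0; [rewrite ltr_pwDr// le_max lexx|exists z].
(* The Lipschitz bound L holds only for points closer than r. For points at distance at least r, the
   trivial bound 2 M on the difference of the field is at most 2 M / r times the distance. *)
pose Lam := L + 2 * M / r.
have Mr0 : 0 <= 2 * M / r.
  by apply: divr_ge0; [apply: mulr_ge0 => //|]; exact: ltW.
have Lam0 : 0 <= Lam by rewrite addr_ge0// ltW.
have Kc s : 0 <= s <= T -> K (c s) by move=> sT; left; exists s => //=; rewrite in_itv/= sT.
have Kd s : 0 <= s <= T -> K (d s) by move=> sT; right; exists s => //=; rewrite in_itv/= sT.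
have lip s : 0 <= s <= T -> `|xi (c s) - xi (d s)| <= Lam * `|c s - d s| + 0.
  move=> sT; rewrite addr0; have [lt|ge] := ltP `|c s - d s| r.
    have [|_ _ h] := Hr (d s) (Kd _ sT) (d s) (c s) _ lt.
      by rewrite subrr normr0.
    by apply: (le_trans h); rewrite ler_wpM2r// lerDl.
  apply: (@le_trans _ _ (2 * M / r * r)).
    rewrite divfK ?gt_eqF// (le_trans (ler_normB _ _))// mulr_natl mulr2n.
    by apply: lerD; apply: HM; [exact: Kc|exact: Kd].
  by apply: ler_pM => //; rewrite ?lerDr ltW.
have [c0 Hc] := sc; have [d0 Hd] := sd.
have Dz (s : R) : 0 <= s <= t -> is_derive s (1:R) (fun s => c s - d s) (xi (c s) - xi (d s)).
  move=> /andP[s0 st]; have sT : 0 <= s <= T by rewrite s0 (le_trans st).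
  by have [_ D1] := Hc s sT; have [_ D2] := Hd s sT; exact: is_deriveB.
have := @gronwall R n _ _ Lam 0 t Lam0 (lexx 0) _ Dz.
rewrite t0 (le_trans tT T1) c0 d0 subrr normr0 addr0 mulr0 => /(_ isT) h.
apply/eqP; rewrite -subr_eq0 -normr_le0; apply: h => s /andP[s0 st].
by apply: lip; rewrite s0 (le_trans st).
Qed.

Lemma flow1E x c : solution xi U x c 1 -> flow1 xi U x = c 1.
Proof using oU Cxi.
move=> sc; rewrite /flow1; case: xgetP => [y _ [d sd <-]|/(_ (c 1))[]]; last by exists c.
by apply: (@solution_unique x d c 1) => //; rewrite ler01 lexx.
Qed.

(** The field is modified outside a tube around c by clamping x - c(t), which makes it globally
    Lipschitz and solvable up to time 1. By Gronwall a nearby start stays in the tube of radius r /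
    2, where nothing was modified. *)
Lemma solution_perturb x0 c : solution xi U x0 c 1 ->
  exists d E, [/\ 0 < d, 0 < E & forall x, `|x - x0| < d ->
    exists2 u, solution xi U x u 1 & forall t, 0 <= t <= 1 -> `|u t - c t| <= E * `|x - x0|].
Proof using oU Cxi.
move=> sc; have [cK KU] := solution_compact sc.
have [r [L [r0 L0 Hr]]] := compact_lipschitz cK KU.
have [df _] := Cxi; have [c0 Hc] := sc.
pose ct t := c (clamp 0 1 t).
have cct : continuous ct by exact: solution_clamp_continuous sc.
have Kct t : (c @` `[0, 1]) (ct t) by exists (clamp 0 1 t) => //=; rewrite in_itv/= clamp01.
have r2 : 0 < r / 2 by rewrite divr_gt0.
have r2r : r / 2 < r by rewrite ltr_pdivrMr// ltr_pMr// ltr1n.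
pose g t x := ct t + vclamp (r / 2) (x - ct t).
have gt t x : `|g t x - ct t| < r.
  by rewrite /g addrC addKr (le_lt_trans (vclamp_le _ (ltW r2))).
pose f t x := xi (g t x).
have lip t x y : `|f t x - f t y| <= L * `|x - y|.
  have [_ _ h] := Hr _ (Kct t) _ _ (gt t y) (gt t x).
  apply: (le_trans h); rewrite ler_pM2l// /g opprD addrACA subrr add0r.
  by apply: (le_trans (vclamp_lip _ _ _)); rewrite opprB addrA subrK.
have cf x : continuous (f ^~ x).
  move=> t; apply: (@continuous_comp _ _ _ (g ^~ x) xi); last first.
    by apply: differentiable_continuous; apply: df; have [] := Hr _ (Kct t) _ _ (gt t x) (gt t x).
  apply: cvgD; first exact: cct.
  apply: (@continuous_comp _ _ _ (fun t => x - ct t) (vclamp (r / 2))).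
    by apply: cvgB; [exact: cvg_cst|exact: cct].
  exact: vclamp_continuous.
pose E := gronwall_cst n L.
have E1 : 1 <= E := gronwall_cst_ge1 n (ltW L0).
have E0 : 0 < E by exact: lt_le_trans E1.
(* With E the Gronwall factor, this initial distance keeps the trajectory within r / 2 of c. *)
exists (r / 2 / E), E; split=> //; first by rewrite divr_gt0.
move=> x xx0; have [u [u0 _ Du]] := picard L0 lip cf x.
have ctE t : 0 <= t <= 1 -> ct t = c t by move=> tt; rewrite /ct clamp_id.
have ft t : 0 <= t <= 1 -> f t (c t) = xi (c t).
  move=> tt; rewrite /f /g ctE// subrr vclamp_id ?addr0//.
  by rewrite normr0 ltW.
have Du' (t : R) : 0 <= t <= 1 -> is_derive t (1:R) u (f t (u t)).
  by move=> /andP[? ?]; apply: Du; apply/andP; split; lra.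
have bu t : 0 <= t <= 1 -> `|u t - c t| <= E * `|x - x0|.
  move=> /andP[t0 t1].
  have tt (s : R) : 0 <= s <= t -> 0 <= s <= 1 by move=> /andP[-> /le_trans ->].
  have := @gronwall R n (fun s => u s - c s) (fun s => f s (u s) - xi (c s)) L 0 t
    (ltW L0) (lexx 0).
  rewrite t0 t1 u0 c0 !addr0; apply => //.
    move=> s /tt ss; have D1 := Du' s ss; have [_ D2] := Hc s ss.
    exact: is_deriveB.
  by move=> s /tt ss; rewrite addr0 -ft//.
exists u => //; split=> // t tt.
have ut : `|u t - ct t| <= r / 2.
  rewrite ctE//; apply: (le_trans (bu t tt)).
  by rewrite mulrC -ler_pdivlMr// ltW.
have fu : f t (u t) = xi (u t) by rewrite /f /g vclamp_id// addrC subrK.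
split; last by rewrite -fu; exact: Du'.
have utr := le_lt_trans ut r2r.
by have [] := Hr _ (Kct t) _ _ utr utr.
Qed.

Lemma open_flow_domain : open (flow_domain xi U).
Proof using oU Cxi.
rewrite openE => x [c sc]; rewrite /interior.
have [d [E [d0 _ H]]] := solution_perturb sc.
apply/nbhs_ballP; exists d => // y; rewrite -ball_normE /= distrC => yx.
by have [u su _] := H y yx; exists u.
Qed.

Lemma variational_solution x c v : solution xi U x c 1 ->
  exists w : R -> 'rV[R]_n, w 0 = v /\
    forall t : R, 0 <= t <= 1 -> is_derive t (1:R) w ('d xi (c t) (w t)).
Proof using oU Cxi.
move=> sc; have [cK KU] := solution_compact sc.
have [L L0 HL] := compact_diff_bound oU Cxi cK KU.
pose ct t := c (clamp 0 1 t).
have cct : continuous ct by exact: solution_clamp_continuous sc.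
have Kct t : (c @` `[0, 1]) (ct t) by exists (clamp 0 1 t) => //=; rewrite in_itv/= clamp01.
pose f t (x : 'rV[R]_n) := 'd xi (ct t) x.
have lip t y z : `|f t y - f t z| <= L * `|y - z|.
  by rewrite /f -linearB; exact: HL.
have cf y : continuous (f ^~ y).
  move=> t; apply/cvgrPdist_le => e e0.
  (* The operator-norm estimate is multiplied by |y| afterwards; the summand 1 covers y = 0. *)
  have e1 : 0 < e / (`|y| + 1) by rewrite divr_gt0// ltr_wpDl.
  have Hs := class_C1_strict oU Cxi (KU _ (Kct t)) e1.
  have : \forall s \near t, U (ct s) /\
     forall v, `|'d xi (ct s) v - 'd xi (ct t) v| <= e / (`|y| + 1) * `|v| by exact: (cct t _ Hs).
  apply: filterS => s [_ /(_ y) h]; rewrite -normrN opprB.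
  apply: (le_trans h); rewrite -mulrA ger_pMr// mulrC ler_pdivrMr ?mul1r ?lerDl//.
have [w [w0 _ Dw]] := picard L0 lip cf v.
exists w; split=> // t tt; have := Dw t; rewrite /f /ct clamp_id//; apply.
by move: tt => /andP[? ?]; apply/andP; split; lra.
Qed.

Lemma variational_unique x c (w1 w2 : R -> 'rV[R]_n) : solution xi U x c 1 ->
  w1 0 = w2 0 ->
  (forall t : R, 0 <= t <= 1 -> is_derive t (1:R) w1 ('d xi (c t) (w1 t))) ->
  (forall t : R, 0 <= t <= 1 -> is_derive t (1:R) w2 ('d xi (c t) (w2 t))) ->
  w1 1 = w2 1.
Proof using oU Cxi.
move=> sc w12 D1 D2; have [cK KU] := solution_compact sc.
have [L L0 HL] := compact_diff_bound oU Cxi cK KU.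
have := @gronwall R n (fun s => w1 s - w2 s)
  (fun s => 'd xi (c s) (w1 s) - 'd xi (c s) (w2 s)) L 0 1 (ltW L0) (lexx 0).
rewrite ler01 lexx w12 subrr normr0 addr0 mulr0 => /(_ isT) h.
apply/eqP; rewrite -subr_eq0 -normr_le0; apply: h => s ss.
  by have d1 := D1 s ss; have d2 := D2 s ss; exact: is_deriveB.
by rewrite addr0 -linearB; apply: HL; exists s => //=; rewrite in_itv/=.
Qed.

(** The defect u - c - w between a neighbouring trajectory, c and the variational solution obeys a
    linear equation with forcing o(|y - x0|), so Gronwall bounds it at time 1. Quantifying over all
    variational solutions w describes the differential without naming it. *)
Lemma flow1_diff x0 c : solution xi U x0 c 1 ->
  differentiable (flow1 xi U) x0 /\
  forall w : R -> 'rV[R]_n,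
    (forall t : R, 0 <= t <= 1 -> is_derive t (1:R) w ('d xi (c t) (w t))) ->
    'd (flow1 xi U) x0 (w 0) = w 1.
Proof using oU Cxi.
move=> sc; have [cK KU] := solution_compact sc.
have [L L0 HL] := compact_diff_bound oU Cxi cK KU.
have /choice[w Hw] v := variational_solution v sc.
pose W v := w v 1.
have linW : linear W.
  move=> a u v; rewrite /W.
  apply: (@variational_unique x0 c (w (a *: u + v)) (fun s => a *: w u s + w v s) sc).
  - have [-> _] := Hw (a *: u + v).
    by have [-> _] := Hw u; have [-> _] := Hw v.
  - by have [] := Hw (a *: u + v).
  - move=> t tt; have [_ Du] := Hw u; have [_ Dv] := Hw v.
    rewrite linearP; have d1 := Du t tt; have d2 := Dv t tt.
    by apply: is_deriveD; apply: is_deriveZ.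
pose LM := GRing.isLinear.Build _ _ _ _ _ linW.
pose LW : {linear 'rV[R]_n -> 'rV[R]_n} := HB.pack W LM.
suff H e : 0 < e -> \forall y \near x0,
    `|flow1 xi U y - flow1 xi U x0 - LW (y - x0)| <= e * `|y - x0|.
  have [d1 d2] := eps_diff (@linear_rV_continuous _ _ _ LW) H.
  split=> // w' Dw'; rewrite [LHS](congr1 (fun h : 'rV[R]_n -> 'rV[R]_n => h (w' 0)) d2).
  change (W (w' 0) = w' 1).
  by have [w0 Dw] := Hw (w' 0); apply: (variational_unique sc).
move=> e0; have [d [E [d0 E0 Hp]]] := solution_perturb sc.
pose E' := gronwall_cst n L.
have E'0 : 0 < E' by apply: (lt_le_trans ltr01); exact: gronwall_cst_ge1 (ltW L0).
(* E converts the initial distance into the distance along the trajectory, and E' is the Gronwall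
   factor for the defect; together they turn e' into e. *)
pose e' := e / (E' * E).
have e'0 : 0 < e' by rewrite divr_gt0// mulr_gt0.
have [r r0 Hr] := compact_strict_diff oU Cxi cK KU e'0.
have rE : 0 < r / E by rewrite divr_gt0.
apply/nbhs_ballP; exists (Num.min d (r / E)); first by rewrite /= lt_min d0.
move=> y; rewrite -ball_normE /= distrC lt_min => /andP[yd yr].
have [u su bu] := Hp y yd.
rewrite (flow1E su) (flow1E sc).
change (`|u 1 - c 1 - w (y - x0) 1| <= e * `|y - x0|).
have [w0 Dw] := Hw (y - x0); set wy := w (y - x0) in w0 Dw *.
have [c0 Hc] := sc; have [u0 Hu] := su.
have := @gronwall R n (fun s => u s - c s - wy s)
  (fun s => xi (u s) - xi (c s) - 'd xi (c s) (wy s)) L (e' * E * `|y - x0|) 1 (ltW L0).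
rewrite ler01 lexx u0 c0 w0 subrr normr0 add0r => h.
have -> : e * `|y - x0| = E' * (e' * E * `|y - x0|).
  by rewrite /e'; field; rewrite !gt_eqF.
apply: h => //.
- by apply: mulr_ge0 => //; apply: mulr_ge0; exact: ltW.
- move=> s ss; have [_ d1] := Hu s ss; have [_ d2] := Hc s ss; have d3 := Dw s ss.
  by apply: is_deriveB; apply: is_deriveB.
- move=> s ss.
  have us : `|u s - c s| < r.
    apply: le_lt_trans (bu s ss) _; by rewrite mulrC -ltr_pdivlMr.
  have Kcs : (c @` `[0, 1]) (c s) by exists s => //=; rewrite in_itv/=.
  have cc : `|c s - c s| < r by rewrite subrr normr0.
  have [_ _ h] := Hr (c s) Kcs (c s) (u s) cc us.
  have -> : xi (u s) - xi (c s) - 'd xi (c s) (wy s) =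
    (xi (u s) - xi (c s) - 'd xi (c s) (u s - c s)) + 'd xi (c s) (u s - c s - wy s).
    by rewrite [X in _ = _ + X]linearB addrA subrK.
  rewrite addrC (le_trans (ler_normD _ _))// lerD//.
    by apply: HL; exists s => //=; rewrite in_itv/=.
  apply: (le_trans h); rewrite -mulrA ler_wpM2l ?(ltW e'0)//.
  exact: bu.
Qed.

End flow.

(** * Smoothness of the flow through the tangent system *)

Section flow_smooth.
Context {R : realType}.

Lemma is_derive_row_mx n q (u : R -> 'rV[R]_n) (v : R -> 'rV[R]_q) (t : R) du dv :
  is_derive t (1:R) u du -> is_derive t (1:R) v dv ->
  is_derive t (1:R) (fun s => row_mx (u s) (v s)) (row_mx du dv).
Proof.
move=> /is_derive_coordP Du /is_derive_coordP Dv; apply/is_derive_coordP => i.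
rewrite !mxE; under eq_fun do rewrite mxE.
by case: (splitP i) => j _; [exact: Du|exact: Dv].
Qed.

Lemma class_C_row_mx (V : normedModType R) k (O : set V) n q (f : V -> 'rV[R]_n) (g : V -> 'rV[R]_q) :
  open O -> class_C k O f -> class_C k O g -> class_C k O (fun x => row_mx (f x) (g x)).
Proof.
move=> oO cf cg; apply: class_C_row => // i; under eq_fun do rewrite mxE.
by case: (splitP i) => j _; exact: class_C_coord.
Qed.

Lemma class_CZ (V : normedModType R) k (O : set V) n (a : V -> R) (f : V -> 'rV[R]_n) :
  open O -> class_C k O a -> class_C k O f -> class_C k O (fun x => a x *: f x).
Proof.
move=> oO ca cf; apply: class_C_row => // j.
apply: (@class_C_eq _ _ _ _ _ (fun x => a x * f x ord0 j)) => //.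
  by move=> x _; rewrite [RHS]mxE.
by apply: class_CM => //; exact: class_C_coord.
Qed.

Lemma class_C_lsubmx (V : normedModType R) k (O : set V) n q (f : V -> 'rV[R]_(n + q)) :
  open O -> class_C k O f -> class_C k O (fun x => lsubmx (f x)).
Proof.
by move=> oO cf; apply: class_C_row => // i; under eq_fun do rewrite mxE; exact: class_C_coord.
Qed.

Lemma class_C_rsubmx (V : normedModType R) k (O : set V) n q (f : V -> 'rV[R]_(n + q)) :
  open O -> class_C k O f -> class_C k O (fun x => rsubmx (f x)).
Proof.
by move=> oO cf; apply: class_C_row => // i; under eq_fun do rewrite mxE; exact: class_C_coord.
Qed.

Lemma open_lsubmx n q (U : set 'rV[R]_n) : open U ->
  open [set z : 'rV[R]_(n + q) | U (lsubmx z)].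
Proof.
move=> oU; apply: (@open_comp _ _ (lsubmx : 'rV[R]_(n + q) -> _)) => //.
by move=> z _; exact: continuous_lsubmx.
Qed.

(** Joint regularity in point and direction, which the tangent system requires. The direction enters
    linearly through its coordinates, so the fixed-direction derivatives supplied by [class_C]
    suffice. *)
Lemma class_C_derive_pair k n q (U : set 'rV[R]_n) (f : 'rV[R]_n -> 'rV[R]_q) :
  open U -> class_C k.+1 U f ->
  class_C k [set z : 'rV[R]_(n + n) | U (lsubmx z)]
    (fun z => 'D_(rsubmx z) f (lsubmx z)).
Proof.
move=> oU [df Df]; have oU' := @open_lsubmx n n U oU.
apply: (@class_C_eq _ _ _ _ _
  (fun z => \sum_(i < n) rsubmx z ord0 i *: 'D_('e_i) f (lsubmx z))) => //.
  move=> z /= Uz; rewrite deriveE; last exact: df.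
  rewrite [in RHS](row_sum_delta (rsubmx z)) linear_sum; apply: eq_bigr => i _.
  by rewrite linearZ/= deriveE//; exact: df.
apply: class_C_sum => // i _.
apply: class_CZ => //.
  by apply: class_C_coord => //; apply: class_C_rsubmx => //; exact: class_C_id.
apply: (@class_C_comp_row _ _ _ _ _ _ U lsubmx ('D_('e_i) f)) => //.
  by apply: class_C_lsubmx => //; exact: class_C_id.
exact: Df.
Qed.

(* Induction on k: the derivative of the flow is the flow of the tangent system
   (x, v)' = (xi x, 'd xi x v), which is a system of the same kind in dimension 2n. *)
Theorem class_C_flow1 k n (U : set 'rV[R]_n) (xi : 'rV[R]_n -> 'rV[R]_n) :
  open U -> (forall j, class_C j U xi) ->
  class_C k (flow_domain xi U) (flow1 xi U).
Proof.
elim: k n U xi => [|k ih] n U xi oU Cxi.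
  move=> x [c sc]; apply: differentiable_continuous.
  by have [] := flow1_diff oU (Cxi 1%N) sc.
split=> [x [c sc]|v]; first by have [] := flow1_diff oU (Cxi 1%N) sc.
pose U' := [set z : 'rV[R]_(n + n) | U (lsubmx z)].
pose xi' (z : 'rV[R]_(n + n)) := row_mx (xi (lsubmx z)) ('D_(rsubmx z) xi (lsubmx z)).
have oU' : open U' by exact: open_lsubmx.
have Cxi' j : class_C j U' xi'.
  apply: class_C_row_mx => //; last exact: class_C_derive_pair.
  apply: (@class_C_comp_row _ _ _ _ _ _ U) => //.
  by apply: class_C_lsubmx => //; exact: class_C_id.
have oO : open (flow_domain xi U) by exact: open_flow_domain (Cxi 1%N).
have oO' : open (flow_domain xi' U') by exact: open_flow_domain (Cxi' 1%N).
have key x : flow_domain xi U x -> flow_domain xi' U' (row_mx x v) /\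
    rsubmx (flow1 xi' U' (row_mx x v)) = 'D_v (flow1 xi U) x.
  (* The pair (c, w) solves the tangent system started at (x, v), and w at time 1 is the derivative
     of the flow in direction v. *)
  move=> [c sc]; have [w [w0 Dw]] := variational_solution oU (Cxi 1%N) v sc.
  have [dphi Ephi] := flow1_diff oU (Cxi 1%N) sc.
  have sc' : solution xi' U' (row_mx x v) (fun s => row_mx (c s) (w s)) 1.
    have [c0 Hc] := sc; split; first by rewrite c0 w0.
    move=> t tt; have [Ut Dc] := Hc t tt; split; first by rewrite /U'/= row_mxKl.
    rewrite /xi' row_mxKl row_mxKr deriveE; last by have [df _] := Cxi 1%N; exact: df.
    by apply: is_derive_row_mx => //; exact: Dw.
  split; first by eexists; exact: sc'.
  rewrite (flow1E oU' (Cxi' 1%N) sc') row_mxKr deriveE//.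
  by rewrite -w0 (Ephi w).
apply: (@class_C_eq _ _ _ _ _ (fun x => rsubmx (flow1 xi' U' (row_mx x v)))) => //.
  by move=> x /key[].
apply: class_C_rsubmx => //.
apply: (@class_C_comp_row _ _ _ _ _ _ (flow_domain xi' U') (fun x => row_mx x v)) => //.
- by move=> x /key[].
- by apply: class_C_row_mx => //; [exact: class_C_id|exact: class_C_cst].
- exact: ih.
Qed.

End flow_smooth.

(** * Continuation of solutions under a priori bounds *)

Section glue.
Context {R : realType}.

(** Both pieces share value and velocity at tau, so a single linear map approximates the glued curve
    from either side. *)
Lemma is_derive_glue (V : normedModType R) (c d : R -> V) (tau : R) v :
  c tau = d tau -> is_derive tau (1:R) c v -> is_derive tau (1:R) d v ->
  is_derive tau (1:R) (fun t => if t <= tau then c t else d t) v.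
Proof.
move=> cd Dc Dd.
have diffE (f : R -> V) : is_derive tau (1:R) f v ->
    differentiable f tau /\ forall h : R, 'd f tau h = h *: v.
  move=> [df ef]; have df' : differentiable f tau by apply/derivable1_diffP.
  split=> // h; rewrite -[X in 'd f tau X]mulr1 -[X in 'd f tau X]/(h *: (1:R)).
  by rewrite linearZ/= -deriveE// ef.
have [dc Ec] := diffE c Dc; have [dd Ed] := diffE d Dd.
set e := (fun _ => _).
have H eps : 0 < eps -> \forall y \near tau,
    `|e y - e tau - 'd c tau (y - tau)| <= eps * `|y - tau|.
  move=> eps0; apply: filterS (filterI (diff_eps dc eps0) (diff_eps dd eps0)) => y [h1 h2].
  rewrite Ec in h1 *; rewrite Ed -cd in h2.
  have -> : e tau = c tau by rewrite /e lexx.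
  by rewrite /e; case: ifP.
have [de Ee] := eps_diff (diff_continuous dc) H.
apply: DeriveDef; first exact/derivable1_diffP.
by rewrite (deriveE _ de) [LHS](congr1 (fun h : R -> V => h 1) Ee) Ec scale1r.
Qed.

End glue.

Section existence.
Context {R : realType} {n : nat}.
Variables (xi : 'rV[R]_n -> 'rV[R]_n) (U : set 'rV[R]_n).
Hypothesis oU : open U.
Hypothesis Cxi : class_C 1 U xi.

(** The length h is the same for all starting points in K; this uniformity lets finitely many steps
    reach time 1. *)
Lemma local_solution (K : set 'rV[R]_n) : compact K -> K `<=` U ->
  exists2 h : R, 0 < h < 1 & forall a, K a -> exists2 c : R -> 'rV[R]_n, c 0 = a &
    forall t : R, 0 <= t <= h -> is_derive t (1:R) c (xi (c t)) /\ U (c t).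
Proof using oU Cxi.
move=> cK KU; have [r [L [r0 L0 Hr]]] := compact_lipschitz oU Cxi cK KU.
have [df _] := Cxi.
have : compact (xi @` K).
  apply: continuous_compact cK; apply/continuous_in_subspaceT => z; rewrite inE => /KU Uz.
  exact/differentiable_continuous/df.
move=> /compact_bounded[M0 [_ HM0]].
have [M1 M10 HM1] : exists2 M, 0 < M & forall z, K z -> `|xi z| <= M.
  exists (Num.max M0 0 + 1); first by rewrite ltr_wpDl// le_max lexx orbT.
  by move=> z Kz; apply: HM0; [rewrite ltr_pwDr// le_max lexx|exists z].
pose M := L * r + M1.
have M_0 : 0 < M by rewrite addr_gt0// mulr_gt0.
have r2 : 0 < r / 2 by rewrite divr_gt0.
have r2r : r / 2 < r by rewrite ltr_pdivrMr// ltr_pMr// ltr1n.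
(* M bounds the clamped field, so up to time (r / 2) / M the curve stays where the clamp is the
   identity; the cap 1/2 keeps the times inside the interval of [picard]. *)
pose h := Num.min (1/2) (r / 2 / M).
have h0 : 0 < h by rewrite lt_min !divr_gt0.
have h1 : h <= 1 / 2 by rewrite ge_min lexx.
have hM : M * h <= r / 2 by rewrite mulrC -ler_pdivlMr// ge_min lexx orbT.
exists h; first by rewrite h0/=; lra.
move=> a Ka.
pose g x := a + vclamp (r / 2) (x - a).
have gt x : `|g x - a| < r.
  by rewrite /g addrC addKr (le_lt_trans (vclamp_le _ (ltW r2))).
pose f (t : R) x := xi (g x).
have lip t x y : `|f t x - f t y| <= L * `|x - y|.
  have [_ _ hh] := Hr _ Ka _ _ (gt y) (gt x).
  apply: (le_trans hh); rewrite ler_pM2l// /g opprD addrACA subrr add0r.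
  by apply: (le_trans (vclamp_lip _ _ _)); rewrite opprB addrA subrK.
have cf x : continuous (f ^~ x) by move=> t; exact: cvg_cst.
have [c [c0 _ Dc]] := picard L0 lip cf a.
have aa : `|a - a| < r by rewrite subrr normr0.
have fM x : `|xi (g x)| <= M.
  have [_ _ hh] := Hr _ Ka _ _ aa (gt x).
  rewrite -[xi (g x)](subrK (xi a)) (le_trans (ler_normD _ _))// lerD ?HM1//.
  by apply: (le_trans hh); rewrite ler_pM2l// ltW.
have ca t : 0 <= t <= h -> `|c t - a| <= r / 2.
  move=> /andP[t0 th]; rewrite -c0.
  apply: (@mean_value_ineq R R n c 0 t) => s /andP[s0 s1].
  rewrite subr0 add0r.
  have st : 0 <= s * t <= h.
    by rewrite mulr_ge0//= (le_trans _ th)// ler_piMl.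
  have [|dc ec] := Dc (s * t); first by move: st => /andP[? ?]; apply/andP; split; lra.
  have dc' : differentiable c (s *: t) by apply/derivable1_diffP.
  split; first exact: dc'.
  rewrite -[X in 'd c _ X]mulr1 -[X in 'd c _ X]/(t *: (1:R)) linearZ/= -deriveE//.
  rewrite ec normrZ (ger0_norm t0) mulrC; apply: le_trans hM.
  by apply: ler_pM => //; exact: fM.
exists c => // t th.
have cat := ca t th.
have fc : f t (c t) = xi (c t) by rewrite /f /g vclamp_id// addrC subrK.
split; last by have [] := Hr _ Ka _ _ (le_lt_trans cat r2r) (le_lt_trans cat r2r).
by rewrite -fc; apply: Dc; move: th => /andP[? ?]; apply/andP; split; lra.
Qed.

(** Every partial solution ends in K, hence can be prolonged by the uniform step h; about 1 / h
    prolongations reach time 1. *)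
Lemma apriori_solution x (K : set 'rV[R]_n) : compact K -> K `<=` U -> U x ->
  (forall tau c, 0 <= tau <= 1 -> solution xi U x c tau -> K (c tau)) ->
  flow_domain xi U x.
Proof using oU Cxi.
move=> cK KU Ux H.
have [h /andP[h0 h1] Hloc] := local_solution cK KU.
have step tau : 0 <= tau <= 1 -> (exists c, solution xi U x c tau) ->
    exists c, solution xi U x c (Num.min 1 (tau + h)).
  move=> tau01 [c sc]; have Kc := H _ _ tau01 sc.
  have [d d0 Hd] := Hloc _ Kc.
  have [c0 Hc] := sc; have /andP[tau0 tau1] := tau01.
  pose dd t := d (t - tau).
  have Ddd (t : R) : tau <= t <= tau + h -> is_derive t (1:R) dd (xi (dd t)) /\ U (dd t).
    move=> /andP[t1 t2]; have [|D UD] := Hd (t - tau).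
      by apply/andP; split; lra.
    split=> //.
    have Ds : is_derive t (1:R) (fun t : R => t - tau) 1.
      by have := is_deriveB (is_derive_id t 1) (is_derive_cst tau t (1:R)); rewrite subr0.
    have dD : differentiable d (t - tau) by have [] := D; move/derivable1_diffP.
    have := is_derive_comp_diff Ds dD.
    by rewrite -deriveE//; case: D => _ ->.
  exists (fun t => if t <= tau then c t else dd t); split; first by rewrite tau0.
  move=> t /andP[t0]; rewrite le_min => /andP[t1 th].
  have [lt|gt|eq] := ltgtP t tau.
  - have [|Ut D] := Hc t; first by rewrite t0 ltW.
    split=> //; apply: near_eq_is_derive D.
    by near=> s; rewrite ifT// ltW//; near: s; exact: lt_nbhsl.
  - have [|D Ud] := Ddd t; first by rewrite (ltW gt).
    split=> //; apply: near_eq_is_derive D.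
    by near=> s; rewrite leNgt ifN// negbK; near: s; exact: lt_nbhsr.
  - rewrite eq; have [|Ut D] := Hc tau; first by rewrite tau0 lexx.
    split=> //; apply: is_derive_glue => //; first by rewrite /dd subrr d0.
    have [|D' _] := Ddd tau; first by rewrite lexx lerDl ltW.
    by move: D'; rewrite /dd subrr d0.
have all k : exists c, solution xi U x c (Num.min 1 (k%:R * h)).
  elim: k => [|k [c sc]].
    (* Even on the degenerate interval [0, 0] a two-sided derivative at 0 is demanded, so a short
       local solution is taken. *)
    rewrite mul0r min_r//; have [c c0 Hc] : exists2 c : R -> 'rV[R]_n, c 0 = x &
        forall t : R, 0 <= t <= 0 -> is_derive t (1:R) c (xi (c t)) /\ U (c t).
      have [|h' /andP[h'0 _] Hl] := @local_solution [set x] (@compact_set1 _ x); first by move=> _ ->.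
      have [c c0 Hc] := Hl x erefl; exists c => // t /andP[t1 t2]; apply: Hc.
      by rewrite t1 (le_trans t2)// ltW.
    by exists c; split=> // t /Hc[? ?].
  have m01 : 0 <= Num.min 1 (k%:R * h) <= 1.
    by rewrite le_min ler01 ge_min lexx andbT/=; apply: mulr_ge0 => //; exact: ltW.
  have [d sd] := step _ m01 (ex_intro _ c sc).
  exists d; suff -> : Num.min 1 (k.+1%:R * h) = Num.min 1 (Num.min 1 (k%:R * h) + h) by [].
  rewrite -natr1 mulrDl mul1r; have [h2|h2] := leP 1 (k%:R * h); last by [].
  by rewrite !min_l ?lerDl ?(ltW h0)// (le_trans h2)// lerDl ltW.
have [c sc] := all (Num.Def.archi_bound h^-1).
exists c; move: sc; rewrite min_l//.
rewrite -ler_pdivrMr// mul1r ltW// archi_boundP// invr_ge0 ltW//.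
Unshelve. all: by end_near. Qed.

End existence.

(** * Analytic maps are smooth *)

Section series_tools.
Context {R : realType}.

Lemma bounded_series_tail (b : nat -> R) (B : R) : (forall n, 0 <= b n) ->
  (forall N, \sum_(n < N) b n <= B) ->
  forall e, 0 < e -> exists N, forall M, (N <= M)%N -> \sum_(N <= n < M) b n <= e.
Proof.
move=> b0 bB e e0.
have nd : nondecreasing_seq (series b).
  by apply/nondecreasing_seqP => n; rewrite !seriesEnat/= big_nat_recr//= lerDl.
have cvb : cvgn (series b).
  apply: nondecreasing_is_cvgn => //; exists B => _ [n _ <-].
  by rewrite seriesEord; exact: bB.
have /cvgrPdist_le/(_ _ e0)[N _ HN] := cvb.
exists N => M NM.
have h := HN N (leqnn N).
have Ml := nondecreasing_cvgn_le nd cvb M.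
have := ler_norm (limn (series b) - series b N).
move=> /le_trans/(_ h); rewrite lerBlDr => h2.
have := le_trans Ml h2; rewrite !seriesEnat/= (@big_cat_nat _ _ _ N 0 M)//=.
by rewrite addrC lerD2r.
Qed.

Lemma sum_ord_sub (V : zmodType) (u : nat -> V) (N M : nat) : (N <= M)%N ->
  \sum_(n < M) u n - \sum_(n < N) u n = \sum_(N <= n < M) u n.
Proof.
move=> NM; rewrite -(big_mkord xpredT u) -(big_mkord xpredT u).
by rewrite (big_cat_nat (n := N))//= [LHS]addrC addKr.
Qed.

Lemma mean_value_scalar (V : normedModType R) (F : V -> R) (x y : V) (B : R) :
  (forall s : R, 0 <= s <= 1 -> differentiable F (x + s *: (y - x)) /\
     `|'d F (x + s *: (y - x)) (y - x)| <= B) ->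
  `|F y - F x| <= B.
Proof.
move=> H; have := @mean_value_ineq R V 1 (fun z => \row_(i < 1) F z) x y B.
have E (u : 'rV[R]_1) : `|u| = `|u ord0 ord0|.
  apply/eqP; rewrite eq_le rV_coord_le andbT rV_norm_le//.
  by apply/forallP => i; rewrite (ord1 i).
rewrite E !mxE; apply => s s01; have [dF bF] := H s s01.
pose L : R -> 'rV[R]_1 := fun a => a *: const_mx 1.
have linL : linear L by move=> a u v; rewrite /L scalerDl scalerA.
pose LM := GRing.isLinear.Build _ _ _ _ _ linL.
pose LL : {linear R -> 'rV[R]_1} := HB.pack L LM.
have cL : continuous LL by exact: scalel_continuous.
have -> : (fun z => \row_(i < 1) F z) = LL \o F.
  by apply/funext => z; apply/rowP => i; rewrite !mxE mulr1.
have dLL : differentiable LL (F (x + s *: (y - x))) by exact: linear_differentiable.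
split; first exact: differentiable_comp.
rewrite diff_comp//= (diff_lin _ cL) E.
by rewrite [LL _]/(L _) /L !mxE mulr1.
Qed.

Lemma le_limit_norm (V : normedModType R) (u : nat -> V) (l : V) (C : R) (N : nat) :
  u n @[n --> \oo] --> l -> (forall n, (N <= n)%N -> `|u n| <= C) -> `|l| <= C.
Proof.
move=> ul uC; apply/ler_addgt0Pl => e e0.
have /cvgrPdist_le/(_ _ e0)[M _ HM] := ul.
have := HM (maxn M N); rewrite /= leq_maxl => /(_ isT) h.
rewrite -(subrK (u (maxn M N)) l) (le_trans (ler_normD _ _))//.
by rewrite lerD// uC// leq_maxr.
Qed.

Lemma bounded_series_cvg (f b : nat -> R) (B : R) : (forall n, `|f n| <= b n) ->
  (forall N, \sum_(n < N) b n <= B) ->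
  exists l : R, \sum_(n < N) f n @[N --> \oo] --> l.
Proof.
move=> fb bB; apply/cvg_ex.
have b0 n : 0 <= b n by exact: le_trans (fb n).
have cvb : cvgn (series b).
  apply: nondecreasing_is_cvgn; last first.
    by exists B => _ [n _ <-]; rewrite seriesEord; exact: bB.
  by apply/nondecreasing_seqP => n; rewrite !seriesEnat/= big_nat_recr//= lerDl.
have -> : (fun N => \sum_(n < N) f n) = series f by apply/funext => N; rewrite seriesEord.
apply: normed_cvg; apply: (series_le_cvg _ _ _ cvb) => // n.
exact: normr_ge0.
Qed.

End series_tools.

(** * Termwise continuity and differentiation of dominated series *)

Section termwise.
Context {R : realType} {m : nat}.
Variables (r : R) (f : nat -> 'rV[R]_m -> R) (b : nat -> R) (B : R).
Let O := [set x : 'rV[R]_m | `|x| < r].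
Hypothesis bB : forall N, \sum_(n < N) b n <= B.

Lemma open_norm_ball : open O.
Proof.
rewrite openE => x Ox; rewrite /interior; apply/nbhs_ballP.
exists (r - `|x|); first by rewrite /= subr_gt0.
move=> y; rewrite -ball_normE /= ltrBrDl => h.
apply: le_lt_trans h; rewrite -[X in `|X| <= _](subrK x y) addrC.
by rewrite (le_trans (ler_normD _ _))// (distrC x).
Qed.

Lemma termwise_continuous F : (forall n x, O x -> {for x, continuous (f n)}) ->
  (forall n x, O x -> `|f n x| <= b n) ->
  (forall x, O x -> \sum_(n < N) f n x @[N --> \oo] --> (F x : R)) ->
  forall x, O x -> {for x, continuous F}.
Proof using bB.
move=> cf fb fF x Ox; apply/(@cvgrPdist_le _ _ _ (nbhs x) (nbhs_filter x)) => e e0.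
have b0 n : 0 <= b n by exact: le_trans (fb n x Ox).
have e3 : 0 < e / 3 by rewrite divr_gt0.
have [N HN] := bounded_series_tail b0 bB e3.
have tail y : O y -> `|F y - \sum_(n < N) f n y| <= e / 3.
  move=> Oy; apply: (@le_limit_norm _ _ (fun M => \sum_(n < M) f n y - \sum_(n < N) f n y) _ _ N).
    by apply: cvgB; [exact: fF|exact: cvg_cst].
  move=> M NM; apply: le_trans (HN M NM).
  rewrite (sum_ord_sub (f ^~ y))//.
  by rewrite (le_trans (ler_norm_sum _ _ _))//; apply: ler_sum => n _; exact: fb.
have cs : {for x, continuous (fun y => \sum_(n < N) f n y)}.
  elim: (N) => [|k ih].
    by under [X in {for x, continuous X}]eq_fun do rewrite big_ord0; exact: cst_continuous.
  under [X in {for x, continuous X}]eq_fun do rewrite big_ord_recr/=.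
  by apply: (@cvgD _ _ _ (nbhs x)); [exact: ih|exact: cf].
have /(@cvgrPdist_le _ _ _ (nbhs x) (nbhs_filter x))/(_ _ e3) := cs.
apply: filterS2 (open_nbhs_nbhs (conj open_norm_ball Ox)) => y Oy h.
have -> : F x - F y = (F x - \sum_(n < N) f n x) + (\sum_(n < N) f n x - \sum_(n < N) f n y)
   + (\sum_(n < N) f n y - F y) by rewrite !addrA !subrK.
rewrite (le_trans (ler_normD _ _))// [X in _ + X]distrC.
have h1 := ler_normD (F x - \sum_(n < N) f n x) (\sum_(n < N) f n x - \sum_(n < N) f n y).
have h2 := tail x Ox; have h3 := tail y Oy.
lra.
Qed.

Lemma termwise_differentiable F : (forall n x, O x -> differentiable (f n) x) ->
  (forall n x v, O x -> `|'D_v (f n) x| <= b n * `|v|) ->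
  (forall x, O x -> \sum_(n < N) f n x @[N --> \oo] --> (F x : R)) ->
  forall x, O x -> differentiable F x /\
    forall v, \sum_(n < N) 'D_v (f n) x @[N --> \oo] --> ('D_v F x : R).
Proof using bB.
move=> df fb fF x Ox.
have /choice[L HL] v : exists l : R, \sum_(n < N) 'D_v (f n) x @[N --> \oo] --> l.
  apply: (@bounded_series_cvg R (fun n => 'D_v (f n) x) (fun n => b n * `|v|) (B * `|v|)).
    by move=> n; exact: fb.
  by move=> N; rewrite -mulr_suml ler_wpM2r.
have linL : linear L.
  move=> a u v; apply: (cvg_unique _ (HL _)) => //.
  have -> : (fun N => \sum_(n < N) 'D_(a *: u + v) (f n) x) =
     (fun N => a *: (\sum_(n < N) 'D_u (f n) x) + \sum_(n < N) 'D_v (f n) x).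
    apply/funext => N; rewrite scaler_sumr -big_split/=; apply: eq_bigr => n _.
    by rewrite !deriveE ?linearP//; exact: df.
  by apply: cvgD; [exact: (cvgM (@cvg_cst _ a _ _ _) (HL u))|exact: HL].
pose LM := GRing.isLinear.Build _ _ _ _ _ linL.
pose LL : {linear 'rV[R]_m -> R} := HB.pack L LM.
have cLL : continuous LL by exact: linear_rV_continuous.
suff H e : 0 < e -> \forall y \near x, `|F y - F x - LL (y - x)| <= e * `|y - x|.
  have [d1 d2] := eps_diff cLL H; split=> // v.
  by rewrite (deriveE _ d1) [X in _ --> X](congr1 (fun h : 'rV[R]_m -> R => h v) d2); exact: HL.
move=> e0.
have e3 : 0 < e / 3 by rewrite divr_gt0.
(* A nonzero direction is used to read off 0 <= b n; in dimension 0 the space is a single point. *)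
have [m0|m0] := posnP m.
  near=> y; have -> : y = x by move: (y) (x); rewrite m0 => a c; apply/rowP => -[].
  by rewrite !subrr linear0 subr0 !normr0 mulr0.
have b0 n : 0 <= b n.
  have := fb n x 'e_(Ordinal m0) Ox; set w := 'e__ => h.
  have w0 : 0 < `|w|.
    rewrite normr_gt0; apply/eqP => /rowP/(_ (Ordinal m0)).
    by rewrite !mxE !eqxx/= => /eqP; rewrite oner_eq0.
  by rewrite -(pmulr_lge0 _ w0) (le_trans _ h).
have [N HN] := bounded_series_tail b0 bB e3.
have eN : 0 < e / 3 / N.+1%:R by rewrite divr_gt0.
have Hnear : \forall y \near x, forall n : 'I_N,
    `|f n y - f n x - 'd (f n) x (y - x)| <= e / 3 / N.+1%:R * `|y - x|.
  apply: (@filter_forall _ _ _ (nbhs x) (nbhs_filter x)) => n.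
  by have := diff_eps (df n x Ox) eN; exact.
apply: filterS2 (open_nbhs_nbhs (conj open_norm_ball Ox)) Hnear => y Oy hN.
pose u M := \sum_(n < M) f n y - \sum_(n < M) f n x - \sum_(n < M) 'D_(y - x) (f n) x.
have uE M : u M = \sum_(n < M) (f n y - f n x - 'D_(y - x) (f n) x).
  by rewrite /u -!sumrB.
apply: (@le_limit_norm _ _ u _ _ N).
  by apply: cvgB; [apply: cvgB; exact: fF|exact: HL].
move=> M NM; rewrite uE.
rewrite -(subrK (\sum_(n < N) (f n y - f n x - 'D_(y - x) (f n) x)) (\sum_(n < M) _)).
rewrite (sum_ord_sub (fun n => f n y - f n x - 'D_(y - x) (f n) x))//.
rewrite (le_trans (ler_normD _ _))//.
(* The tail costs e / 3 twice, once for the increments by the mean value inequality and once for the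
   derivatives; the finite head costs the last third. *)
have -> : e * `|y - x| = 2 * (e / 3) * `|y - x| + e / 3 * `|y - x| by field.
apply: lerD.
  rewrite (le_trans (ler_norm_sum _ _ _))//.
  apply: (@le_trans _ _ (\sum_(N <= n < M) b n * (2 * `|y - x|))); last first.
    by rewrite -mulr_suml mulrCA mulrA ler_wpM2r// ler_wpM2l// HN.
  apply: ler_sum => n _; rewrite (le_trans (ler_normB _ _))//.
  rewrite mulrCA (mulr_natl _ 2) mulr2n lerD//; last exact: fb.
  apply: mean_value_scalar => s /andP[s0 s1].
  have Oz : O (x + s *: (y - x)).
    rewrite /O/= (_ : _ + _ = (1 - s) *: x + s *: y); last first.
      by apply/rowP => i; rewrite !mxE; ring.
    apply: (le_lt_trans (ler_normD _ _)); rewrite !normrZ (ger0_norm s0) ger0_norm ?subr_ge0//.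
    have h1 : (1 - s) * `|x| <= (1 - s) * Num.max `|x| `|y|.
      by rewrite ler_wpM2l ?subr_ge0// le_max lexx.
    have h2 : s * `|y| <= s * Num.max `|x| `|y| by rewrite ler_wpM2l// le_max lexx orbT.
    apply: (le_lt_trans (lerD h1 h2)); rewrite -mulrDl subrK mul1r gt_max.
    by apply/andP; split; [exact: Ox|exact: Oy].
  by split; [exact: df|rewrite -deriveE; [exact: fb|exact: df]].
rewrite (le_trans (ler_norm_sum _ _ _))//.
apply: (@le_trans _ _ (\sum_(n < N) e / 3 / N.+1%:R * `|y - x|)).
  by apply: ler_sum => n _; rewrite deriveE; [exact: hN|exact: df].
rewrite sumr_const card_ord -(mulr_natl (_ * _)) mulrA ler_wpM2r//.
by rewrite mulrCA ler_piMr ?(ltW e3)// ler_pdivrMr// mul1r ler_nat.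
Unshelve. all: by end_near. Qed.

End termwise.

(** * Power series in several variables *)

Section monomials.
Context {R : realType} {m : nat}.
Implicit Types (e : 'I_m -> nat) (x v : 'rV[R]_m).

Definition monomial e x : R := \prod_(i < m) x ord0 i ^+ e i.
(** At e i = 0 the truncated predecessor leaves e unchanged; this is harmless, since the monomial
    then comes with the factor (e i)%:R = 0. *)
Definition edec e (i : 'I_m) : 'I_m -> nat := fun j => if j == i then (e i).-1 else e j.
Definition edeg e : nat := \sum_(i < m) e i.

Lemma monomial_bound e x (rho : R) : `|x| <= rho -> `|monomial e x| <= rho ^+ edeg e.
Proof.
move=> xr; rewrite /monomial /edeg normr_prod.
have -> : rho ^+ (\sum_(i < m) e i) = \prod_(i < m) rho ^+ e i.
  by rewrite -expr_sum.
apply: ler_prod => i _; rewrite normr_ge0 normrX/=.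
have r0 : 0 <= rho by exact: le_trans xr.
by apply: lerXn2r; rewrite ?nnegrE// (le_trans (rV_coord_le x i)).
Qed.

Lemma derive_prod (V : normedModType R) (I : eqType) (s : seq I) (f : I -> V -> R) (y v : V) :
  uniq s -> (forall i, differentiable (f i) y) ->
  differentiable (fun z => \prod_(i <- s) f i z) y /\
  'D_v (fun z => \prod_(i <- s) f i z) y =
    \sum_(i <- s) 'D_v (f i) y * \prod_(j <- s | j != i) f j y.
Proof.
move=> + df; elim: s => [_|i s ih /=/andP[is_ us]].
  under eq_fun do rewrite big_nil.
  by split; [exact: differentiable_cst|rewrite big_nil derive_cst].
have [dp Ep] := ih us.
under eq_fun do rewrite big_cons.
split; first exact: differentiableM.
rewrite (@deriveM _ _ (f i)); [|exact: diff_derivable..].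
rewrite Ep big_cons [RHS]addrC big_cons eqxx/= scaler_sumr; congr (_ + _).
  apply: eq_big_seq => j js.
  rewrite big_cons ifT; last by apply/negP => /eqP ij; rewrite ij js in is_.
  by rewrite /GRing.scale/= mulrCA.
rewrite /GRing.scale/= mulrC; congr (_ * _).
rewrite [LHS]big_seq [RHS]big_seq_cond; apply: eq_bigl => j.
by case: (boolP (j \in s)) => //= js; apply/esym/negP => /eqP ji; rewrite -ji js in is_.
Qed.

Lemma differentiable_exprn (V : normedModType R) (g : V -> R) n (y v : V) :
  differentiable g y -> differentiable (fun z => g z ^+ n) y /\
  'D_v (fun z => g z ^+ n) y = n%:R * g y ^+ n.-1 * 'D_v g y.
Proof.
move=> dg; have -> : (fun z => g z ^+ n) = g ^+ n by apply/funext => z; rewrite exprfctE.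
split; first by case: n => [|n]; [exact: differentiable_cst|exact: differentiableX].
by rewrite deriveX//; exact: diff_derivable.
Qed.

Lemma derive_monomial e x v : differentiable (monomial e) x /\
  'D_v (monomial e) x = \sum_(i < m) v ord0 i * (e i)%:R * monomial (edec e i) x.
Proof.
pose f (i : 'I_m) (y : 'rV[R]_m) : R := y ord0 i ^+ e i.
have dc (i : 'I_m) : differentiable (fun y : 'rV[R]_m => y ord0 i) x.
  exact: differentiable_coord.
have df i : differentiable (f i) x by have [] := differentiable_exprn (e i) v (dc i).
have Df i : 'D_v (f i) x = v ord0 i * (e i)%:R * x ord0 i ^+ (e i).-1.
  have [_ ->] := differentiable_exprn (e i) v (dc i).
  have -> : 'D_v (fun y : 'rV[R]_m => y ord0 i) x = v ord0 i.
    have := @derive_mx R 'rV[R]_m 1 m id x v (@derivable_id _ _ x v).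
    by rewrite derive_id => /rowP/(_ i); rewrite mxE.
  by rewrite mulrC mulrA.
have [dm Em] := @derive_prod _ _ _ f x v (index_enum_uniq 'I_m) df.
split; first exact: dm.
rewrite [LHS]Em; apply: eq_bigr => i _; rewrite Df -[LHS]mulrA; congr (_ * _).
rewrite [RHS]/monomial [RHS](bigD1 i)//= /edec eqxx; congr (_ * _).
by apply: eq_bigr => j /negbTE ->.
Qed.

Lemma edeg_edec e i : (0 < e i)%N -> edeg e = (edeg (edec e i)).+1.
Proof.
move=> ei; rewrite /edeg (bigD1 i)//= [in RHS](bigD1 i)//= /edec eqxx.
rewrite -addSn prednK//; congr (_ + _)%N.
by apply: eq_bigr => j /negbTE ->.
Qed.

(** A single term of the binomial expansion. It pays for the factor n produced by differentiation
    with a slightly larger radius. *)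
Lemma exprn_deriv_bound (rho d : R) n : 0 <= rho -> 0 <= d ->
  (n%:R + 1) * rho ^+ n * d <= (rho + d) ^+ n.+1.
Proof.
move=> r0 d0; elim: n => [|n ih]; first by rewrite expr0 expr1 add0r !mul1r lerDr.
rewrite [leRHS]exprS [leRHS]mulrDl.
have h1 : rho * ((n%:R + 1) * rho ^+ n * d) <= rho * (rho + d) ^+ n.+1 by rewrite ler_wpM2l.
have h2 : d * rho ^+ n.+1 <= d * (rho + d) ^+ n.+1.
  by rewrite ler_wpM2l// ler_pXn2r// ?nnegrE ?addr_ge0// lerDl.
apply: le_trans (lerD h1 h2).
by rewrite -natr1 !(exprS rho) le_eqVlt; apply/orP; left; apply/eqP; ring.
Qed.

(** Bounded partial sums express absolute convergence on the closed polydiscs of radius rho < r.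
    Balls of the sup norm are polydiscs, so rho to the total degree bounds each monomial. *)
Definition radius_ge (r : R) (a : nat -> R) (e : nat -> 'I_m -> nat) : Prop :=
  forall rho, 0 < rho < r -> exists B, forall N, \sum_(n < N) `|a n| * rho ^+ edeg (e n) <= B.

Lemma radius_ge_deriv r (a : nat -> R) (e : nat -> 'I_m -> nat) i : radius_ge r a e ->
  radius_ge r (fun n => a n * (e n i)%:R) (fun n => edec (e n) i).
Proof.
move=> Q rho /andP[r0 rr].
(* The intermediate radius leaves a gap d, and the differentiated series is bounded by 1 / d times
   the original one at rho'. *)
pose rho' := (rho + r) / 2; pose d := rho' - rho.
have d0 : 0 < d by rewrite /d /rho'; lra.
have [|B HB] := Q rho'; first by apply/andP; split; rewrite /rho'; lra.
exists (d^-1 * B) => N; apply: le_trans (ler_wpM2l _ (HB N)); last by rewrite invr_ge0 ltW.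
rewrite mulr_sumr; apply: ler_sum => n _.
rewrite normrM [leRHS]mulrCA -[leLHS]mulrA ler_wpM2l// ger0_norm//.
case: (posnP (e n i)) => [->|ei].
  by rewrite mul0r mulr_ge0// ?invr_ge0 ?exprn_ge0// /rho' ?ltW//; lra.
rewrite [leRHS]mulrC ler_pdivlMr//.
have -> : rho' = rho + d by rewrite /d addrC subrK.
rewrite (edeg_edec ei); apply: le_trans (exprn_deriv_bound _ (ltW r0) (ltW d0)).
rewrite ler_wpM2r ?(ltW d0)// ler_wpM2r ?exprn_ge0 ?(ltW r0)// natr1 ler_nat -(edeg_edec ei).
by rewrite /edeg (bigD1 i)//= leq_addr.
Qed.

Lemma power_series_diff (J : finType) (a : J -> nat -> R)
  (e : J -> nat -> 'I_m -> nat) (r : R) (F : 'rV[R]_m -> R) :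
  (forall j, radius_ge r (a j) (e j)) ->
  (forall x, `|x| < r -> \sum_(n < N) (\sum_(j : J) a j n * monomial (e j n) x) @[N --> \oo] --> F x) ->
  forall x, `|x| < r -> [/\ {for x, continuous F}, differentiable F x &
    forall v, \sum_(n < N) (\sum_(ji : J * 'I_m)
       (v ord0 ji.2 * (a ji.1 n * (e ji.1 n ji.2)%:R)) * monomial (edec (e ji.1 n) ji.2) x)
      @[N --> \oo] --> 'D_v F x].
Proof.
move=> Q HF x xr.
pose rho := (`|x| + r) / 2; have x0 := normr_ge0 x.
have rr : 0 < rho < r by rewrite /rho; apply/andP; split; lra.
have xrho : `|x| < rho by rewrite /rho; lra.
pose f n y := \sum_(j : J) a j n * monomial (e j n) y.
have HF' y : `|y| < rho -> \sum_(n < N) f n y @[N --> \oo] --> F y.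
  by move=> yr; apply: HF; move: rr => /andP[_]; exact: lt_trans.
have dm n j y : differentiable (fun z => a j n * monomial (e j n) z) y.
  by apply: differentiableM; [exact: differentiable_cst|have [] := derive_monomial (e j n) y 0].
have fE n : f n = \sum_(j : J) (fun z => a j n * monomial (e j n) z).
  by apply/funext => z; rewrite fct_sumE.
have DfE n y v : differentiable (f n) y /\ 'D_v (f n) y = \sum_(ji : J * 'I_m)
       (v ord0 ji.2 * (a ji.1 n * (e ji.1 n ji.2)%:R)) * monomial (edec (e ji.1 n) ji.2) y.
  have D1 j : is_derive y v (fun z => a j n * monomial (e j n) z)
      (a j n * \sum_(i < m) v ord0 i * (e j n i)%:R * monomial (edec (e j n) i) y).
    have [dm' Em] := derive_monomial (e j n) y v.
    have D : is_derive y v (monomial (e j n)) ('D_v (monomial (e j n)) y).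
      by apply: derivableP; exact: diff_derivable.
    by have := is_deriveZ (a j n) D; rewrite Em.
  split.
    rewrite fE; elim/big_ind : _ => [|g h dg dh|j _]; [exact: differentiable_cst| |exact: dm].
    exact: differentiableD.
  have D2 : is_derive y v (f n)
      (\sum_(j : J) a j n * \sum_(i < m) v ord0 i * (e j n i)%:R * monomial (edec (e j n) i) y).
    rewrite fE; elim/big_ind2 : _ => [|g g' h h' dg dh|j _]; last exact: D1.
      exact: is_derive_cst.
    exact: is_deriveD.
  have [_ ->] := D2.
  rewrite -(pair_bigA _ (fun j i => v ord0 i * (a j n * (e j n i)%:R) * monomial (edec (e j n) i) y))/=.
  apply: eq_bigr => j _; rewrite mulr_sumr; apply: eq_bigr => i _.
  by rewrite mulrA; congr (_ * _); rewrite mulrCA mulrA.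
pose b n := \sum_(j : J) `|a j n| * rho ^+ edeg (e j n).
have [B HB] : exists B, forall N, \sum_(n < N) b n <= B.
  have /choice[B HB] j := Q j rho rr.
  exists (\sum_j B j) => N; rewrite /b exchange_big/=.
  by apply: ler_sum => j _; exact: HB.
pose b' n := \sum_(ji : J * 'I_m)
     `|a ji.1 n * (e ji.1 n ji.2)%:R| * rho ^+ edeg (edec (e ji.1 n) ji.2).
have [B' HB'] : exists B, forall N, \sum_(n < N) b' n <= B.
  have /choice[B' HB'] ji := radius_ge_deriv ji.2 (Q ji.1) rr.
  exists (\sum_ji B' ji) => N; rewrite /b' exchange_big/=.
  by apply: ler_sum => ji _; exact: HB'.
have [dF HD] : differentiable F x /\ forall v, \sum_(n < N) 'D_v (f n) x @[N --> \oo] --> ('D_v F x : R).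
  apply: (@termwise_differentiable _ _ rho f b' B' HB' F) xrho => //.
    by move=> n y _; have [] := DfE n y 0.
  move=> n y v yr; have [_ ->] := DfE n y v.
  apply: le_trans (ler_norm_sum _ _ _) _; rewrite /b' mulr_suml; apply: ler_sum => ji _.
  rewrite normrM [in leLHS]normrM -mulrA [leRHS]mulrC; apply: ler_pM => //.
  - exact: rV_coord_le.
  - by rewrite ler_wpM2l// monomial_bound// ltW.
have cF : {for x, continuous F}.
  apply: (@termwise_continuous _ _ rho f b B HB F) xrho => //.
    by move=> n y _; apply: differentiable_continuous; have [] := DfE n y 0.
  move=> n y yr; apply: le_trans (ler_norm_sum _ _ _) _ => /=; apply: ler_sum => j _.
  by rewrite normrM ler_wpM2l// monomial_bound// ltW.
split=> // v; have := HD v.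
by under eq_fun do (under eq_bigr do rewrite (DfE _ _ _).2).
Qed.

(* Finite families of series, indexed by J, are closed under directional
   derivation (J becomes J * 'I_m), which a single enumerated series is not. *)
Theorem power_series_class_C k : forall (J : finType) (a : J -> nat -> R)
  (e : J -> nat -> 'I_m -> nat) (r : R), (forall j, radius_ge r (a j) (e j)) ->
  forall F : 'rV[R]_m -> R,
  (forall x, `|x| < r -> \sum_(n < N) (\sum_(j : J) a j n * monomial (e j n) x) @[N --> \oo] --> F x) ->
  class_C k [set x | `|x| < r] F.
Proof.
elim: k => [|k ih] J a e r Q F HF.
  by move=> x xr; have [] := power_series_diff Q HF xr.
split=> [x xr|v]; first by have [] := power_series_diff Q HF xr.
apply: (ih _ (fun (ji : J * 'I_m) n => v ord0 ji.2 * (a ji.1 n * (e ji.1 n ji.2)%:R))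
  (fun ji n => edec (e ji.1 n) ji.2)).
  move=> ji rho rr; have [B HB] := radius_ge_deriv ji.2 (Q ji.1) rr.
  exists (`|v ord0 ji.2| * B) => N; apply: le_trans (ler_wpM2l _ (HB N)) => //.
  by rewrite mulr_sumr; apply: ler_sum => n _; rewrite [in leLHS]normrM mulrA.
by move=> x xr; have [_ _] := power_series_diff Q HF xr; exact.
Qed.

End monomials.

(** * From unconditional sums over multi-indices to series *)

Section unconditional.
Import finmap.
Context {R : realType} {I : countType}.

Lemma partial_sum_seq (V : zmodType) (f : I -> V) (s : seq I) : uniq s ->
  summability.partial_sum f [fset i in s]%fset = \sum_(i <- s) f i.
Proof.
move=> us; rewrite /summability.partial_sum -(big_seq_fsetE _ _ xpredT f).
rewrite (perm_big s)//; apply: uniq_perm => [||i]; [exact: fset_uniq|exact: us|].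
by rewrite !inE.
Qed.

Lemma totally_seq (V : normedModType R) (f : I -> V) (l : V) :
  summability.partial_sum f @ summability.totally --> l ->
  forall eps, 0 < eps -> exists s0 : seq I, uniq s0 /\
    forall s, uniq s -> {subset s0 <= s} -> `|l - \sum_(i <- s) f i| <= eps.
Proof.
move=> fl eps e0.
have [A _ HA] := (@cvgrPdist_le _ _ _ _ (@summability.totally_filter I) _ _).1 fl eps e0.
exists (enum_fset A); split=> [|s us sA]; first exact: fset_uniq.
have := HA [fset i in s]%fset; rewrite /= partial_sum_seq//; apply.
by apply/fsubsetP => i iA; rewrite !inE; exact: sA.
Qed.

(* A sum over s differs from a sum over s and s0 by at most the absolute sum over
   s0; applied to the nonnegative and the negative terms of s. *)
Lemma totally_abs_bounded (f : I -> R) (l : R) :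
  summability.partial_sum f @ summability.totally --> l ->
  exists B, forall s : seq I, uniq s -> \sum_(i <- s) `|f i| <= B.
Proof.
move=> /totally_seq/(_ 1 ltr01)[s0 [us0 Hs0]].
pose K := `|l| + 1 + \sum_(i <- s0) `|f i|.
have HK s : uniq s -> `|\sum_(i <- s) f i| <= K.
  move=> us; pose s1 := [seq i <- s0 | i \notin s].
  have us1 : uniq (s ++ s1).
    rewrite cat_uniq us filter_uniq// andbT/=; apply/hasPn => i.
    by rewrite mem_filter => /andP[].
  have /(Hs0 _ us1) : {subset s0 <= s ++ s1}.
    by move=> i i0; rewrite mem_cat mem_filter i0 andbT orbN.
  rewrite big_cat/= => h.
  have -> : \sum_(i <- s) f i = l - (l - (\sum_(i <- s) f i + \sum_(i <- s1) f i)) - \sum_(i <- s1) f i.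
    by ring.
  rewrite (le_trans (ler_normB _ _))// lerD//.
    by rewrite (le_trans (ler_normB _ _))// lerD2l.
  rewrite (le_trans (ler_norm_sum _ _ _))// big_filter [leRHS](bigID (fun i => i \notin s))/=.
  by rewrite lerDl sumr_ge0.
exists (K + K) => s us.
rewrite (bigID (fun i => 0 <= f i))/=; apply: lerD.
  rewrite -big_filter; apply: le_trans (HK _ (filter_uniq (fun i => 0 <= f i) us)).
  apply: le_trans (ler_norm _); rewrite !big_filter le_eqVlt; apply/orP; left; apply/eqP.
  by apply: eq_bigr => i /ger0_norm.
rewrite -big_filter; apply: le_trans (HK _ (filter_uniq (fun i => ~~ (0 <= f i)) us)).
rewrite -[leRHS]normrN -sumrN; apply: le_trans (ler_norm _).
rewrite !big_filter le_eqVlt; apply/orP; left; apply/eqP.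
by apply: eq_bigr => i; rewrite -ltNge => /ltr0_norm.
Qed.

(** Codes that name no index are skipped here; in the associated series over nat they contribute
    zero terms. *)
Definition prefix_enum N : seq I := pmap (@pickle_inv I) (iota 0 N).

Lemma uniq_prefix_enum N : uniq (prefix_enum N).
Proof. by apply: (pmap_uniq (@pickle_invK I)); exact: iota_uniq. Qed.

Lemma prefix_enum_sum (V : zmodType) (f : I -> V) N :
  \sum_(i <- prefix_enum N) f i = \sum_(n < N) oapp f 0 (@pickle_inv I n).
Proof.
rewrite /prefix_enum big_pmap -(big_mkord xpredT (fun n => oapp f 0 (@pickle_inv I n))).
by rewrite /index_iota subn0.
Qed.

Lemma prefix_enum_cvg (V : normedModType R) (f : I -> V) (l : V) :
  summability.partial_sum f @ summability.totally --> l ->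
  \sum_(n < N) oapp f 0 (@pickle_inv I n) @[N --> \oo] --> l.
Proof.
move=> /totally_seq H; apply/cvgrPdist_le => eps /H[s0 [us0 Hs0]].
exists (\max_(i <- s0) (choice.pickle i).+1) => // N/= HN.
rewrite -prefix_enum_sum; apply: Hs0; first exact: uniq_prefix_enum.
move=> i i0; rewrite /prefix_enum mem_pmap; apply/mapP; exists (choice.pickle i).
  rewrite mem_iota/= add0n (leq_trans _ HN)//.
  by rewrite (@leq_bigmax_seq _ s0 xpredT (fun i => (choice.pickle i).+1)).
by rewrite pickleK_inv.
Qed.

End unconditional.

Section analytic.
Context {R : realType} {m p : nat}.

Lemma analytic_at_class_C (G : 'rV[R]_m -> 'rV[R]_p) : analytic_at G 0 ->
  exists2 r : R, 0 < r & forall k, class_C k [set x | `|x| < r] G.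
Proof.
move=> [c /nbhs_ballP[r0 /= r00 Hr0]].
have r20 : 0 < r0 / 2 by rewrite divr_gt0.
exists (r0 / 2) => // k; apply: class_C_row; first exact: open_norm_ball.
move=> j.
pose I := {ffun 'I_m -> nat}.
pose t (x : 'rV[R]_m) (al : I) : R := monomial (fun i => al i) x * c al ord0 j.
have Ht x : `|x| < r0 -> summability.partial_sum (t x) @ summability.totally --> G x ord0 j.
  move=> xr; have := Hr0 x; rewrite -ball_normE/= sub0r normrN => /(_ xr) h.
  have -> : summability.partial_sum (t x) = (fun v : 'rV[R]_p => v ord0 j) \o
    summability.partial_sum (fun al : I =>
      (\prod_(i < m) (x ord0 i - (0 : 'rV[R]_m) ord0 i) ^+ al i) *: c al).
    apply/funext => A; rewrite /= /summability.partial_sum summxE; apply: eq_bigr => al _.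
    by rewrite mxE /t /monomial; congr (_ * _); apply: eq_bigr => i _; rewrite mxE subr0.
  exact: (cvg_comp _ _ h (@coord_continuous _ _ _ _ _ (G x))).
pose a (_ : unit) n : R := oapp (fun al : I => c al ord0 j) 0 (@pickle_inv I n).
pose e (_ : unit) n : 'I_m -> nat := oapp (fun (al : I) i => al i) (fun=> 0%N) (@pickle_inv I n).
have tE x n : a tt n * monomial (e tt n) x = oapp (t x) 0 (@pickle_inv I n).
  by rewrite /a /e /t; case: pickle_inv => [al|]/=; rewrite ?mul0r// mulrC.
apply: (@power_series_class_C R m k unit a e).
  move=> [] rho /andP[rho0 rhor].
  (* At the point with all coordinates rho each monomial equals rho to its degree, so absolute
     summability there is precisely the bound wanted. *)
  have xr : `|const_mx rho : 'rV[R]_m| < r0.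
    apply: (@le_lt_trans _ _ rho); last by lra.
    by rewrite rV_norm_le; [apply/forallP => i; rewrite mxE gtr0_norm|exact: ltW].
  have [B HB] := totally_abs_bounded (Ht _ xr); exists B => N.
  apply: le_trans (HB _ (@uniq_prefix_enum I N)).
  rewrite prefix_enum_sum; apply: ler_sum => n _.
  rewrite /a /e; case: pickle_inv => [al|]/=; last by rewrite normr0 mul0r.
  have mE : monomial (fun i => al i) (const_mx rho) = rho ^+ edeg (fun i => al i).
    by rewrite /edeg expr_sum; apply: eq_bigr => i _; rewrite mxE.
  by rewrite /t mE normrM mulrC [X in _ <= X * _]ger0_norm// exprn_ge0// ltW.
move=> x xr; have xr' : `|x| < r0 by apply: lt_trans xr _; lra.
have := prefix_enum_cvg (Ht x xr'); apply: cvg_trans; apply: near_eq_cvg.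
near=> N; apply: eq_bigr => n _.
by rewrite (big_pred1 tt) ?tE//; case.
Unshelve. all: by end_near. Qed.

End analytic.

(** * Gram matrices and the kernel of the Jacobian of psi *)

Section dot.
Context {R : realType}.

Definition dotp n (a b : 'rV[R]_n) : R := \sum_(i < n) a ord0 i * b ord0 i.

Lemma dotpC n (a b : 'rV[R]_n) : dotp a b = dotp b a.
Proof. by apply: eq_bigr => i _; rewrite mulrC. Qed.

Lemma dotpDl n (a b c : 'rV[R]_n) : dotp (a + b) c = dotp a c + dotp b c.
Proof. by rewrite /dotp -big_split/=; apply: eq_bigr => i _; rewrite mxE mulrDl. Qed.

Lemma dotpZl n k (a b : 'rV[R]_n) : dotp (k *: a) b = k * dotp a b.
Proof. by rewrite /dotp mulr_sumr; apply: eq_bigr => i _; rewrite mxE mulrA. Qed.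

Lemma dotpDr n (a b c : 'rV[R]_n) : dotp a (b + c) = dotp a b + dotp a c.
Proof. by rewrite dotpC dotpDl !(dotpC a). Qed.

Lemma dotpZr n k (a b : 'rV[R]_n) : dotp a (k *: b) = k * dotp a b.
Proof. by rewrite dotpC dotpZl dotpC. Qed.

Lemma dotpNl n (a b : 'rV[R]_n) : dotp (- a) b = - dotp a b.
Proof. by rewrite -scaleN1r dotpZl mulN1r. Qed.

Lemma dotp0l n (a : 'rV[R]_n) : dotp 0 a = 0.
Proof. by rewrite -(scale0r 0) dotpZl mul0r. Qed.

Lemma dotpBl n (a b c : 'rV[R]_n) : dotp (a - b) c = dotp a c - dotp b c.
Proof. by rewrite dotpDl dotpNl. Qed.

Lemma sqnormE n (a : 'rV[R]_n) : sqnorm a = dotp a a.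
Proof. by apply: eq_bigr => i _; rewrite expr2. Qed.

Lemma dotp_row_mx n q (a c : 'rV[R]_n) (b d : 'rV[R]_q) :
  dotp (row_mx a b) (row_mx c d) = dotp a c + dotp b d.
Proof.
rewrite /dotp big_split_ord/=; congr (_ + _); apply: eq_bigr => i _.
  by rewrite !row_mxEl.
by rewrite !row_mxEr.
Qed.

Lemma mulmx_tr_dotp n (a b : 'rV[R]_n) : a *m b^T = (dotp a b)%:M.
Proof.
rewrite [LHS]mx11_scalar; congr (_%:M); rewrite mxE.
by apply: eq_bigr => i _; rewrite mxE.
Qed.

Lemma sqnorm_eq0 n (a : 'rV[R]_n) : (sqnorm a == 0) = (a == 0).
Proof.
apply/eqP/eqP => [a0|->]; last by rewrite sqnormE dotp0l.
have := norm_sqr_le_sqnorm a; rewrite a0 => h.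
by apply/eqP; rewrite -normr_eq0 -(sqrf_eq0 `|a|) eq_le h sqr_ge0.
Qed.

Lemma sqnorm_gt0 n (a : 'rV[R]_n) : (0 < sqnorm a) = (a != 0).
Proof. by rewrite lt_def sqnorm_ge0 andbT sqnorm_eq0. Qed.

Lemma sqnormZ n k (a : 'rV[R]_n) : sqnorm (k *: a) = k ^+ 2 * sqnorm a.
Proof. by rewrite !sqnormE dotpZl dotpZr mulrA expr2. Qed.

Lemma sqnormB n (a b : 'rV[R]_n) : sqnorm (a - b) = sqnorm a - 2 * dotp a b + sqnorm b.
Proof. by rewrite !sqnormE dotpBl !(dotpC _ (a - b)) !dotpBl (dotpC b a); ring. Qed.

Lemma sqnormD n (a b : 'rV[R]_n) : sqnorm (a + b) = sqnorm a + 2 * dotp a b + sqnorm b.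
Proof. by rewrite !sqnormE dotpDl !dotpDr (dotpC b a); ring. Qed.

End dot.

Section gram.
Context {R : realType}.

(** The associated quadratic form at b is |b J^T|^2 + be <b, g>^2, a sum of two nonnegative terms,
    so a kernel vector annihilates both. *)
Lemma gram_unitmx m n (J : 'M[R]_(m, n)) (g : 'rV[R]_n) (be : R) : 0 <= be ->
  (forall b : 'rV[R]_n, b *m J^T = 0 -> be * dotp b g = 0 -> b = 0) ->
  J^T *m J + be *: (g^T *m g) \in unitmx.
Proof.
move=> be0 H; rewrite -row_free_unit; apply: inj_row_free => b bM.
have E : sqnorm (b *m J^T) + be * dotp b g ^+ 2 = 0.
  have : b *m (J^T *m J + be *: (g^T *m g)) *m b^T = 0 by rewrite bM mul0mx.
  rewrite mulmxDr mulmxDl -scalemxAr -scalemxAl.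
  have -> : b *m (J^T *m J) *m b^T = (sqnorm (b *m J^T))%:M.
    have Jb : J *m b^T = (b *m J^T)^T by rewrite trmx_mul trmxK.
    by rewrite mulmxA -[LHS]mulmxA Jb mulmx_tr_dotp sqnormE.
  have -> : b *m (g^T *m g) *m b^T = (dotp b g ^+ 2)%:M.
    by rewrite mulmxA -[LHS]mulmxA !mulmx_tr_dotp -scalar_mxM (dotpC g).
  move=> /(congr1 (fun A : 'M[R]_1 => A ord0 ord0)).
  by rewrite [LHS]mxE mxE [in X in _ + X]mxE [X in _ + _ * X]mxE eqxx !mulr1n mxE.
have p2 : 0 <= be * dotp b g ^+ 2 by rewrite mulr_ge0// sqr_ge0.
have /eqP := E; rewrite paddr_eq0 ?sqnorm_ge0// => /andP[].
rewrite sqnorm_eq0 => /eqP h1 h2; apply: H => //.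
by move: h2; rewrite mulf_eq0 sqrf_eq0 => /orP[] /eqP ->; rewrite ?mul0r ?mulr0.
Qed.

(** Orthogonality supplies the linear independence of u and v, which together span a plane in the
    left kernel. *)
Lemma rank_orthogonal_kernel n m (B : 'M[R]_(n, m)) (u v : 'rV[R]_n) :
  u *m B = 0 -> v *m B = 0 -> dotp u v = 0 -> u != 0 -> v != 0 ->
  (\rank B + 2 <= n)%N.
Proof.
move=> uB vB uv u0 v0.
have KB : col_mx u v *m B = 0 by rewrite mul_col_mx uB vB col_mx0.
have rK : row_free (col_mx u v).
  apply: inj_row_free => w; rewrite -[w]hsubmxK mul_row_col.
  rewrite [lsubmx w]mx11_scalar [rsubmx w]mx11_scalar !mul_scalar_mx.
  set a := lsubmx w _ _; set b := rsubmx w _ _ => E.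
  have := congr1 (fun z : 'rV[R]_n => dotp z u) E.
  rewrite dotp0l dotpDl !dotpZl (dotpC v) uv mulr0 addr0 -sqnormE.
  move=> /eqP; rewrite mulf_eq0 sqnorm_eq0 (negbTE u0) orbF => /eqP ->.
  have := congr1 (fun z : 'rV[R]_n => dotp z v) E; rewrite dotp0l dotpDl !dotpZl uv mulr0 add0r -sqnormE.
  move=> /eqP; rewrite mulf_eq0 sqnorm_eq0 (negbTE v0) orbF => /eqP ->.
  by rewrite raddf0 row_mx0.
have := mulmx0_rank_max KB.
by move: rK; rewrite /row_free => /eqP ->; rewrite addnC.
Qed.

(** Cramer's formula: the entries of the inverse are cofactors, polynomial in the entries of A,
    divided by the determinant. *)
Lemma class_C_invmx (V : normedModType R) k (O : set V) n (A : V -> 'M[R]_n) :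
  open O -> (forall x, O x -> A x \in unitmx) ->
  (forall i j, class_C k O (fun x => A x i j)) ->
  forall i j, class_C k O (fun x => invmx (A x) i j).
Proof.
move=> oO uA cA i j.
have cdet q (D : V -> 'M[R]_q) : (forall i j, class_C k O (fun x => D x i j)) ->
    class_C k O (fun x => \det (D x)).
  move=> cD; rewrite /determinant; apply: class_C_sum => // s _.
  apply: class_CM => //; first exact: class_C_cst.
  by apply: class_C_prod => // l _; exact: cD.
apply: (@class_C_eq _ _ _ _ _ (fun x => (\det (A x))^-1 * cofactor (A x) j i)) => //.
  by move=> x Ox; rewrite /invmx uA// !mxE.
apply: class_CM => //.
  apply: class_CV => //; last exact: cdet.
  by move=> x Ox; have := uA x Ox; rewrite unitmxE unitfE.
rewrite /cofactor; apply: class_CM => //; first exact: class_C_cst.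
by apply: cdet => i' j'; under eq_fun do rewrite !mxE; exact: cA.
Qed.

End gram.

Section maps.
Context {R : realType}.

Lemma mulmx_jacobian m n (F : 'rV[R]_m -> 'rV[R]_n) x v : v *m 'J F x = 'd F x v.
Proof. by rewrite /jacobian mul_rV_lin1. Qed.

Lemma class_C_sqnorm (V : normedModType R) k (O : set V) n (f : V -> 'rV[R]_n) :
  open O -> class_C k O f -> class_C k O (fun x => sqnorm (f x)).
Proof.
by move=> oO cf; apply: class_C_sum => // i _; apply: class_CX => //; exact: class_C_coord.
Qed.

Lemma class_C_dotp (V : normedModType R) k (O : set V) n (f g : V -> 'rV[R]_n) :
  open O -> class_C k O f -> class_C k O g -> class_C k O (fun x => dotp (f x) (g x)).
Proof.
by move=> oO cf cg; apply: class_C_sum => // i _; apply: class_CM => //; exact: class_C_coord.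
Qed.

Lemma class_C_psi (m p k : nat) (O : set 'rV[R]_m) (G : 'rV[R]_m -> 'rV[R]_p) :
  open O -> (forall x, O x -> G x != 0) -> class_C k O G -> class_C k O (psi G).
Proof.
move=> oO G0 cG; apply: class_CZ => //; apply: class_CV => //.
  by move=> x Ox; rewrite gt_eqF// sqrtr_gt0 sqnorm_gt0 G0.
apply: class_C_sqrt => //; last exact: class_C_sqnorm.
by move=> x Ox; rewrite sqnorm_gt0 G0.
Qed.

Lemma class_C_scalar_rV (V : normedModType R) k (O : set V) (f : V -> R) :
  open O -> class_C k O f -> class_C k O (fun x => (f x)%:M : 'rV[R]_1).
Proof.
move=> oO cf; apply: class_C_row => // i; apply: (@class_C_eq _ _ _ _ _ f) => //.
by move=> x _; rewrite (ord1 i) mxE eqxx mulr1n.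
Qed.

Lemma class_C_with_sqnorm (m p k : nat) (O : set 'rV[R]_m) (G : 'rV[R]_m -> 'rV[R]_p) :
  open O -> class_C k O G -> class_C k O (with_sqnorm G).
Proof.
move=> oO cG; apply: class_C_row_mx => //.
by apply: class_C_scalar_rV => //; apply: class_C_sqnorm => //; exact: class_C_id.
Qed.

Lemma diff_with_sqnorm (m p : nat) (O : set 'rV[R]_m) (G : 'rV[R]_m -> 'rV[R]_p) x v :
  open O -> O x -> class_C 1 O G ->
  'd (with_sqnorm G) x v = row_mx ('d (fun y => (sqnorm y)%:M : 'rV[R]_1) x v) ('d G x v).
Proof.
move=> oO Ox cG; have [dH _] := class_C_with_sqnorm oO cG.
have dHx := dH x Ox.
rewrite -[LHS]hsubmxK; congr row_mx.
  have -> : (fun y => (sqnorm y)%:M : 'rV[R]_1) =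
      (@lsubmx R 1 1 p : {linear _ -> _}) \o (with_sqnorm G).
    by apply/funext => y; rewrite /= row_mxKl.
  rewrite diff_comp//; last by apply: linear_differentiable; exact: continuous_lsubmx.
  by rewrite diff_lin//; exact: continuous_lsubmx.
have {2}-> : G = (@rsubmx R 1 1 p : {linear _ -> _}) \o (with_sqnorm G).
  by apply/funext => y; rewrite /= row_mxKr.
rewrite diff_comp//; last by apply: linear_differentiable; exact: continuous_rsubmx.
by rewrite diff_lin//; exact: continuous_rsubmx.
Qed.

End maps.

Lemma derive_scale_rV (R : realType) (V : normedModType R) n (O : set V) (f : V -> R)
    (u : V -> 'rV[R]_n) x v : open O -> O x -> class_C 1 O f -> class_C 1 O u ->
  'D_v (fun y => f y *: u y) x = 'D_v f x *: u x + f x *: 'D_v u x.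
Proof.
move=> oO Ox cf cu.
have der (W : normedModType R) (h : V -> W) : class_C 1 O h -> derivable h x v.
  by move=> [d _]; exact/diff_derivable/d.
have dM i := deriveM (der _ _ cf) (der _ _ (class_C_coord i oO cu)).
rewrite (derive_mx (der _ _ (class_CZ oO cf cu))) (derive_mx (der _ _ cu)).
apply/rowP => i; rewrite !mxE.
have -> : (fun y => (f y *: u y) ord0 i) = f * (fun y => u y ord0 i).
  by apply/funext => y; rewrite mxE.
refine (etrans (dM i) _).
by rewrite /GRing.scale/= addrC; congr (_ + _); rewrite mulrC.
Qed.

(** * Rank of the Jacobian of (rho, psi) *)

Section psi_kernel.
Context {R : realType} {m p : nat}.
Variables (G : 'rV[R]_m -> 'rV[R]_p) (O : set 'rV[R]_m).
Hypotheses (oO : open O) (cG : forall k, class_C k O G) (G0 : forall x, O x -> G x != 0).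

Lemma sqnorm_psi x : O x -> sqnorm (psi G x) = 1.
Proof using G0.
move=> /G0 Gx; rewrite sqnormZ exprVn sqr_sqrtr ?sqnorm_ge0// mulVf//.
by rewrite sqnorm_eq0.
Qed.

(** Differentiate |psi|^2 = 1. *)
Lemma dotp_psi_deriv x v : O x -> dotp (psi G x) ('d (psi G) x v) = 0.
Proof using oO cG G0.
move=> Ox; have [dpsi _] := class_C_psi oO G0 (cG 1%N).
have dc i : is_derive x v (fun y => psi G y ord0 i) ('d (psi G) x v ord0 i).
  have [d _] := class_C_coord i oO (class_C_psi oO G0 (cG 1%N)).
  apply: DeriveDef; first exact/diff_derivable/d.
  have := @derive_mx R 'rV[R]_m 1 p (psi G) x v (diff_derivable (dpsi x Ox)).
  rewrite -deriveE ?dpsi//; last exact: dpsi.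
  by move=> ->; rewrite mxE.
have D : is_derive x v (fun y => sqnorm (psi G y))
    (\sum_(i < p) 2 * (psi G x ord0 i * 'd (psi G) x v ord0 i)).
  rewrite /sqnorm; have -> : (fun y => \sum_(i < p) psi G y ord0 i ^+ 2) =
     \sum_(i < p) (fun y => psi G y ord0 i ^+ 2) by apply/funext => y; rewrite fct_sumE.
  elim/big_ind2 : _ => [|g g' h h' dg dh|i _]; first exact: is_derive_cst.
    exact: is_deriveD.
  have := is_deriveX 1 (dc i); rewrite expr1 => h; apply: is_derive_eq.
  by rewrite /GRing.scale/= expr0; ring.
have D0 : 'D_v (fun y => sqnorm (psi G y)) x = 0.
  rewrite -(@derive_cst _ _ _ (1 : R) x v); apply: near_eq_derive.
  by apply: (near_open oO Ox) => y Oy; rewrite sqnorm_psi.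
move: D0; have [_ ->] := D; rewrite -mulr_sumr => /eqP.
by rewrite mulf_eq0 pnatr_eq0/= => /eqP.
Qed.

(** The product rule for G = |G| psi. The coefficient mu, the derivative of |G|, is left anonymous
    because it is paired only with covectors orthogonal to psi. *)
Lemma diff_normalised x v : O x ->
  exists mu : R, 'd G x v = mu *: psi G x + enorm (G x) *: 'd (psi G) x v.
Proof using oO cG G0.
move=> Ox; have [dpsi _] := class_C_psi oO G0 (cG 1%N).
have cN : class_C 1 O (fun y => enorm (G y)).
  by apply: class_C_sqrt => //; [move=> y Oy; rewrite sqnorm_gt0 G0|exact: class_C_sqnorm].
have [dN _] := cN.
have E : \near x, G x = enorm (G x) *: psi G x.
  apply: (near_open oO Ox) => y Oy; rewrite scalerA divff ?scale1r//.
  by rewrite gt_eqF// sqrtr_gt0 sqnorm_gt0 G0.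
have [dG _] := cG 1%N.
exists ('D_v (fun y => enorm (G y)) x).
have EG : 'd G x v = 'D_v G x by apply/esym/deriveE/dG.
have Ep : 'd (psi G) x v = 'D_v (psi G) x by apply/esym/deriveE/dpsi.
refine (etrans EG (etrans (@near_eq_derive _ _ _ _ _ _ _ E) _)).
suff key : 'D_v (fun y => enorm (G y) *: psi G y) x =
    'D_v (fun y => enorm (G y)) x *: psi G x + enorm (G x) *: 'D_v (psi G) x.
  refine (etrans key _); congr (_ + _ *: _); exact: esym Ep.
exact: (derive_scale_rV v oO Ox cN (class_C_psi oO G0 (cG 1%N))).
Qed.

(** The covector (0, psi) always annihilates the differential of (rho, psi). A covector b = (b0, b')
    that annihilates that of (rho, G) and is orthogonal to (0, G) yields a second one, (b0, |G| b'),
    orthogonal to the first; the rank is then at most 1 + p - 2. *)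
Lemma psi_rank_deficient x (b : 'rV[R]_(1 + p)) : O x ->
  b *m ('J (with_sqnorm G) x)^T = 0 -> dotp b (row_mx 0 (G x)) = 0 -> b != 0 ->
  (\rank ('J (with_sqnorm (psi G)) x) < p)%N.
Proof using oO cG G0.
move=> Ox; rewrite -[b]hsubmxK; set b0 := lsubmx b; set b' := rsubmx b.
move=> bJ; rewrite dotp_row_mx (dotpC b0) dotp0l add0r => bG bn0.
have Gn : 0 < enorm (G x) by rewrite sqrtr_gt0 sqnorm_gt0 G0.
have bpsi : dotp b' (psi G x) = 0 by rewrite dotpZr bG mulr0.
set JP := 'J (with_sqnorm (psi G)) x.
have kerP (H : 'rV[R]_m -> 'rV[R]_(1 + p)) (u : 'rV[R]_(1 + p)) :
    (u *m ('J H x)^T == 0) <-> forall v, dotp u ('d H x v) = 0.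
  have E v : dotp u ('d H x v) = dotp (u *m ('J H x)^T) v.
    rewrite -mulmx_jacobian; have := mulmx_tr_dotp u (v *m 'J H x).
    rewrite trmx_mul mulmxA mulmx_tr_dotp.
    by move=> /(congr1 (fun A : 'M[R]_1 => A ord0 ord0)); rewrite !mxE eqxx !mulr1n.
  split=> [/eqP u0 v|h]; first by rewrite E u0 dotp0l.
  by rewrite -sqnorm_eq0 sqnormE -E h.
have dH v := diff_with_sqnorm v oO Ox (cG 1%N).
have dP v := diff_with_sqnorm v oO Ox (class_C_psi oO G0 (cG 1%N)).
have k1 : (row_mx 0 (psi G x) : 'rV[R]_(1 + p)) *m JP^T = 0.
  by apply/eqP/kerP => v; rewrite dP dotp_row_mx dotp0l add0r dotp_psi_deriv.
have k2 : row_mx b0 (enorm (G x) *: b') *m JP^T = 0.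
  apply/eqP/kerP => v; rewrite dP dotp_row_mx dotpZl.
  have /eqP/kerP/(_ v) := bJ; rewrite dH dotp_row_mx.
  (* Pairing with b' removes the radial part mu psi, so b' sees only |G| times the differential of
     psi. *)
  have [mu E] := diff_normalised v Ox.
  have E2 : dotp b' ('d G x v) = enorm (G x) * dotp b' ('d (psi G) x v).
    refine (etrans (congr1 (dotp b') E) _).
    by rewrite dotpDr (dotpZr mu) bpsi mulr0 add0r dotpZr.
  by move=> h; apply: etrans h; congr (_ + _); exact: esym E2.
suff : (\rank JP + 2 <= 1 + p)%N by move: (\rank JP) => r; rewrite addn2 add1n ltnS.
rewrite -mxrank_tr; apply: (rank_orthogonal_kernel k1 k2).
- by rewrite dotp_row_mx dotp0l add0r dotpZr dotpC bpsi mulr0.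
- apply/eqP => /eqP; rewrite -sqnorm_eq0 sqnormE dotp_row_mx dotp0l add0r -sqnormE sqnorm_psi//.
  by rewrite oner_eq0.
- apply: contra bn0 => /eqP E.
  have := congr1 (fun M : 'rV[R]_(1 + p) => lsubmx M) E; rewrite /= row_mxKl raddf0 => ->.
  have := congr1 (fun M : 'rV[R]_(1 + p) => rsubmx M) E; rewrite /= row_mxKr raddf0 => /eqP.
  by rewrite scaler_eq0 gt_eqF//= => /eqP ->; rewrite row_mx0.
Qed.

End psi_kernel.

(** * The flow on the annulus *)

Section prelim.
Context {R : realType}.

Lemma zero_derive_cst (f : R -> R) (tau : R) : 0 <= tau ->
  (forall t : R, 0 <= t <= tau -> is_derive t (1:R) f 0) -> f tau = f 0.
Proof.
move=> tau0 Df.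
have cf : {within `[0, tau], continuous f}.
  apply/continuous_in_subspaceT => t; rewrite inE/= in_itv/= => /Df.
  exact: is_derive_continuous.
have cc : {within `[0, tau], continuous (fun=> 0 : R)}.
  by apply: continuous_subspaceT => t; exact: cst_continuous.
have := @le_derive_increment R f (fun=> 0) (fun=> 0) (fun=> 0) 0 tau tau0 _ _ cf cc.
rewrite subrr => h; apply/eqP; rewrite -subr_eq0 -normr_le0; apply: h.
- by move=> t /andP[a b]; apply: Df; rewrite !ltW.
- by move=> t _; rewrite normr0.
Qed.

Lemma is_derive_dotp n (u : R -> 'rV[R]_n) (y : 'rV[R]_n) (t : R) du :
  is_derive t (1:R) u du -> is_derive t (1:R) (fun s => dotp (u s) y) (dotp du y).
Proof.
move=> /is_derive_coordP D; rewrite /dotp.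
have -> : (fun s => \sum_(i < n) u s ord0 i * y ord0 i) =
   \sum_(i < n) (fun s => u s ord0 i * y ord0 i) by apply/funext => s; rewrite fct_sumE.
elim/big_ind2 : _ => [|g g' h h' dg dh|i _]; first exact: is_derive_cst.
  exact: is_deriveD.
have := is_deriveM (D i) (@is_derive_cst _ _ _ (y ord0 i) t (1:R)).
by move=> h; apply: is_derive_eq; rewrite scaler0 add0r /GRing.scale/= mulrC.
Qed.

Lemma sqnorm_continuous n : continuous (@sqnorm R n).
Proof.
move=> x; have := class_C_sqnorm (@openT _) (@class_C_id _ _ 0 (setT : set 'rV[R]_n)).
by apply.
Qed.

Lemma dotp_continuous n (y : 'rV[R]_n) : continuous (fun x => dotp x y).
Proof.
move=> x; have := class_C_dotp (@openT _) (@class_C_id _ _ 0 (setT : set 'rV[R]_n))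
  (@class_C_cst _ _ _ 0 _ y).
by apply.
Qed.

Lemma annulus_compact n (lo hi : R) : compact [set x : 'rV[R]_n | lo <= sqnorm x <= hi].
Proof.
apply: bounded_closed_compact.
  exists (hi + 1); split; first exact: num_real.
  move=> M hM x /= /andP[_ xhi].
  have h0 : 0 <= hi by exact: le_trans (sqnorm_ge0 x) xhi.
  have M1 : 1 <= M by rewrite (le_trans _ (ltW hM))// lerDr.
  have M0 : 0 <= M by exact: le_trans M1.
  rewrite -(@ler_pXn2r _ 2 isT) ?nnegrE//.
  apply: (le_trans (norm_sqr_le_sqnorm x)); apply: (le_trans xhi).
  have : M <= M ^+ 2 by rewrite expr2 ler_peMr.
  by apply: le_trans; rewrite (le_trans _ (ltW hM))// lerDl.
rewrite [X in closed X](_ : _ = (@sqnorm R n) @^-1` `[lo, hi]); last first.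
  by apply/seteqP; split=> x /=; rewrite in_itv.
by apply: preimage_closed; [move=> x _; exact: sqnorm_continuous|exact: itv_closed].
Qed.

Lemma compact_preimage n q (A : set 'rV[R]_n) (f : 'rV[R]_n -> 'rV[R]_q) (D : set 'rV[R]_q) :
  compact A -> (forall x, A x -> {for x, continuous f}) -> closed D ->
  compact (A `&` f @^-1` D).
Proof.
move=> cA cf cD; apply: (subclosed_compact _ cA); last by move=> x [].
move=> x xcl.
have Ax : A x.
  apply: (compact_closed (@norm_hausdorff _ _) cA).
  by apply: closure_subset xcl => y [].
split=> //=; apply: cD => N /(cf x Ax)/xcl[y [[_ Dy] Ny]].
by exists (f y).
Qed.

Lemma open_continuous_preimage (V W : normedModType R) (O : set V) (f : V -> W) (D : set W) :
  open O -> (forall x, O x -> {for x, continuous f}) -> open D ->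
  open [set x | O x /\ D (f x)].
Proof.
move=> oO cf oD; rewrite openE => x [Ox Dx].
have h := cf x Ox _ (open_nbhs_nbhs (conj oD Dx)).
by apply: filterS2 (open_nbhs_nbhs (conj oO Ox)) h => y.
Qed.

Lemma is_derive_rev (V : normedModType R) (c : R -> V) (t : R) v :
  is_derive (1 - t) (1:R) c v -> is_derive t (1:R) (fun u => c (1 - u)) (- v).
Proof.
move=> [dc ec]; have dc' : differentiable c (1 - t) by apply/derivable1_diffP.
have D : is_derive t (1:R) (fun u : R => 1 - u) (- 1).
  by have := is_deriveB (@is_derive_cst _ _ _ (1:R) t (1:R)) (@is_derive_id _ _ t (1:R)); rewrite sub0r.
have := is_derive_comp_diff D dc'.
have -> : 'd c (1 - t) (-1) = - v by rewrite linearN -ec -(deriveE _ dc').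
by [].
Qed.

End prelim.

(** * The lifting field *)

Section milnor_field.
Context {R : realType} {m p : nat}.
Variables (G : 'rV[R]_m -> 'rV[R]_p) (C : set 'rV[R]_p) (W : set 'rV[R]_m).
Variables (lo hi mu0 : R).
Hypothesis cG : forall k, class_C k W G.
Hypothesis annW : forall x, lo <= sqnorm x <= hi -> W x.
Hypothesis clC : closed C.
Hypothesis coneC : real_cone C.

(** Thickening the sphere gives an open set, where ordinary calculus is available; two spheres that
    are to be compared lie in the same one. *)
Definition annulus_off_cone : set 'rV[R]_m := [set x | lo < sqnorm x < hi /\ ~ C (G x)].
Local Notation U := annulus_off_cone.

Lemma annulus_off_cone_sub x : U x -> W x.
Proof. by move=> [/andP[a b] _]; apply: annW; rewrite !ltW. Qed.

Lemma annulus_off_cone_neq0 x : U x -> G x != 0.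
Proof. by move=> [_ nC]; apply/eqP => G0; apply: nC; rewrite G0; case: coneC. Qed.

Lemma open_annulus_off_cone : open U.
Proof.
rewrite openE => x Ux; have [/andP[a b] nC] := Ux.
have cGx : {for x, continuous G} by apply: (cG 0); exact: annulus_off_cone_sub.
have n1 : \forall y \near x, lo < sqnorm y < hi.
  have h1 := @cvgr_gt _ _ (nbhs x) (nbhs_filter x) _ _ (@sqnorm_continuous R m x) lo a.
  have h2 := @cvgr_lt _ _ (nbhs x) (nbhs_filter x) _ _ (@sqnorm_continuous R m x) hi b.
  by apply: filterS2 h1 h2 => y -> ->.
have n2 : \forall y \near x, (~` C) (G y).
  by apply: cGx; apply: open_nbhs_nbhs; split => //; exact: closed_openC.
by apply: filterS2 n1 n2.
Qed.
Let oU := open_annulus_off_cone.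

Lemma annulus_off_cone_class_C k : class_C k U G.
Proof. by apply: class_C_sub (cG k) => x /annulus_off_cone_sub. Qed.
Let cGU := annulus_off_cone_class_C.

Hypothesis rank_low : forall x, U x -> sqnorm (G x) <= mu0 ->
  ~ (\rank ('J (with_sqnorm G) x) < p.+1)%N.
Hypothesis rank_psi : forall x, U x -> ~ (\rank ('J (with_sqnorm (psi G)) x) < p)%N.

(* Switches the term g^T g on away from V_G only: near V_G, where (rho, G) is
   already a submersion, the field must move G without radial correction. *)
Definition field_weight x : R := bump (sqnorm (G x) - mu0).

Definition field_gram x : 'M[R]_(1 + p) :=
  ('J (with_sqnorm G) x)^T *m 'J (with_sqnorm G) x +
  field_weight x *: ((row_mx 0 (G x) : 'rV[R]_(1 + p))^T *m (row_mx 0 (G x) : 'rV[R]_(1 + p))).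

(** Where the weight vanishes this is the lift of b of least Euclidean norm through the differential
    of (rho, G), given by the pseudoinverse. *)
Definition milnor_field x (b : 'rV[R]_(1 + p)) : 'rV[R]_m :=
  b *m invmx (field_gram x) *m ('J (with_sqnorm G) x)^T.

Lemma field_gram_unit x : U x -> field_gram x \in unitmx.
Proof.
move=> Ux; apply: gram_unitmx; first exact: bump_ge0.
move=> b bJ bG; have [G_small|G_big] := leP (sqnorm (G x)) mu0.
  have rJ : row_free ('J (with_sqnorm G) x)^T.
    rewrite /row_free mxrank_tr eqn_leq rank_leq_col/= leqNgt.
    by apply/negP => h; apply: (rank_low Ux G_small).
  by apply/eqP; rewrite -(mulmx_free_eq0 b rJ) bJ.
have bw : 0 < field_weight x by rewrite bump_gt0// subr_gt0.
have {}bG : dotp b (row_mx 0 (G x)) = 0.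
  by move/eqP: bG; rewrite mulf_eq0 gt_eqF//= => /eqP.
apply/eqP/negPn/negP => b0; apply: (rank_psi Ux).
exact: (psi_rank_deficient oU cGU annulus_off_cone_neq0 Ux bJ bG b0).
Qed.

(** Writing J^T J as the Gram matrix minus its rank-one term turns b M^-1 J^T J into b - la g. As g
    has no rho-component, rho moves with speed exactly b_0 even where the correction acts. *)
Lemma milnor_field_diff x b : U x -> exists la : R,
  [/\ sqnorm (G x) <= mu0 -> la = 0,
      'd (fun y => (sqnorm y)%:M : 'rV[R]_1) x (milnor_field x b) = lsubmx b &
      'd G x (milnor_field x b) = rsubmx b - la *: G x].
Proof.
move=> Ux; pose g : 'rV[R]_(1 + p) := row_mx 0 (G x).
pose la := field_weight x * dotp (b *m invmx (field_gram x)) g.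
exists la.
have E : 'd (with_sqnorm G) x (milnor_field x b) = b - la *: g.
  rewrite -mulmx_jacobian /milnor_field -[LHS]mulmxA.
  have -> : ('J (with_sqnorm G) x)^T *m 'J (with_sqnorm G) x =
      field_gram x - field_weight x *: (g^T *m g) by rewrite /field_gram addrK.
  rewrite mulmxBr mulmxKV ?field_gram_unit//; congr (_ - _).
  by rewrite -scalemxAr mulmxA mulmx_tr_dotp mul_scalar_mx scalerA.
rewrite (diff_with_sqnorm _ oU Ux (cGU 1%N)) in E.
split.
- by move=> Gs; rewrite /la /field_weight bump_le0 ?mul0r// subr_le0.
- have := congr1 (fun M : 'rV[R]_(1 + p) => lsubmx M) E.
  rewrite row_mxKl => ->; rewrite linearB linearZ/= row_mxKl scaler0 subr0//.
- have := congr1 (fun M : 'rV[R]_(1 + p) => rsubmx M) E.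
  by rewrite row_mxKr => ->; rewrite linearB linearZ/= row_mxKr.
Qed.

Lemma class_C_milnor_field (V : normedModType R) k (O : set V) (X : V -> 'rV[R]_m)
    (B : V -> 'rV[R]_(1 + p)) :
  open O -> (forall z, O z -> U (X z)) -> class_C k O X -> class_C k O B ->
  class_C k O (fun z => milnor_field (X z) (B z)).
Proof.
move=> oO OU cX cB.
have cJ i j : class_C k O (fun z => 'J (with_sqnorm G) (X z) i j).
  apply: (@class_C_comp _ _ _ _ _ U X (fun x => 'J (with_sqnorm G) x i j)) => //.
  (* Entries of the Jacobian are directional derivatives, hence the extra class. *)
  have cH := class_C_with_sqnorm oU (cGU k.+1).
  apply: (@class_C_eq _ _ _ _ _ (fun x => 'D_(delta_mx 0 i) (with_sqnorm G) x ord0 j)) => //.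
    move=> x Ux; rewrite /jacobian mxE deriveE//; exact: cH.1.
  by apply: class_C_coord => //; exact: cH.2.
have cGX : class_C k O (fun z => G (X z)) by apply: (class_C_comp_row oU).
have cg j : class_C k O (fun z => (row_mx 0 (G (X z)) : 'rV[R]_(1 + p)) ord0 j).
  by apply: class_C_coord => //; apply: class_C_row_mx => //; exact: class_C_cst.
have cM i j : class_C k O (fun z => field_gram (X z) i j).
  apply: (@class_C_eq _ _ _ _ _ (fun z =>
    \sum_l 'J (with_sqnorm G) (X z) l i * 'J (with_sqnorm G) (X z) l j +
    field_weight (X z) * ((row_mx 0 (G (X z)) : 'rV[R]_(1 + p)) ord0 i *
      (row_mx 0 (G (X z)) : 'rV[R]_(1 + p)) ord0 j))) => //.
    move=> z _; rewrite /field_gram [RHS]mxE; congr (_ + _).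
      by rewrite [RHS]mxE; apply: eq_bigr => l _; rewrite [X in _ = X * _]mxE.
    by rewrite [RHS]mxE; congr (_ * _); rewrite [RHS]mxE big_ord1 [X in _ = X * _]mxE.
  apply: class_CD => //.
    by apply: class_C_sum => // l _; exact: class_CM.
  apply: class_CM => //; last exact: class_CM.
  apply: class_C_flat => //; apply: class_CB => //; last exact: class_C_cst.
  exact: class_C_sqnorm.
have cI := @class_C_invmx R V k O _ (fun z => field_gram (X z)) oO
  (fun z Oz => field_gram_unit (OU z Oz)) cM.
apply: class_C_row => // j.
apply: (@class_C_eq _ _ _ _ _ (fun z => \sum_i (\sum_l B z ord0 l * invmx (field_gram (X z)) l i) *
   'J (with_sqnorm G) (X z) j i)) => //.
  by move=> z _; rewrite [RHS]mxE; apply: eq_bigr => i _; rewrite [in RHS]mxE [in RHS]mxE.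
apply: class_C_sum => // i _; apply: class_CM => //.
apply: class_C_sum => // l _; apply: class_CM => //; exact: class_C_coord.
Qed.

(** * Trivialisation of psi near a unit vector y0 *)

Section lifting.
Variable y0 : 'rV[R]_p.
Hypothesis y01 : sqnorm y0 = 1.

Local Notation gg y := (dotp y y0).
(** Central projection to the affine hyperplane <q, y0> = 1. Admissible velocities are therefore
    orthogonal to y0, whence the condition dotp w y0 = 0 on directions. *)
Definition gnomonic (y : 'rV[R]_p) : 'rV[R]_p := (gg y)^-1 *: y.

Lemma dotp_gnomonic y : 0 < gg y -> gg (gnomonic y) = 1.
Proof. by move=> h; rewrite dotpZl mulVf// gt_eqF. Qed.

(** One notion for both motions: s = 0 stays on a sphere and moves psi, while w = 0 changes the
    sphere and fixes psi. *)
Definition lifted_path (s : R) (w : 'rV[R]_p) (c : R -> 'rV[R]_m) (tau : R) : Prop :=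
  forall t : R, 0 <= t <= tau -> [/\ U (c t), 0 < gg (G (c t)) &
    is_derive t (1:R) c (milnor_field (c t) (row_mx s%:M (gg (G (c t)) *: w)))].

Lemma lifted_path_sub s w c tau tau' : tau' <= tau -> lifted_path s w c tau ->
  lifted_path s w c tau'.
Proof. by move=> h H t /andP[t0 t1]; apply: H; rewrite t0 (le_trans t1). Qed.

Lemma lifted_path_derive s w c tau t : dotp w y0 = 0 -> lifted_path s w c tau ->
  0 <= t <= tau -> exists la : R, [/\ sqnorm (G (c t)) <= mu0 -> la = 0,
    is_derive t (1:R) (fun u => sqnorm (c u)) s,
    is_derive t (1:R) (fun u => G (c u)) (gg (G (c t)) *: w - la *: G (c t)) &
    is_derive t (1:R) (fun u => gg (G (c u))) (- la * gg (G (c t)))].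
Proof.
move=> w0 H /H[Uc gc Dc].
have [la [la0 E1 E2]] := milnor_field_diff (row_mx s%:M (gg (G (c t)) *: w)) Uc.
rewrite row_mxKl in E1; rewrite row_mxKr in E2.
have [dG _] := cGU 1%N.
have [dn _] : class_C 1 setT (fun y : 'rV[R]_m => (sqnorm y)%:M : 'rV[R]_1).
  apply: class_C_scalar_rV; first exact: openT.
  by apply: class_C_sqnorm; [exact: openT|exact: class_C_id].
have D1 := is_derive_comp_diff Dc (dn (c t) I).
have D2 := is_derive_comp_diff Dc (dG (c t) Uc).
have D2' : is_derive t (1:R) (fun u => G (c u)) (gg (G (c t)) *: w - la *: G (c t)).
  exact: (eq_ind _ (fun z => is_derive t (1:R) (G \o c) z) D2 _ E2).
exists la; split=> //.
  have D1' : is_derive t (1:R) (fun u => (sqnorm (c u))%:M : 'rV[R]_1) (s%:M).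
    exact: (eq_ind _ (fun z => is_derive t (1:R) (_ \o c) z) D1 _ E1).
  move/is_derive_coordP/(_ ord0) : D1'; rewrite mxE eqxx mulr1n.
  rewrite (_ : (fun _ => _) = (fun u => sqnorm (c u)))//.
  by apply/funext => u; rewrite mxE eqxx mulr1n.
have := is_derive_dotp y0 D2'.
by rewrite dotpBl !dotpZl w0 mulr0 sub0r mulNr.
Qed.

(** In the derivative of G / <G, y0> the unknown radial terms of numerator and denominator cancel
    and w remains; subtracting the expected linear motion leaves a function with zero derivative. *)
Lemma lifted_path_endpoint s w c tau : 0 <= tau -> dotp w y0 = 0 -> lifted_path s w c tau ->
  sqnorm (c tau) = sqnorm (c 0) + tau * s /\
  gnomonic (G (c tau)) = gnomonic (G (c 0)) + tau *: w.
Proof.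
move=> tau0 w0 H; split.
  suff : sqnorm (c tau) - tau * s = sqnorm (c 0) - 0 * s.
    by rewrite mul0r subr0 => <-; rewrite subrK.
  apply: (@zero_derive_cst R (fun t => sqnorm (c t) - t * s) tau tau0) => t.
  move=> /(lifted_path_derive w0 H)[la [_ D _ _]].
  have D' : is_derive t (1:R) (fun t : R => t * s) s.
    have := is_deriveM (@is_derive_id _ _ t (1:R)) (@is_derive_cst _ _ _ s t (1:R)).
    by move=> h; apply: is_derive_eq; rewrite scaler0 add0r /GRing.scale/= mulr1.
  by have := is_deriveB D D'; rewrite subrr.
apply/rowP => i; rewrite [RHS]mxE [X in _ + X]mxE.
suff : gnomonic (G (c tau)) ord0 i - tau * w ord0 i = gnomonic (G (c 0)) ord0 i - 0 * w ord0 i.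
  by rewrite mul0r subr0 => <-; rewrite subrK.
apply: (@zero_derive_cst R (fun t => gnomonic (G (c t)) ord0 i - t * w ord0 i) tau tau0) => t t01.
 have [la [_ _ DG Dg]] := lifted_path_derive w0 H t01.
have [_ gpos _] := H t t01.
have gn0 : gg (G (c t)) != 0 by rewrite gt_eqF.
have D' : is_derive t (1:R) (fun t : R => t * w ord0 i) (w ord0 i).
  have := is_deriveM (@is_derive_id _ _ t (1:R)) (@is_derive_cst _ _ _ (w ord0 i) t (1:R)).
  by move=> h; apply: is_derive_eq; rewrite scaler0 add0r /GRing.scale/= mulr1.
have Di := is_deriveM (is_deriveV gn0 Dg) ((is_derive_coordP _ _ _).1 DG i).
have := is_deriveB Di D'.
rewrite (_ : _ - (fun t : R => t * w ord0 i) =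
  (fun t => gnomonic (G (c t)) ord0 i - t * w ord0 i)); last first.
  by apply/funext => u; rewrite /gnomonic mxE.
move=> h; apply: is_derive_eq; rewrite !mxE /GRing.scale/=; field.
by rewrite gn0.
Qed.

(* [bump (ka - <G, y0>)] is constant along the path: its derivative vanishes both
   where <G, y0> >= ka and, as la = 0 there, where <G, y0> < ka. *)
Lemma lifted_path_gauge s w c tau ka : 0 <= tau -> dotp w y0 = 0 -> lifted_path s w c tau ->
  (forall t : R, 0 <= t <= tau -> sqnorm (gnomonic (G (c 0)) + t *: w) <= 2) ->
  0 <= ka -> 2 * ka ^+ 2 <= mu0 -> ka <= gg (G (c 0)) -> ka <= gg (G (c tau)).
Proof.
move=> tau0 w0 H q2 ka0 kamu ka1.
have E0 : bump (ka - gg (G (c 0))) = 0 by apply: bump_le0; rewrite subr_le0.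
suff E : bump (ka - gg (G (c tau))) = bump (ka - gg (G (c 0))).
  rewrite leNgt; apply/negP => lt; have := @bump_gt0 R (ka - gg (G (c tau))).
  by rewrite subr_gt0 => /(_ lt); rewrite E E0 ltxx.
apply: (@zero_derive_cst R (fun t => bump (ka - gg (G (c t)))) tau tau0) => t t01.
have [la [la0 _ _ Dg]] := lifted_path_derive w0 H t01.
have [_ gpos _] := H t t01.
have D := is_deriveB (@is_derive_cst _ _ _ ka t (1:R)) Dg.
have := @is_derive1_comp R bump (fun u => ka - gg (G (c u))) t _ _ (is_derive_flat 1 _) D.
move=> h; apply: is_derive_eq.
have [le|gt] := leP ka (gg (G (c t))).
  by rewrite /flat subr_gt0 ltNge le/= mul0r.
(* Here G = <G, y0> q with <G, y0> < ka and |q|^2 <= 2, so |G|^2 <= 2 ka^2 <= mu0 and the radial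
   coefficient vanishes. *)
rewrite la0 ?oppr0 ?mul0r ?subr0 ?mulr0//.
move: t01 => /andP[t0 t1].
have [_ Eq] := lifted_path_endpoint t0 w0 (lifted_path_sub t1 H).
have -> : G (c t) = gg (G (c t)) *: gnomonic (G (c t)).
  by rewrite scalerA divff ?scale1r// gt_eqF.
rewrite sqnormZ Eq; apply: le_trans kamu; rewrite mulrC.
have h2 := q2 t; rewrite t0 t1 in h2; have {}h2 := h2 isT.
apply: ler_pM => //; [exact: sqnorm_ge0|exact: sqr_ge0|].
by apply: lerXn2r; rewrite ?nnegrE //; exact: ltW.
Qed.

Lemma sqnorm_convex n (a b : 'rV[R]_n) (r t : R) : 0 <= t <= 1 -> sqnorm a <= r ->
  sqnorm (a + b) <= r -> sqnorm (a + t *: b) <= r.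
Proof.
move=> /andP[t0 t1]; rewrite !sqnormD dotpZr sqnormZ => ha hb.
have h1 : t ^+ 2 * sqnorm b <= t * sqnorm b.
  by rewrite ler_wpM2r ?sqnorm_ge0// expr2 ler_piMr.
have h2 : (1 - t) * sqnorm a <= (1 - t) * r by rewrite ler_wpM2l// subr_ge0.
have h3 := ler_wpM2l t0 hb.
lra.
Qed.

Variable r : R.
Hypothesis r01 : 0 < r <= 1.
Hypothesis rC : forall q, dotp q y0 = 1 -> sqnorm (q - y0) <= r -> ~ C q.

(** Pythagoras: q - y0 is orthogonal to the unit vector y0, and r <= 1. *)
Lemma gnomonic_sqnorm_le2 q : gg q = 1 -> sqnorm (q - y0) <= r -> sqnorm q <= 2.
Proof.
move=> q1; rewrite sqnormB y01 q1 => h.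
have /andP[_ r1] := r01; lra.
Qed.

(** Three coordinates are confined: rho moves between its initial and final values, q runs along a
    segment of a convex disc off C, and <G, y0> stays above ka. K may depend on x, since only the
    existence of the path from x up to time 1 is at stake. *)
Lemma lifted_path_compact x s w : U x -> 0 < gg (G x) -> dotp w y0 = 0 ->
  0 < mu0 -> lo < sqnorm x + s < hi ->
  sqnorm (gnomonic (G x) - y0) <= r -> sqnorm (gnomonic (G x) + w - y0) <= r ->
  exists K : set 'rV[R]_m, [/\ compact K, (forall y, K y -> U y /\ 0 < gg (G y)) &
    forall tau c, 0 <= tau <= 1 -> c 0 = x -> lifted_path s w c tau -> K (c tau)].
Proof.
move=> Ux gx w0 mu00 /andP[s1 s2] q0 q1; have [/andP[x1 x2] _] := Ux.
pose l1 := Num.min (sqnorm x) (sqnorm x + s).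
pose h1 := Num.max (sqnorm x) (sqnorm x + s).
pose nu := Num.min 1 (mu0 / 2).
have nu0 : 0 < nu by rewrite lt_min ltr01 divr_gt0.
(* From ka <= 1 and ka <= mu0 / 2 it follows that 2 ka^2 <= mu0, the threshold of the gauge
   argument. *)
pose ka := Num.min (gg (G x)) nu.
have ka0 : 0 < ka by rewrite lt_min gx nu0.
have kamu : 2 * ka ^+ 2 <= mu0.
  have k1 : ka <= 1 by rewrite /ka /nu !ge_min lexx !orbT.
  have k2 : ka <= mu0 / 2 by rewrite /ka /nu !ge_min lexx !orbT.
  nra.
(* The solid cone over the disc |q - y0|^2 <= r, cut off below height ka. Clearing the denominator
   <y, y0> makes the condition continuous on all of R^p, hence D closed. *)
pose D := [set y : 'rV[R]_p | ka <= gg y] `&` [set y | sqnorm (y - gg y *: y0) - r * gg y ^+ 2 <= 0].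
have cgg k : class_C k setT (fun y : 'rV[R]_p => gg y).
  by apply: class_C_dotp; [exact: openT|exact: class_C_id|exact: class_C_cst].
have clD : closed D.
  apply: closedI.
    rewrite (_ : mkset _ = (fun y : 'rV[R]_p => gg y) @^-1` [set u | ka <= u])//.
    by apply: preimage_closed; [move=> y _; exact: dotp_continuous|exact: closed_ge].
  rewrite (_ : mkset _ = (fun y : 'rV[R]_p => sqnorm (y - gg y *: y0) - r * gg y ^+ 2)
    @^-1` [set u | u <= 0])//.
  apply: preimage_closed; last exact: closed_le.
  suff cc k : class_C k setT (fun y : 'rV[R]_p => sqnorm (y - gg y *: y0) - r * gg y ^+ 2).
    by move=> y _; exact: (cc 0).
  have oT : open (setT : set 'rV[R]_p) by exact: openT.
  apply: class_CB => //.
    apply: class_C_sqnorm => //; apply: class_CB => //; first exact: class_C_id.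
    by apply: class_CZ => //; exact: class_C_cst.
  apply: class_CM => //; [exact: class_C_cst|exact: class_CX].
have DP y : D y -> 0 < gg y /\ ~ C y.
  move=> [/= gy hy]; have g0 : 0 < gg y by exact: lt_le_trans gy.
  split=> // Cy; apply: (rC (q := gnomonic y)); first exact: dotp_gnomonic.
    have -> : gnomonic y - y0 = (gg y)^-1 *: (y - gg y *: y0).
      by rewrite scalerBr scalerA mulVf ?scale1r// gt_eqF.
    rewrite sqnormZ exprVn mulrC ler_pdivrMr ?exprn_gt0//.
    by move: hy; rewrite subr_le0.
  by apply: (coneC.2) => //; rewrite invr_gt0.
exists ([set z | l1 <= sqnorm z <= h1] `&` G @^-1` D); split.
- apply: compact_preimage => //; first exact: annulus_compact.
  move=> z /= /andP[z1 z2]; apply: (cG 0); apply: annW.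
  rewrite (le_trans _ z1) ?(le_trans z2)//.
    by rewrite ge_max !ltW.
  by rewrite le_min !ltW.
- move=> y [/= /andP[y1 y2] /DP[g0 nC]]; split=> //; split=> //.
  by rewrite (lt_le_trans _ y1) ?(le_lt_trans y2)// ?gt_max ?lt_min ?x1 ?x2 ?s1 ?s2.
- move=> tau c /andP[tau0 tau1] c0 H.
  have [Erho Eq] := lifted_path_endpoint tau0 w0 H.
  have qt (t : R) : 0 <= t <= 1 -> sqnorm (gnomonic (G x) + t *: w - y0) <= r.
    move=> t01; have -> : gnomonic (G x) + t *: w - y0 = gnomonic (G x) - y0 + t *: w by rewrite addrAC.
    by apply: sqnorm_convex => //; rewrite addrAC.
  have q1' (t : R) : gg (gnomonic (G x) + t *: w) = 1.
    by rewrite dotpDl dotpZl w0 mulr0 addr0 dotp_gnomonic.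
  have tau_in : 0 <= tau <= tau by rewrite tau0 lexx.
  have [_ gpos _] := H tau tau_in.
  split.
    rewrite /= Erho c0 /l1 /h1 ge_min le_max.
    by have [s0|s0] := leP 0 s; apply/andP; split; apply/orP; [left|right|right|left]; nra.
  have kt : ka <= gg (G (c tau)).
    apply: (lifted_path_gauge tau0 w0 H) => //; last by rewrite c0 /ka ge_min lexx.
    - move=> t /andP[t0 t1]; rewrite c0; apply: gnomonic_sqnorm_le2 => //; apply: qt.
      by rewrite t0 (le_trans t1).
    - exact: ltW.
  split=> //=; rewrite subr_le0.
  have -> : G (c tau) - gg (G (c tau)) *: y0 = gg (G (c tau)) *: (gnomonic (G (c tau)) - y0).
    by rewrite scalerBr scalerA divff ?scale1r// gt_eqF.
  rewrite sqnormZ mulrC ler_wpM2r ?sqr_ge0// Eq c0; apply: qt.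
  by rewrite tau0.
Qed.

Definition lift_domain : set 'rV[R]_m := [set x | U x /\ 0 < gg (G x)].

Lemma open_lift_domain : open lift_domain.
Proof.
have cg := class_C_dotp oU (cGU 0) (@class_C_cst _ _ _ 0 U y0).
exact: (@open_continuous_preimage R _ R U (fun x => gg (G x)) [set u | 0 < u] oU cg (@open_gt R 0)).
Qed.

(* The direction w is frozen as part of the state, so that smooth dependence of
   the flow on initial conditions includes smooth dependence on w. *)
Definition lift_field (s : R) (z : 'rV[R]_(m + p)) : 'rV[R]_(m + p) :=
  row_mx (milnor_field (lsubmx z) (row_mx s%:M (gg (G (lsubmx z)) *: rsubmx z))) 0.

Definition lift_space : set 'rV[R]_(m + p) := [set z | lift_domain (lsubmx z)].

Lemma open_lift_space : open lift_space.
Proof. exact: (open_lsubmx open_lift_domain). Qed.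

Lemma class_C_gauge_map (V : normedModType R) k (O : set V) (f : V -> 'rV[R]_p) :
  open O -> class_C k O f -> class_C k O (fun z => gg (f z)).
Proof. by move=> oO cf; apply: class_C_dotp => //; exact: class_C_cst. Qed.

Lemma class_C_lift_field s k : class_C k lift_space (lift_field s).
Proof.
have oT := open_lift_space.
have cl : class_C k lift_space (fun z => lsubmx z) by apply: class_C_lsubmx => //; exact: class_C_id.
have cr : class_C k lift_space (fun z => rsubmx z) by apply: class_C_rsubmx => //; exact: class_C_id.
apply: class_C_row_mx => //; last exact: class_C_cst.
apply: class_C_milnor_field => //; first by move=> z [].
apply: class_C_row_mx => //; first exact: class_C_cst.
apply: class_CZ => //; apply: class_C_gauge_map => //.
by apply: (class_C_comp_row oU) => // z [].
Qed.

Lemma lifted_path_solution s w c tau : lifted_path s w c tau ->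
  solution (lift_field s) lift_space (row_mx (c 0) w) (fun t => row_mx (c t) w) tau.
Proof.
move=> H; split=> // t /H[Uc gc Dc]; split; first by rewrite /lift_space/= row_mxKl.
have := is_derive_row_mx Dc (@is_derive_cst _ _ _ w t (1:R)).
by rewrite /lift_field row_mxKl row_mxKr.
Qed.

Lemma solution_lifted_path s x w c tau : 0 <= tau ->
  solution (lift_field s) lift_space (row_mx x w) c tau ->
  [/\ lsubmx (c 0) = x, rsubmx (c tau) = w & lifted_path s w (fun t => lsubmx (c t)) tau].
Proof.
move=> tau0 [c0 H].
have Dl (t : R) : 0 <= t <= tau ->
    is_derive t (1:R) (fun t => lsubmx (c t)) (lsubmx (lift_field s (c t))).
  move=> /H[_ /is_derive_coordP D]; apply/is_derive_coordP => i; rewrite mxE.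
  by rewrite (_ : (fun _ => _) = (fun u => c u ord0 (lshift p i)))//; apply/funext => u; rewrite mxE.
have Er (t : R) : 0 <= t <= tau -> rsubmx (c t) = w.
  move=> /andP[t0 t1]; have -> : w = rsubmx (c 0) by rewrite c0 row_mxKr.
  apply/rowP => i; rewrite !mxE.
  apply: (@zero_derive_cst R (fun t => c t ord0 (rshift m i)) t t0) => u /andP[u0 u1].
  have /H[_ /is_derive_coordP/(_ (rshift m i))] : 0 <= u <= tau by rewrite u0 (le_trans u1).
  by rewrite /lift_field row_mxEr mxE.
split; first by rewrite c0 row_mxKl.
  by apply: Er; rewrite tau0 lexx.
move=> t t01; have [Hc _] := H t t01; have [Uc gc] := Hc; split=> //.
by have := Dl t t01; rewrite /lift_field row_mxKl (Er t t01).
Qed.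

(** [milnor_field] is linear in b, so time reversal amounts to changing the signs of s and w;
    inverse maps are thus again transports. *)
Lemma lifted_path_rev s w c : lifted_path s w c 1 ->
  lifted_path (- s) (- w) (fun t => c (1 - t)) 1.
Proof.
move=> H t /andP[t0 t1].
have [|Uc gc Dc] := H (1 - t); first by rewrite subr_ge0 t1 lerBlDr lerDl.
split=> //; have -> : milnor_field (c (1 - t)) (row_mx (- s)%:M (gg (G (c (1 - t))) *: - w)) =
    - milnor_field (c (1 - t)) (row_mx s%:M (gg (G (c (1 - t))) *: w)).
  by rewrite /milnor_field -!mulNmx opp_row_mx scalerN raddfN.
exact: is_derive_rev.
Qed.

Lemma lift_exists x s w : U x -> 0 < gg (G x) -> dotp w y0 = 0 ->
  0 < mu0 -> lo < sqnorm x + s < hi ->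
  sqnorm (gnomonic (G x) - y0) <= r -> sqnorm (gnomonic (G x) + w - y0) <= r ->
  exists c, c 0 = x /\ lifted_path s w c 1.
Proof.
move=> Ux gx w0 mu00 hs q0 q1.
have [K [cK KU HK]] := lifted_path_compact Ux gx w0 mu00 hs q0 q1.
have ce : continuous (fun y : 'rV[R]_m => row_mx y w).
  move=> y; have := class_C_row_mx (@openT _) (@class_C_id _ _ 0 (setT : set 'rV[R]_m))
    (@class_C_cst _ _ _ 0 _ w).
  by apply.
have cK' : compact ((fun y => row_mx y w) @` K).
  by apply: continuous_compact => //; apply: continuous_subspaceT => y; exact: ce.
have [|||c sc] := apriori_solution open_lift_space (class_C_lift_field s 1) cK' (x := row_mx x w).
- by move=> _ [y /KU Ky <-]; rewrite /lift_space/= row_mxKl.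
- by rewrite /lift_space/= row_mxKl.
- move=> tau c /andP[tau0 tau1] sc; have [c0 cr Hc] := solution_lifted_path tau0 sc.
  exists (lsubmx (c tau)); last by rewrite -cr hsubmxK.
  by apply: (HK tau (fun t => lsubmx (c t))) => //; rewrite tau0.
- have [c0 _ Hc] := solution_lifted_path ler01 sc.
  by exists (fun t => lsubmx (c t)).
Qed.

Definition transport s x w : 'rV[R]_m :=
  lsubmx (flow1 (lift_field s) lift_space (row_mx x w)).

Lemma lifted_path_transport s w c : lifted_path s w c 1 ->
  flow_domain (lift_field s) lift_space (row_mx (c 0) w) /\ transport s (c 0) w = c 1.
Proof.
move=> /lifted_path_solution sc; split; first by exists (fun t => row_mx (c t) w).
by rewrite /transport (flow1E open_lift_space (class_C_lift_field s 1) sc) row_mxKl.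
Qed.

Lemma transportP x s w : U x -> 0 < gg (G x) -> dotp w y0 = 0 ->
  0 < mu0 -> lo < sqnorm x + s < hi ->
  sqnorm (gnomonic (G x) - y0) <= r -> sqnorm (gnomonic (G x) + w - y0) <= r ->
  let z := transport s x w in
  [/\ flow_domain (lift_field s) lift_space (row_mx x w), lift_domain z,
      sqnorm z = sqnorm x + s, gnomonic (G z) = gnomonic (G x) + w &
      flow_domain (lift_field (- s)) lift_space (row_mx z (- w)) /\ transport (- s) z (- w) = x].
Proof.
move=> Ux gx w0 mu00 hs q0 q1.
have [c [c0 Hc]] := lift_exists Ux gx w0 mu00 hs q0 q1.
have [fd Ez] := lifted_path_transport Hc; rewrite c0 in fd Ez; rewrite Ez.
have [Er Eg] := lifted_path_endpoint ler01 w0 Hc; rewrite c0 mul1r in Er; rewrite c0 scale1r in Eg.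
have [fd' Ez'] := lifted_path_transport (lifted_path_rev Hc).
rewrite subr0 in fd' Ez'; rewrite subrr c0 in Ez'.
have [|Uc gc _] := Hc 1; first by rewrite ler01 lexx.
by split.
Qed.

Lemma gnomonicZ k y : k != 0 -> gnomonic (k *: y) = gnomonic y.
Proof. by move=> k0; rewrite /gnomonic dotpZl invfM scalerA mulrAC mulVf// mul1r. Qed.

(** On the half-space <y, y0> > 0 the gnomonic coordinate determines the ray, so statements about q
    translate back into statements about psi. *)
Lemma normalise_eq a b : 0 < gg a -> 0 < gg b -> gnomonic a = gnomonic b -> sqnorm b = 1 ->
  (enorm a)^-1 *: a = b.
Proof.
move=> ga gb ab b1; have -> : a = (gg a / gg b) *: b.
  have Ea : gg a *: gnomonic a = a by rewrite scalerA divff ?scale1r// gt_eqF.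
  by rewrite -{1}Ea ab /gnomonic scalerA.
have k0 : 0 < gg a / gg b by rewrite divr_gt0.
rewrite /enorm sqnormZ b1 mulr1 sqrtr_sqr gtr0_norm// scalerA mulVf ?scale1r//.
by rewrite gt_eqF.
Qed.

Lemma gauge_y0 : gg y0 = 1.
Proof. by rewrite -sqnormE. Qed.

Lemma gnomonic_y0 : gnomonic y0 = y0.
Proof. by rewrite /gnomonic gauge_y0 invr1 scale1r. Qed.

Lemma class_C_gnomonic (V : normedModType R) k (O : set V) (f : V -> 'rV[R]_p) :
  open O -> (forall z, O z -> 0 < gg (f z)) -> class_C k O f ->
  class_C k O (fun z => gnomonic (f z)).
Proof.
move=> oO f0 cf; apply: class_CZ => //; apply: class_CV => //; last exact: class_C_gauge_map.
by move=> z /f0 h; rewrite gt_eqF.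
Qed.

Definition chart_nbhd : set 'rV[R]_p := [set y | 0 < gg y /\ sqnorm (gnomonic y - y0) < r].

Lemma open_half_space : open [set y : 'rV[R]_p | 0 < gg y].
Proof.
have cg : class_C 0 setT (fun y : 'rV[R]_p => gg y).
  by apply: class_C_gauge_map; [exact: openT|exact: class_C_id].
have := @open_continuous_preimage R _ R setT (fun y => gg y) [set u | 0 < u] (@openT _) cg
  (@open_gt R 0).
by congr open; apply/seteqP; split=> y //= [].
Qed.

Lemma open_chart_nbhd : open chart_nbhd.
Proof.
have oH := open_half_space.
have cg : class_C 0 [set y : 'rV[R]_p | 0 < gg y] (fun y => sqnorm (gnomonic y - y0)).
  apply: (class_C_sqnorm oH); apply: (class_CB oH); last exact: class_C_cst.
  by apply: (class_C_gnomonic oH) => //; exact: class_C_id.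
exact: (@open_continuous_preimage R _ R _ _ [set u | u < r] oH cg (@open_lt R r)).
Qed.

Lemma open_transport_domain (V : normedModType R) (O : set V) s (X : V -> 'rV[R]_m)
    (w : V -> 'rV[R]_p) : open O -> class_C 0 O X -> class_C 0 O w ->
  open [set z | O z /\ flow_domain (lift_field s) lift_space (row_mx (X z) (w z))].
Proof.
move=> oO cX cw; apply: (open_continuous_preimage oO (class_C_row_mx oO cX cw)).
exact: (open_flow_domain open_lift_space (class_C_lift_field s 1)).
Qed.

Lemma class_C_transport (V : normedModType R) k (O : set V) s (X : V -> 'rV[R]_m)
    (w : V -> 'rV[R]_p) : open O -> (forall j, class_C j O X) -> (forall j, class_C j O w) ->
  class_C k [set z | O z /\ flow_domain (lift_field s) lift_space (row_mx (X z) (w z))]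
    (fun z => transport s (X z) (w z)).
Proof.
move=> oO cX cw; have oD := open_transport_domain s oO (cX 0) (cw 0).
apply: (class_C_lsubmx oD).
apply: (class_C_comp_row (open_flow_domain open_lift_space (class_C_lift_field s 1)) oD).
- by move=> z [].
- by apply: (class_C_row_mx oD); [apply: class_C_sub (cX k)|apply: class_C_sub (cw k)] => z [].
- exact: (class_C_flow1 k open_lift_space (class_C_lift_field s)).
Qed.

Lemma smooth_on_class_C (V V' : normedModType R) (A O : set V) (f : V -> V') :
  open O -> A `<=` O -> (forall k, class_C k O f) -> smooth_on A f.
Proof. by move=> oO AO cf x Ax; exists O, f; split => //; exact: AO. Qed.

Variable e : R.
Hypothesis e0 : 0 < e.
Hypothesis e_in : lo < e ^+ 2 < hi.
Hypothesis mu00 : 0 < mu0.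

Local Notation X := (esphere m e `\` G @^-1` C).
Local Notation Y := (esphere p 1 `\` C).

Lemma enorm_sqnorm n (x : 'rV[R]_n) : enorm x ^+ 2 = sqnorm x.
Proof. by rewrite sqr_sqrtr// sqnorm_ge0. Qed.

Lemma sphere_off_coneP x : X x <-> U x /\ sqnorm x = e ^+ 2.
Proof.
split=> [[xe nC]|[[_ nC] xe]]; last first.
  by split => //; rewrite /esphere/= /enorm xe sqrtr_sqr gtr0_norm.
have E : sqnorm x = e ^+ 2 by rewrite -enorm_sqnorm xe.
by split=> //; split=> //; rewrite E.
Qed.

Lemma psi_off_cone x : U x -> Y (psi G x).
Proof.
move=> Ux; have Gx := annulus_off_cone_neq0 Ux; split.
  by rewrite /esphere/= /enorm (sqnorm_psi annulus_off_cone_neq0 Ux) sqrtr1.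
move=> Cp; have [_ nC] := Ux; apply: nC.
have n0 : 0 < enorm (G x) by rewrite sqrtr_gt0 sqnorm_gt0.
have -> : G x = enorm (G x) *: psi G x by rewrite scalerA divff ?scale1r// gt_eqF.
exact: coneC.2.
Qed.

Lemma enorm_psi_neq0 x : U x -> (enorm (G x))^-1 != 0.
Proof.
by move=> Ux; rewrite invr_eq0 gt_eqF// sqrtr_gt0 sqnorm_gt0; exact: annulus_off_cone_neq0.
Qed.

Lemma gauge_psi x : U x -> (0 < gg (psi G x)) = (0 < gg (G x)).
Proof.
move=> Ux; rewrite dotpZl pmulr_rgt0// invr_gt0 sqrtr_gt0 sqnorm_gt0.
exact: annulus_off_cone_neq0.
Qed.

Lemma gnomonic_psi x : U x -> gnomonic (psi G x) = gnomonic (G x).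
Proof. by move=> Ux; rewrite gnomonicZ// enorm_psi_neq0. Qed.

(** [tr] follows, in unit time, the segment from the coordinate of psi G x to y0, and [bk] follows
    it from y0 back; s = 0 keeps both on the sphere. *)
Let tr x := transport 0 x (y0 - gnomonic (G x)).
Let bk (yz : 'rV[R]_p * 'rV[R]_m) := transport 0 yz.2 (gnomonic yz.1 - y0).

Lemma transport_to_fibre x : X x -> chart_nbhd (psi G x) ->
  [/\ flow_domain (lift_field 0) lift_space (row_mx x (y0 - gnomonic (G x))),
      X (tr x), psi G (tr x) = y0 & bk (psi G x, tr x) = x].
Proof.
move=> /sphere_off_coneP[Ux xe] []; rewrite gauge_psi// gnomonic_psi// => gx qx.
have [|||||fd [Uz gz] Ez Eg [_ Eb]] := @transportP x 0 (y0 - gnomonic (G x)) Ux gx.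
- by rewrite dotpBl gauge_y0 dotp_gnomonic// subrr.
- exact: mu00.
- by rewrite addr0 xe.
- exact: ltW.
- have /andP[/ltW r0 _] := r01.
  by rewrite (addrC (gnomonic _)) subrK subrr sqnormE dotp0l.
- split=> //.
  + by apply/sphere_off_coneP; split => //; rewrite /tr Ez addr0.
  + apply: normalise_eq => //; first by rewrite gauge_y0.
    by rewrite Eg gnomonic_y0 addrC subrK.
  + rewrite /bk/= gnomonic_psi//.
    by move: Eb; rewrite oppr0 opprB.
Qed.

Lemma transport_from_fibre y z : Y y -> chart_nbhd y -> X z -> psi G z = y0 ->
  [/\ flow_domain (lift_field 0) lift_space (row_mx z (gnomonic y - y0)),
      X (bk (y, z)), psi G (bk (y, z)) = y & tr (bk (y, z)) = z].
Proof.
move=> [y1 nCy] [gy qy] /sphere_off_coneP[Uz ze] pz.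
have gz : 0 < gg (G z) by rewrite -gauge_psi// pz gauge_y0.
have qz : gnomonic (G z) = y0 by rewrite -gnomonic_psi// pz gnomonic_y0.
have [|||||fd [Ux gx] Ex Eg [_ Eb]] := @transportP z 0 (gnomonic y - y0) Uz gz.
- by rewrite dotpBl gauge_y0 dotp_gnomonic// subrr.
- exact: mu00.
- by rewrite addr0 ze.
- have /andP[/ltW r0 _] := r01.
  by rewrite qz subrr sqnormE dotp0l.
- by rewrite qz (addrC y0) subrK; exact: ltW.
- have Eg' : gnomonic (G (bk (y, z))) = gnomonic y by rewrite Eg qz addrC subrK.
  split=> //.
  + by apply/sphere_off_coneP; split => //; rewrite Ex addr0.
  + by apply: normalise_eq => //; rewrite -enorm_sqnorm y1 expr1n.
  + by rewrite /tr Eg'; move: Eb; rewrite oppr0 opprB.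
Qed.

Lemma local_trivialisation : exists (O : set 'rV[R]_p) (h : 'rV[R]_m -> 'rV[R]_p * 'rV[R]_m),
  [/\ open O, O y0,
      diffeomorphism (X `&` psi G @^-1` O) ((Y `&` O) `*` (X `&` psi G @^-1` [set y0])) h
    & forall x, X x -> O (psi G x) -> (h x).1 = psi G x].
Proof.
exists chart_nbhd, (fun x => (psi G x, tr x)); split=> //.
- exact: open_chart_nbhd.
- split; first by rewrite gauge_y0.
  by rewrite gnomonic_y0 subrr sqnormE dotp0l; have /andP[] := r01.
exists bk; split.
(* Smoothness on a piece of the sphere is witnessed by an extension: the same formula makes sense on
   the open set of points off the sphere where the flow reaches time 1. *)
- have oL := open_lift_domain.
  have cGL j : class_C j lift_domain G by apply: class_C_sub (cGU j) => x [].
  have cw j : class_C j lift_domain (fun x => y0 - gnomonic (G x)).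
    apply: (class_CB oL); first exact: class_C_cst.
    by apply: (class_C_gnomonic oL) => // x [].
  have ci j : class_C j lift_domain (fun x : 'rV[R]_m => x) by exact: class_C_id.
  have oD := open_transport_domain 0 oL (ci 0) (cw 0).
  apply: (smooth_on_class_C oD) => [x [Xx Ox]|k].
    have [fd _ _ _] := transport_to_fibre Xx Ox; split=> //.
    have [Ux _] := (sphere_off_coneP x).1 Xx; split => //.
    by rewrite -gauge_psi//; case: Ox.
  apply: (class_C_pair oD); last exact: (class_C_transport k 0 oL ci cw).
  apply: class_C_psi => //; first by move=> x [[Ux _] _]; exact: annulus_off_cone_neq0.
  by apply: class_C_sub (cGL k) => x [].
(* The inverse extends to pairs (y, z) with y in the half-space and z outside the fibre as well, as
   long as the flow is defined. *)
- have oH' : open [set yz : 'rV[R]_p * 'rV[R]_m | 0 < gg yz.1].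
    have := @open_continuous_preimage R _ _ setT (fun yz : 'rV[R]_p * 'rV[R]_m => yz.1)
      [set y | 0 < gg y] (@openT _) _ open_half_space.
    rewrite (_ : [set _ | _ /\ _] = [set yz : 'rV[R]_p * 'rV[R]_m | 0 < gg yz.1]).
      by apply=> x _; exact: cvg_fst.
    by apply/seteqP; split=> yz //= [].
  set O' := [set yz : 'rV[R]_p * 'rV[R]_m | 0 < gg yz.1] in oH'.
  have c1 j : class_C j O' (fun yz : 'rV[R]_p * 'rV[R]_m => yz.1).
    by apply: (class_C_fst oH'); exact: class_C_id.
  have c2 j : class_C j O' (fun yz : 'rV[R]_p * 'rV[R]_m => yz.2).
    by apply: (class_C_snd oH'); exact: class_C_id.
  have cw j : class_C j O' (fun yz => gnomonic yz.1 - y0).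
    by apply: (class_CB oH'); [exact: (class_C_gnomonic oH')|exact: class_C_cst].
  have oD := open_transport_domain 0 oH' (c2 0) (cw 0).
  apply: (smooth_on_class_C oD) => [[y z] [/= [Yy Oy] [Xz pz]]|k].
    have [fd _ _ _] := transport_from_fibre Yy Oy Xz pz; split=> //.
    by case: Oy.
  exact: (class_C_transport k 0 oH' c2 cw).
- move=> x [Xx Ox]; have [_ Xz pz Eb] := transport_to_fibre Xx Ox.
  have [Ux _] := (sphere_off_coneP x).1 Xx.
  by split=> //; split; split => //; exact: psi_off_cone.
- move=> [y z] [/= [Yy Oy] [Xz pz]].
  have [_ Xx px Et] := transport_from_fibre Yy Oy Xz pz.
  by rewrite px Et; split=> //; split=> //=; rewrite /preimage/= px.
Qed.

End lifting.

(** * The fibrations on the spheres and the passage between spheres *)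

Lemma cone_separation y : ~ C y ->
  exists2 r, 0 < r <= 1 & forall q, sqnorm (q - y) <= r -> ~ C q.
Proof.
move=> nC; have /nbhs_ballP[d /= d0 Hd] : nbhs y (~` C).
  by apply: open_nbhs_nbhs; split => //; exact: closed_openC.
(* The bound is on the square of the Euclidean norm, which dominates the sup norm of the ball; the
   cap 1 is the condition r <= 1 of the charts. *)
exists (Num.min 1 ((d / 2) ^+ 2)).
  by rewrite lt_min ltr01 exprn_gt0 ?divr_gt0//= ge_min lexx.
move=> q; rewrite le_min => /andP[_ h]; apply: Hd; rewrite -ball_normE/= distrC.
have d2 : 0 < d / 2 by rewrite divr_gt0.
apply: (@le_lt_trans _ _ (d / 2)); last by lra.
rewrite -(@ler_pXn2r _ 2 isT) ?nnegrE ?(ltW d2)//.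
exact: le_trans (norm_sqr_le_sqnorm _) h.
Qed.

(** With w = 0 the auxiliary vector y0 disappears, so one field serves all of U, while the chart
    estimates can be applied at each point with its own y0. *)
Definition radial_field (s : R) (x : 'rV[R]_m) : 'rV[R]_m := milnor_field x (row_mx s%:M 0).

Lemma class_C_radial_field s k : class_C k U (radial_field s).
Proof. by apply: class_C_milnor_field => //; [exact: class_C_id|exact: class_C_cst]. Qed.

Lemma lifted_path_radial y0 s c : lifted_path y0 s 0 c 1 ->
  solution (radial_field s) U (c 0) c 1.
Proof. by move=> H; split=> // t /H[Uc _]; rewrite scaler0. Qed.

(** For y0 = psi G x the coordinate q starts at y0 and stays there, so psi is preserved and the
    confinement results apply with any disc around y0 off C. *)
Lemma radial_flowP x s : 0 < mu0 -> U x -> lo < sqnorm x + s < hi ->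
  let z := flow1 (radial_field s) U x in
  [/\ flow_domain (radial_field s) U x, U z, sqnorm z = sqnorm x + s,
      psi G z = psi G x & flow1 (radial_field (- s)) U z = x].
Proof.
move=> mu00 Ux hs; pose y0 := psi G x.
have Gx := annulus_off_cone_neq0 Ux.
have n0 : 0 < enorm (G x) by rewrite sqrtr_gt0 sqnorm_gt0.
have y01 : sqnorm y0 = 1 := sqnorm_psi annulus_off_cone_neq0 Ux.
have [_ y0C] := psi_off_cone Ux.
have [r r01 Hr] := cone_separation y0C.
have Gy : G x = enorm (G x) *: y0 by rewrite scalerA divff ?scale1r// gt_eqF.
have gx : 0 < dotp (G x) y0 by rewrite Gy dotpZl -sqnormE y01 mulr1.
have qx : gnomonic y0 (G x) = y0.
  by rewrite (congr1 (gnomonic y0) Gy) gnomonicZ ?gt_eqF// gnomonic_y0.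
have r0 : 0 <= r by have /andP[/ltW] := r01.
have z0 : sqnorm (0 : 'rV[R]_p) = 0 by rewrite sqnormE dotp0l.
have [||c [c0 Hc]] := @lift_exists y0 y01 r r01 (fun q _ => Hr q) x s 0 Ux gx (dotp0l y0) mu00 hs.
- by rewrite qx subrr z0.
- by rewrite qx addr0 subrr z0.
have sc := lifted_path_radial Hc; rewrite c0 in sc.
have Hr' := lifted_path_rev Hc; rewrite oppr0 in Hr'.
have sc' := lifted_path_radial Hr'; rewrite subr0 in sc'.
have fl s' := flow1E oU (class_C_radial_field s' 1).
lazy zeta; rewrite (fl _ _ _ sc) (fl _ _ _ sc') subrr c0.
have [Er Eg] := lifted_path_endpoint ler01 (dotp0l y0) Hc.
rewrite c0 mul1r in Er; rewrite c0 scaler0 addr0 qx in Eg.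
have [|U1 g1 _] := Hc 1; first by rewrite ler01 lexx.
split=> //; first by exists c.
apply: (@normalise_eq y0 (G (c 1)) y0 g1) => //; first by rewrite -sqnormE y01.
by rewrite Eg gnomonic_y0.
Qed.

Hypothesis mu00 : 0 < mu0.

Lemma sphere_psi_fibration e : 0 < e -> lo < e ^+ 2 < hi ->
  smooth_fibration (esphere m e `\` G @^-1` C) (esphere p 1 `\` C) (psi G).
Proof.
move=> e0 e_in; split.
- by move=> x /(sphere_off_coneP e0 e_in)[Ux _]; exact: psi_off_cone.
- apply: (smooth_on_class_C oU) => [x /(sphere_off_coneP e0 e_in)[]//|k].
  by apply: class_C_psi => //; exact: annulus_off_cone_neq0.
- move=> y [y1 nCy]; have [r r01 Hr] := cone_separation nCy.
  have y01 : sqnorm y = 1 by rewrite -enorm_sqnorm y1 expr1n.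
  exact: (local_trivialisation y01 r01 (fun q _ => Hr q) e0 e_in mu00).
Qed.

Lemma sphere_radial_iso e1 e2 : 0 < e1 -> 0 < e2 -> lo < e1 ^+ 2 < hi -> lo < e2 ^+ 2 < hi ->
  fibration_iso (esphere m e1 `\` G @^-1` C) (esphere m e2 `\` G @^-1` C) (psi G).
Proof.
(* rho is the squared distance and moves with speed s for unit time. *)
move=> e10 e20 in1 in2; pose s := e2 ^+ 2 - e1 ^+ 2.
have P1 x := sphere_off_coneP e10 in1 x; have P2 x := sphere_off_coneP e20 in2 x.
have F1 x : U x -> sqnorm x = e1 ^+ 2 -> lo < sqnorm x + s < hi.
  by move=> _ ->; rewrite addrC subrK.
have F2 x : U x -> sqnorm x = e2 ^+ 2 -> lo < sqnorm x + - s < hi.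
  by move=> _ ->; rewrite opprB addrC subrK.
have sm s' k := @class_C_flow1 R k m U (radial_field s') oU (class_C_radial_field s').
have od s' := open_flow_domain oU (class_C_radial_field s' 1).
exists (flow1 (radial_field s) U); split; last first.
  by move=> x /P1[Ux xe]; have [] := radial_flowP mu00 Ux (F1 x Ux xe).
exists (flow1 (radial_field (- s)) U); split.
- apply: (smooth_on_class_C (od s)) => [x /P1[Ux xe]|k]; last exact: sm.
  by have [] := radial_flowP mu00 Ux (F1 x Ux xe).
- apply: (smooth_on_class_C (od (- s))) => [x /P2[Ux xe]|k]; last exact: sm.
  by have [] := radial_flowP mu00 Ux (F2 x Ux xe).
- move=> x /P1[Ux xe]; have [_ Uz Ez _ Eb] := radial_flowP mu00 Ux (F1 x Ux xe).
  by split=> //; apply/P2; split=> //; rewrite Ez xe addrC subrK.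
- move=> x /P2[Ux xe]; have [_ Uz Ez _ Eb] := radial_flowP mu00 Ux (F2 x Ux xe).
  rewrite opprK in Eb; split=> //; apply/P1; split=> //.
  by rewrite Ez xe opprB addrC subrK.
Qed.

End milnor_field.

(** * From germs at the origin to a uniform annulus *)

Section germs.
Context {R : realType} {m p : nat}.

Lemma closed_disc (G : 'rV[R]_m -> 'rV[R]_p) e : closed (disc G e).
Proof.
apply: closedU; first exact: closed_closure.
by rewrite setDE; apply: closedI; [exact: closed_closure|exact/open_closedC/open_interior].
Qed.

(** A point of the closure is scaled into the ball where C and D agree, and scaled back
    afterwards. *)
Lemma closed_cone_of_germ (C D : set 'rV[R]_p) : real_cone C -> closed D -> germ_eq D C -> closed C.
Proof.
move=> coneC clD /nbhs_ballP[d /= d0 Hd] y clCy.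
have {}Hd z : `|z| < d -> (D z <-> C z).
  by move=> zd; apply: Hd; rewrite -ball_normE/= sub0r normrN.
(* Then |t y| <= d / 2 < d, also for y = 0. *)
pose t := d / 2 / (`|y| + 1).
have y1 : 0 < `|y| + 1 by rewrite ltr_wpDl.
have t0 : 0 < t by rewrite !divr_gt0.
have ty : `|t *: y| < d.
  have h : (`|y| + 1)^-1 * `|y| <= 1 by rewrite mulrC ler_pdivrMr// mul1r lerDl.
  rewrite normrZ gtr0_norm// /t -(mulrA (d / 2)).
  have := ler_wpM2l (ltW (divr_gt0 d0 (ltr0Sn R 1))) h.
  by rewrite mulr1 => /le_lt_trans; apply; lra.
suff Dty : D (t *: y).
  have tn0 : t != 0 by rewrite gt_eqF.
  rewrite -[y]scale1r -(mulVf tn0) -scalerA.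
  by apply: coneC.2; [rewrite invr_gt0|apply/Hd].
apply: clD => N Nty.
have ct : {for y, continuous (fun z : 'rV[R]_p => t *: z)} by exact: scaler_continuous.
have nd : nbhs (t *: y) [set z : 'rV[R]_p | `|z| < d].
  apply/nbhs_ballP; exists (d - `|t *: y|); first by rewrite /= subr_gt0.
  move=> z; rewrite -ball_normE/= ltrBrDl => h; apply: le_lt_trans h.
  by rewrite -[X in `|X| <= _](subrK (t *: y) z) addrC (le_trans (ler_normD _ _))// distrC.
have [z [Cz [Nz zd]]] := clCy _ (ct _ (filterI Nty nd)).
by exists (t *: z); split=> //; apply/Hd => //; exact: coneC.2.
Qed.

(** The origin is outside the closed annulus, so on the compact part of it lying in the closure of
    M(G) minus G^-1(C) the function |G|^2 has no zero. Its image is closed and hence avoids a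
    neighbourhood of 0, which yields mu0. *)
Lemma milnor_annulus (G : 'rV[R]_m -> 'rV[R]_p) (C : set 'rV[R]_p) (d e1 e2 : R) :
  (forall x : 'rV[R]_m, `|x| < d -> {for x, continuous G}) ->
  (forall x : 'rV[R]_m, `|x| < d -> (closure (milnor_set G `\` G @^-1` C) `&` zero_set G) x -> x = 0) ->
  (forall x : 'rV[R]_m, `|x| < d -> milnor_set_psi G x -> C (G x)) ->
  C 0 -> 0 < e1 < d -> 0 < e2 < d ->
  exists lo hi mu0 : R, [/\ 0 < mu0, lo < e1 ^+ 2 < hi, lo < e2 ^+ 2 < hi,
    (forall x : 'rV[R]_m, lo <= sqnorm x <= hi -> `|x| < d) &
    (forall x, annulus_off_cone G C lo hi x -> sqnorm (G x) <= mu0 ->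
       ~ (\rank ('J (with_sqnorm G) x) < p.+1)%N) /\
    (forall x, annulus_off_cone G C lo hi x ->
       ~ (\rank ('J (with_sqnorm (psi G)) x) < p)%N)].
Proof.
move=> cG hM hP C0 /andP[e10 e1d] /andP[e20 e2d].
pose a := Num.min e1 e2; pose b := Num.max e1 e2.
have a0 : 0 < a by rewrite lt_min e10.
have bd : b < d by rewrite gt_max e1d.
have b0 : 0 <= b by rewrite le_max ltW.
have d0 : 0 < d by exact: lt_trans e1d.
(* Thus 0 < lo < a^2 <= b^2 < hi < d^2: both spheres are interior to the annulus, and the closed
   annulus lies in the ball where the germ hypotheses hold. *)
pose lo := a ^+ 2 / 2; pose hi := (b ^+ 2 + d ^+ 2) / 2.
have a20 : 0 < a ^+ 2 by rewrite exprn_gt0.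
have bd2 : b ^+ 2 < d ^+ 2 by rewrite ltr_pXn2r// nnegrE// ltW.
have ine e : 0 < e -> a <= e -> e <= b -> lo < e ^+ 2 < hi.
  move=> e0 ae eb; have h1 : a ^+ 2 <= e ^+ 2 by apply: lerXn2r; rewrite ?nnegrE// ltW.
  have h2 : e ^+ 2 <= b ^+ 2 by apply: lerXn2r; rewrite ?nnegrE//; exact: ltW.
  by rewrite /lo /hi; apply/andP; split; lra.
have annd (x : 'rV[R]_m) : lo <= sqnorm x <= hi -> `|x| < d.
  move=> /andP[_ xh]; rewrite -(@ltr_pXn2r _ 2 isT) ?nnegrE ?(ltW d0)//.
  apply: (le_lt_trans (norm_sqr_le_sqnorm x)); apply: (le_lt_trans xh).
  by rewrite /hi; lra.
pose Z := [set x : 'rV[R]_m | lo <= sqnorm x <= hi] `&` closure (milnor_set G `\` G @^-1` C).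
have cZ : compact Z by apply: compact_closedI; [exact: annulus_compact|exact: closed_closure].
pose f x := sqnorm (G x).
have cf : {within Z, continuous f}.
  apply/continuous_in_subspaceT => x; rewrite inE => -[/annd xd _].
  by apply: continuous_comp; [exact: cG|exact: sqnorm_continuous].
have clf : closed (f @` Z).
  by apply: compact_closed; [exact: norm_hausdorff|exact: continuous_compact].
have nf0 : ~ (f @` Z) 0.
  move=> [x [xh xcl] /eqP]; rewrite sqnorm_eq0 => /eqP Gx.
  have x0 : x = 0 by apply: hM => //; exact: annd.
  move: xh; rewrite /= x0 sqnormE dotp0l => /andP[+ _].
  by rewrite leNgt divr_gt0.
have /nbhs_ballP[mu /= mu0 Hmu] : nbhs (0 : R) (~` (f @` Z)).
  by apply: open_nbhs_nbhs; split => //; exact: closed_openC.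
exists lo, hi, (mu / 2); split.
- by rewrite divr_gt0.
- by apply: ine => //; rewrite /a /b ?ge_min ?le_max lexx.
- by apply: ine => //; rewrite /a /b ?ge_min ?le_max lexx orbT.
- exact: annd.
- split=> x [/andP[x1 x2] nCx].
    move=> Gs rk; apply: (Hmu (f x)).
      rewrite -ball_normE/= sub0r normrN ger0_norm ?sqnorm_ge0//.
      by apply: le_lt_trans Gs _; lra.
    exists x => //; split; first by rewrite /= !ltW.
    (* Two closures are entered: the one in the definition of [milnor_set], then the one of its part
       off G^-1(C). *)
    by apply: subset_closure; split => //; apply: subset_closure.
  have xd : `|x| < d by apply: annd; rewrite !ltW.
  move=> rk; apply: (nCx); apply: (hP x xd); apply: subset_closure; split=> //.
  by move=> Gx; apply: nCx; rewrite Gx.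
Qed.

End germs.

Theorem theorem3p6 (R : realType) (m p : nat) (hp : (2 <= p)%N) (hmp : (p < m)%N)
    (G : 'rV[R]_m -> 'rV[R]_p) (C : set 'rV[R]_p)
    (hG : analytic_germ G)
    (hnc : nonconstant_germ G)
    (hnice : nice G)
    (hrad : radial_disc G C)
    (hmilnor : germ_sub
       (closure (milnor_set G `\` G @^-1` C) `&` zero_set G) [set 0])
    (hreg : rho_regular G C) :
  milnor_hamm_sphere_fibration G C.
Proof.
have [coneC hdisc] := hrad.
(* One radius is enough: C inherits closedness from any closed set with the same germ. *)
have [e eC] : exists e : R, germ_eq (disc G e) C.
  exact: (@filter_ex _ _ (at_right_proper_filter 0) _ hdisc).
have clC : closed C := closed_cone_of_germ coneC (@closed_disc R m p G e) eC.
have [r r0 cG] := analytic_at_class_C (nbhs_singleton hG.2).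
have /nbhs_ballP[d1 /= d10 h1] := hmilnor.
have /nbhs_ballP[d2 /= d20 h2] := hreg.
have inb (x : 'rV[R]_m) d : `|x| < d -> ball (0 : 'rV[R]_m) d x.
  by rewrite -ball_normE/= sub0r normrN.
(* On the ball of radius d the map is smooth and both germ inclusions hold as inclusions of sets, so
   d itself is the bound on the radii of the spheres. *)
pose d := Num.min r (Num.min d1 d2).
have d0 : 0 < d by rewrite !lt_min r0 d10.
have dP (x : 'rV[R]_m) : `|x| < d -> [/\ `|x| < r, `|x| < d1 & `|x| < d2].
  by rewrite !lt_min => /and3P[].
have A e1 e2 h h' h'' := @milnor_annulus R m p G C d e1 e2 h h' h'' coneC.1.
exists d => //; split.
- move=> e1 he1; have [|||lo [hi [mu0 [mu00 in1 _ ann [rk1 rk2]]]]] := A e1 e1 _ _ _ he1 he1.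
  + by move=> x /dP[xr _ _]; exact: (cG 0).
  + by move=> x /dP[_ x1 _] /(h1 _ (inb _ _ x1)).
  + by move=> x /dP[_ _ x2] /(h2 _ (inb _ _ x2)).
  + have /andP[e10 _] := he1.
    have annr (x : 'rV[R]_m) : lo <= sqnorm x <= hi -> `|x| < r by move=> h; have [] := dP x (ann x h).
    exact: (sphere_psi_fibration cG annr clC coneC rk1 rk2 mu00 e10 in1).
- move=> e1 e2 he1 he2; have [|||lo [hi [mu0 [mu00 in1 in2 ann [rk1 rk2]]]]] := A e1 e2 _ _ _ he1 he2.
  + by move=> x /dP[xr _ _]; exact: (cG 0).
  + by move=> x /dP[_ x1 _] /(h1 _ (inb _ _ x1)).
  + by move=> x /dP[_ _ x2] /(h2 _ (inb _ _ x2)).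
  + have /andP[e10 _] := he1; have /andP[e20 _] := he2.
    have annr (x : 'rV[R]_m) : lo <= sqnorm x <= hi -> `|x| < r by move=> h; have [] := dP x (ann x h).
    exact: (sphere_radial_iso cG annr clC coneC rk1 rk2 mu00 e10 e20 in1 in2).
Qed.
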